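(* Let $K\in\mathbb{R}$. Points of $\mathbb{R}^3\setminus\{(0,0,0)\}$ have unique realizations, up to isometry of the model space, as follows: 1. A point in $T^+$ is realized by a unique triangle in $S_K$, provided the sum of its coordinates is $<2\pi/\sqrt{K}$. A point in $T^-$ is realized by a unique triangle in $-S_K$, provided the sum of its coordinates is $>-2\pi/\sqrt{K}$. 2. A point in $D^+$ is realized by unique triangles in $S_K$ and $M_K$, provided the largest coordinate is $<\pi/\sqrt{K}$. A point in $D^-$ is realized by unique triangles in $-S_K$ and $M_K$, provided the smallest coordinate is $>-\pi/\sqrt{K}$. 3. A point in the complement of $T^+\cup T^-\cup D^+\cup D^-\cup\{(0,0,0)\}$ is realized by a unique triangle in $M_0=\mathbb{R}^2_1$. For $K>0$, if the largest coordinate is $<\pi/\sqrt{K}$, the point is realized by a unique triangle in $M_K$. For $K<0$, if the smallest coordinate is $>-\pi/\sqrt{-K}$, the point is realized by a unique triangle in $M_K$.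
   Context: Set $\pi/\sqrt{k}=\infty$ if $k\le 0$. All geodesics are parametrized by $[0,1]$; the signed length of a geodesic $\gamma$ is $|\gamma|=\operatorname{sgn}(E)\sqrt{|E|}$ with $E=\langle\gamma'(0),\gamma'(0)\rangle$ (so the timelike sign is negative). A triangle consists of three points joined by three geodesic sides, and its sidelengths are the signed lengths of its sides; triangles may be degenerate. A point of $\mathbb{R}^3$ is realized in a model space if its coordinates are the (signed) sidelengths of a triangle there. The model spaces are $S_K$, $M_K$ and $-S_K$: $S_K$ is the simply connected 2-dimensional Riemannian space form of constant curvature $K$; $M_K$ is the simply connected 2-dimensional Lorentz space form of constant curvature $K$ (for $K=0$, the Minkowski plane $\mathbb{R}^2_1$); $-S_K$ is $S_K$ with the sign of the metric switched, a space of constant curvature $-K$. $T^+\subset\mathbb{R}^3$ is the set of triples of positive numbers the largest of which is less than the sum of the other two, and $T^-=-T^+$ is the set of their negatives. A triple is degenerate if one of its entries is the sum of the other two. $D^+$ is the set of points of $\mathbb{R}^3\setminus\{(0,0,0)\}$ whose coordinates are nonnegative degenerate triples, and $D^-=-D^+$ is the set of their negatives.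
   Formalization: For D^- in M_K with K<0, uniqueness of the triangle with its sides is proved only if no sidelength is -nπ/√(-K), n≥1 (it fails otherwise, e.g. K=-1, (-π,-1,-π-1)); existence and uniqueness of the vertices up to isometry are proved always. *)

(* Defs.v *)
From Stdlib Require Import Reals.
From Coquelicot Require Import Coquelicot.
Open Scope R_scope.

(** Triples of reals serve both as points of the coordinate spaces carrying the
    model spaces and as points of R^3 to be realized as sidelengths. *)

Definition triple : Type := (R * R * R)%type.

Definition co1 (p : triple) : R := fst (fst p).
Definition co2 (p : triple) : R := snd (fst p).
Definition co3 (p : triple) : R := snd p.

Definition tzero : triple := (0, 0, 0).
Definition topp (x : triple) : triple := (- co1 x, - co2 x, - co3 x).

(** * Curves in R^3 *)

Definition curve_derivable (c : R -> triple) (s : R) : Prop :=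
  ex_derive (fun u => co1 (c u)) s /\
  ex_derive (fun u => co2 (c u)) s /\
  ex_derive (fun u => co3 (c u)) s.

Definition vel (c : R -> triple) (s : R) : triple :=
  (Derive (fun u => co1 (c u)) s,
   Derive (fun u => co2 (c u)) s,
   Derive (fun u => co3 (c u)) s).

(** * Immersed semi-Riemannian surfaces

    A surface is a closed smooth surface [carrier] in R^3, together with a
    smooth map [dev] of R^3 that restricts to an immersion of [carrier] into
    the semi-Euclidean space R^3 with scalar product
    [sg1 x1 y1 + sg2 x2 y2 + sg3 x3 y3].  Its metric is the induced one (the
    first fundamental form of [dev]).  Having [dev] different from the identity
    is what allows universal covers of quadrics. *)

Record surface : Type := Surface {
  carrier : triple -> Prop;
  dev : triple -> triple;
  sg1 : R; sg2 : R; sg3 : R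
}.

Definition form (M : surface) (v w : triple) : R :=
  sg1 M * co1 v * co1 w + sg2 M * co2 v * co2 w + sg3 M * co3 v * co3 w.

Definition curve_in (M : surface) (c : R -> triple) : Prop :=
  forall s, carrier M (c s).

(** The image of the velocity of [c] under the differential of [dev]. *)
Definition dvel (M : surface) (c : R -> triple) : R -> triple :=
  vel (fun u => dev M (c u)).

(** Geodesics of an immersed semi-Riemannian surface are the curves whose
    acceleration in the ambient flat space is normal to the surface; every
    tangent vector at [g s] is the velocity of some curve [c] as below.  A
    smooth curve on [0,1] is one extending smoothly to a neighbourhood of
    [0,1], hence [e]; the values of [g] outside of [0,1] are irrelevant. *)
Definition geodesic (M : surface) (g : R -> triple) : Prop :=
  exists e : R, 0 < e /\
  forall s, - e < s < 1 + e ->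
    carrier M (g s) /\
    curve_derivable g s /\ curve_derivable (vel g) s /\
    forall c : R -> triple,
      curve_in M c -> c 0 = g s -> curve_derivable c 0 ->
      form M (vel (dvel M g) s) (dvel M c 0) = 0.

Definition signed_length (M : surface) (g : R -> triple) : R :=
  let E := form M (dvel M g 0) (dvel M g 0) in sign E * sqrt (Rabs E).

(** C^1 maps of R^3: Frechet differentiable with continuous differential. *)
Definition C1_map (f : triple -> triple) : Prop :=
  exists D : triple -> triple -> triple, forall p,
    filterdiff f (locally p) (D p) /\
    forall v, continuous (fun q => D q v) p.

(** Diffeomorphisms of [carrier M] preserving the metric.  Smooth maps on a
    closed submanifold are the restrictions of smooth maps of the ambient space;
    class C^1 suffices, since C^1 isometries of smooth metrics are smooth. *)
Definition isometry (M : surface) (f : triple -> triple) : Prop :=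
  C1_map f /\
  (exists f' : triple -> triple, C1_map f' /\
     forall p, carrier M p ->
       carrier M (f p) /\ carrier M (f' p) /\ f' (f p) = p /\ f (f' p) = p) /\
  forall (c : R -> triple) (s : R),
    curve_in M c -> curve_derivable c s ->
    form M (dvel M (fun u => f (c u)) s) (dvel M (fun u => f (c u)) s)
    = form M (dvel M c s) (dvel M c s).

(** * Triangles *)

Record geodesic_triangle : Type := Triangle {
  vA : triple; vB : triple; vC : triple;
  sAB : R -> triple; sBC : R -> triple; sAC : R -> triple
}.

Definition joins (M : surface) (g : R -> triple) (p q : triple) : Prop :=
  geodesic M g /\ g 0 = p /\ g 1 = q.

Definition is_triangle (M : surface) (T : geodesic_triangle) : Prop :=
  joins M (sAB T) (vA T) (vB T) /\
  joins M (sBC T) (vB T) (vC T) /\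
  joins M (sAC T) (vA T) (vC T).

Definition realizes (M : surface) (T : geodesic_triangle) (x : triple) : Prop :=
  is_triangle M T /\
  signed_length M (sAB T) = co1 x /\
  signed_length M (sBC T) = co2 x /\
  signed_length M (sAC T) = co3 x.

Definition maps_vertices (f : triple -> triple) (T T' : geodesic_triangle) : Prop :=
  f (vA T) = vA T' /\ f (vB T) = vB T' /\ f (vC T) = vC T'.

Definition maps_sides (f : triple -> triple) (T T' : geodesic_triangle) : Prop :=
  forall s, 0 <= s <= 1 ->
    f (sAB T s) = sAB T' s /\ f (sBC T s) = sBC T' s /\ f (sAC T s) = sAC T' s.

(** A triangle, as vertices joined by sides, is unique up to isometry. *)
Definition uniquely_realized (M : surface) (x : triple) : Prop :=
  (exists T, realizes M T x) /\
  forall T T', realizes M T x -> realizes M T' x ->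
    exists f, isometry M f /\ maps_vertices f T T' /\ maps_sides f T T'.

(** Only the vertices are unique up to isometry. *)
Definition uniquely_realized_vertices (M : surface) (x : triple) : Prop :=
  (exists T, realizes M T x) /\
  forall T T', realizes M T x -> realizes M T' x ->
    exists f, isometry M f /\ maps_vertices f T T'.

(** * Model spaces *)

Definition plane (p : triple) : Prop := co3 p = 0.

(** S_K: the plane if K = 0, the sphere of radius 1/sqrt K if K > 0, and the
    upper sheet of the hyperboloid - x^2 + y^2 + z^2 = 1/K in Minkowski space
    if K < 0. *)
Definition riemann_model (K : R) : surface :=
  if Req_EM_T K 0 then Surface plane (fun p => p) 1 1 1
  else if Rlt_dec 0 K then
    Surface (fun p => co1 p ^ 2 + co2 p ^ 2 + co3 p ^ 2 = / K)
            (fun p => p) 1 1 1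
  else
    Surface (fun p => - co1 p ^ 2 + co2 p ^ 2 + co3 p ^ 2 = / K /\ 0 < co1 p)
            (fun p => p) (-1) 1 1.

Definition switch_sign (M : surface) : surface :=
  Surface (carrier M) (dev M) (- sg1 M) (- sg2 M) (- sg3 M).

(** The universal covering of the quadric - x^2 + y^2 + z^2 = 1/k^2. *)
Definition quadric_cover (k : R) (p : triple) : triple :=
  (sinh (k * co1 p) / k,
   cosh (k * co1 p) * cos (k * co2 p) / k,
   cosh (k * co1 p) * sin (k * co2 p) / k).

(** M_K: the Minkowski plane if K = 0.  If K <> 0, the quadric of curvature K in
    R^3 is not simply connected, and M_K is its universal cover, with global
    coordinates (t,s).  With k = sqrt |K|, the induced metric is
    - dt^2 + cosh^2 (k t) ds^2 if K > 0 (de Sitter) and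
    dt^2 - cosh^2 (k t) ds^2 if K < 0 (anti-de Sitter). *)
Definition lorentz_model (K : R) : surface :=
  if Req_EM_T K 0 then Surface plane (fun p => p) (-1) 1 1
  else if Rlt_dec 0 K then
    Surface plane (quadric_cover (sqrt K)) (-1) 1 1
  else
    Surface plane (quadric_cover (sqrt (- K))) 1 (-1) (-1).

(** * Sets of triples *)

Definition largest (x : triple) : R := Rmax (Rmax (co1 x) (co2 x)) (co3 x).
Definition smallest (x : triple) : R := Rmin (Rmin (co1 x) (co2 x)) (co3 x).
Definition total (x : triple) : R := co1 x + co2 x + co3 x.

Definition T_pos (x : triple) : Prop :=
  0 < co1 x /\ 0 < co2 x /\ 0 < co3 x /\ largest x < total x - largest x.

Definition T_neg (x : triple) : Prop := T_pos (topp x).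

Definition degenerate (x : triple) : Prop :=
  co1 x = co2 x + co3 x \/ co2 x = co1 x + co3 x \/ co3 x = co1 x + co2 x.

Definition D_pos (x : triple) : Prop :=
  x <> tzero /\ 0 <= co1 x /\ 0 <= co2 x /\ 0 <= co3 x /\ degenerate x.

Definition D_neg (x : triple) : Prop := D_pos (topp x).

Definition pi_over_sqrt (k : R) : Rbar :=
  if Rlt_dec 0 k then Finite (PI / sqrt k) else p_infty.

(** If K < 0, all timelike geodesics of M_K issuing from a point p meet again at
    the signed lengths - n PI / sqrt (- K), n = 1, 2, ...  A side of such a
    length is not determined by its endpoints: for instance, the sidelengths
    (- PI, - 1, - PI - 1) are realized in M_K, K = -1, by triangles with the
    same vertices but non-congruent triples of sides.  There are no conjugate
    lengths below 0 if K >= 0. *)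
Definition no_conjugate_timelike_side (K : R) (x : triple) : Prop :=
  K < 0 -> forall n : nat, (0 < n)%nat ->
    co1 x <> - (INR n * (PI / sqrt (- K))) /\
    co2 x <> - (INR n * (PI / sqrt (- K))) /\
    co3 x <> - (INR n * (PI / sqrt (- K))).

(* Main.v *)
(** A geodesic of a quadric [<p,p> = 1/K] solves [p'' = - K E p], where [E] is its
    constant energy; hence the signed sidelengths of a triangle determine the Gram
    matrix of its vertices, and, away from conjugate lengths, the vertices determine
    the sides.  If some side is not null the Gram matrix determines the vertices up to
    a linear isometry, even when it is singular.  For the Lorentz quadric that isometry
    lifts to the universal cover with any prescribed image of one vertex, and since
    lifts of curves are unique it then maps the whole triangle correctly.

    For existence, degenerate triples are realized on a geodesic line and all others
    by explicit vertices, the sign of the Gram determinant being read off from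
    factorizations such as
    [1 + 2xyz - x^2 - y^2 - z^2 = - (z - cos (a+b)) (z - cos (a-b))] for [x = cos a],
    [y = cos b].  In the Lorentz quadric the vertices of a nondegenerate triangle can be
    moved into an open half space; there the covering has a section, so that the
    triangle closes up in the universal cover.

    At conjugate timelike lengths only the vertices are determined.  All of them lie
    on one geodesic: a lift fixing the base point moves the polar angle by less than
    pi, up to a reflection, which rules out the wrong side of a conjugate point. *)

Require Import Defs.
From Stdlib Require Import Reals ZArith Lra Lia Psatz.
From Coquelicot Require Import Coquelicot.
Open Scope R_scope.

(** * Generalized trigonometric functions *)

(** Two devices shape the proof. Lorentz surfaces of negative curvature are never treated directly:
    switching the sign of the metric turns [lorentz_model K] into the model of curvature [- K] and
    negates all lengths, so that conjugate timelike lengths reappear as lengths of spacelike sides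
    in the de Sitter cover. The record [quadric_surface] collects what uniqueness asks of a model,
    so one argument serves the sphere, the hyperbolic plane and that cover. The laborious field of
    this record is the lifting of linear isometries. An isometry has to be a C^1 map of the ambient
    space with a C^1 inverse, so a lift is composed of explicit maps: shifts of the angle,
    reflections and boosts. For a boost the new angle must be a smooth function of the point,
    although polar angles are multivalued. It is taken as the old angle plus the turn from the old
    polar direction to the new one; a boost never makes these opposite, so the half-angle formula
    for the turn has a nonzero denominator everywhere. *)

Definition gcos (k s : R) : R :=
  if Rlt_dec 0 k then cos (sqrt k * s)
  else if Req_EM_T k 0 then 1 else cosh (sqrt (- k) * s).

(** [gcos k] and [gsin k] solve u'' = - k u with initial data (1, 0) and (0, 1). Taking k as the
    curvature times the energy of a side treats spacelike, null and timelike sides alike. *)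
Definition gsin (k s : R) : R :=
  if Rlt_dec 0 k then sin (sqrt k * s) / sqrt k
  else if Req_EM_T k 0 then s else sinh (sqrt (- k) * s) / sqrt (- k).

Lemma is_derive_cosh (x : R) : is_derive cosh x (sinh x).
Proof. apply is_derive_Reals, derivable_pt_lim_cosh. Qed.

Lemma is_derive_sinh (x : R) : is_derive sinh x (cosh x).
Proof. apply is_derive_Reals, derivable_pt_lim_sinh. Qed.

Lemma cosh2_sinh2 (x : R) : cosh x * cosh x = 1 + sinh x * sinh x.
Proof.
  unfold cosh, sinh.
  assert (H : exp x * exp (- x) = 1) by (rewrite <- exp_plus, Rplus_opp_r; apply exp_0).
  nra.
Qed.

Lemma cosh_pos (x : R) : 0 < cosh x.
Proof. unfold cosh. pose proof (exp_pos x); pose proof (exp_pos (- x)); lra. Qed.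

Lemma is_derive_gsin (k s : R) : is_derive (gsin k) s (gcos k s).
Proof.
  unfold gsin, gcos. destruct (Rlt_dec 0 k) as [Hk|Hk].
  - pose proof (sqrt_lt_R0 k Hk). auto_derive; trivial. field. lra.
  - destruct (Req_EM_T k 0) as [H0|H0].
    + auto_derive; trivial.
    + assert (H : 0 < sqrt (- k)) by (apply sqrt_lt_R0; lra).
      evar_last.
      apply (is_derive_comp (fun t => sinh t / sqrt (- k)) (fun s => sqrt (- k) * s)).
      apply (is_derive_ext (fun t => scal (/ sqrt (- k)) (sinh t))).
      { intros t; unfold scal; simpl; unfold mult; simpl; unfold Rdiv; ring. }
      apply is_derive_scal, is_derive_sinh.
      auto_derive; trivial.
      unfold scal; simpl; unfold mult; simpl. field. lra.
Qed.

Lemma is_derive_gcos (k s : R) : is_derive (gcos k) s (- k * gsin k s).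
Proof.
  unfold gsin, gcos. destruct (Rlt_dec 0 k) as [Hk|Hk].
  - pose proof (sqrt_lt_R0 k Hk). auto_derive; trivial.
    rewrite <- (sqrt_sqrt k) at 3 by lra. field. lra.
  - destruct (Req_EM_T k 0) as [H0|H0].
    + auto_derive; trivial. rewrite H0; ring.
    + assert (H : 0 < sqrt (- k)) by (apply sqrt_lt_R0; lra).
      evar_last.
      apply (is_derive_comp cosh (fun s => sqrt (- k) * s)).
      apply is_derive_cosh.
      auto_derive; trivial.
      unfold scal; simpl; unfold mult; simpl.
      replace (- k) with (sqrt (- k) * sqrt (- k)) at 3 by (apply sqrt_sqrt; lra). field. lra.
Qed.

Lemma gcos_0 (k : R) : gcos k 0 = 1.
Proof.
  unfold gcos. rewrite !Rmult_0_r. destruct (Rlt_dec 0 k); [apply cos_0|].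
  destruct (Req_EM_T k 0); [reflexivity | apply cosh_0].
Qed.

Lemma gsin_0 (k : R) : gsin k 0 = 0.
Proof.
  unfold gsin. rewrite !Rmult_0_r, sin_0, sinh_0. unfold Rdiv. rewrite !Rmult_0_l.
  destruct (Rlt_dec 0 k); [reflexivity|]. destruct (Req_EM_T k 0); reflexivity.
Qed.

Lemma gcos2_gsin2 (k s : R) : gcos k s * gcos k s + k * (gsin k s * gsin k s) = 1.
Proof.
  unfold gsin, gcos. destruct (Rlt_dec 0 k) as [Hk|Hk].
  - pose proof (sqrt_lt_R0 k Hk). pose proof (sin2_cos2 (sqrt k * s)) as H1.
    unfold Rsqr in H1. rewrite <- H1. rewrite <- (sqrt_sqrt k) at 3 by lra. field. lra.
  - destruct (Req_EM_T k 0) as [H0|H0]; [rewrite H0; ring|].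
    assert (H : 0 < sqrt (- k)) by (apply sqrt_lt_R0; lra).
    rewrite cosh2_sinh2.
    replace (k * _) with (- (sinh (sqrt (- k) * s) * sinh (sqrt (- k) * s)) *
      ((- k) / (sqrt (- k) * sqrt (- k)))) by (field; lra).
    rewrite sqrt_sqrt by lra. field. lra.
Qed.

Lemma is_derive_zero_const (f : R -> R) (a b x y : R) :
  (forall s, a < s < b -> is_derive f s 0) -> a < x < b -> a < y < b -> f x = f y.
Proof.
  intros Hf Hx Hy.
  destruct (MVT_gen f y x (fun _ => 0)) as [c [_ Hc]].
  - intros z Hz. apply Hf. unfold Rmin, Rmax in Hz. destruct (Rle_dec y x); lra.
  - intros z Hz. apply continuity_pt_filterlim, (ex_derive_continuous (V := R_NormedModule)).
    exists 0. apply Hf. unfold Rmin, Rmax in Hz. destruct (Rle_dec y x); lra.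
  - lra.
Qed.

(** The combinations [u * gcos - v * gsin] and [k * u * gsin + v * gcos] have zero derivative;
    [gcos2_gsin2] then solves them for [u]. *)
Lemma oscillator_unique (k a b : R) (u v : R -> R) :
  a < 0 < b ->
  (forall s, a < s < b -> is_derive u s (v s)) ->
  (forall s, a < s < b -> is_derive v s (- k * u s)) ->
  forall s, a < s < b -> u s = u 0 * gcos k s + v 0 * gsin k s.
Proof.
  intros H0 Hu Hv s Hs.
  assert (Hp : u s * gcos k s - v s * gsin k s = u 0 * gcos k 0 - v 0 * gsin k 0).
  { apply (is_derive_zero_const (fun s => u s * gcos k s - v s * gsin k s) a b); trivial.
    intros t Ht. evar_last.
    apply (is_derive_minus (fun s => u s * gcos k s) (fun s => v s * gsin k s)).
    apply (is_derive_mult u (gcos k)). apply Hu, Ht. apply is_derive_gcos.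
    intros; apply Rmult_comm.
    apply (is_derive_mult v (gsin k)). apply Hv, Ht. apply is_derive_gsin.
    intros; apply Rmult_comm.
    unfold minus, plus, opp, mult; simpl. ring. }
  assert (Hq : k * u s * gsin k s + v s * gcos k s = k * u 0 * gsin k 0 + v 0 * gcos k 0).
  { apply (is_derive_zero_const (fun s => k * u s * gsin k s + v s * gcos k s) a b); trivial.
    intros t Ht. evar_last.
    apply (is_derive_plus (fun s => k * u s * gsin k s) (fun s => v s * gcos k s)).
    apply (is_derive_mult (fun s => k * u s) (gsin k)).
    apply (is_derive_scal u). apply Hu, Ht. apply is_derive_gsin.
    intros; apply Rmult_comm.
    apply (is_derive_mult v (gcos k)). apply Hv, Ht. apply is_derive_gcos.
    intros; apply Rmult_comm.
    unfold plus, mult; simpl. ring. }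
  rewrite gcos_0, gsin_0 in Hp, Hq.
  replace (u s) with (u s * (gcos k s * gcos k s + k * (gsin k s * gsin k s)))
    by (rewrite gcos2_gsin2; ring).
  replace (u 0) with (u s * gcos k s - v s * gsin k s) by lra.
  replace (v 0) with (k * u s * gsin k s + v s * gcos k s) by lra.
  ring.
Qed.

Lemma gsin_one_minus (k s : R) : gsin k (1 - s) = gsin k 1 * gcos k s - gcos k 1 * gsin k s.
Proof.
  (* Any interval around both 0 and [s] will do. *)
  rewrite (oscillator_unique k (Rmin 0 s - 1) (Rmax 0 s + 1)
    (fun t => gsin k (1 - t)) (fun t => - gcos k (1 - t))).
  - rewrite Rminus_0_r. ring.
  - unfold Rmin, Rmax; destruct (Rle_dec 0 s); lra.
  - intros t _. evar_last.
    apply (is_derive_comp (gsin k) (fun t => 1 - t)). apply is_derive_gsin.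
    auto_derive; trivial. unfold scal; simpl; unfold mult; simpl. ring.
  - intros t _. evar_last.
    apply (is_derive_opp (fun t => gcos k (1 - t))).
    apply (is_derive_comp (gcos k) (fun t => 1 - t)). apply is_derive_gcos.
    auto_derive; trivial. unfold opp, scal; simpl; unfold mult; simpl. ring.
  - unfold Rmin, Rmax; destruct (Rle_dec 0 s); lra.
Qed.

Lemma sinh_pos (x : R) : 0 < x -> 0 < sinh x.
Proof. intros H. rewrite <- sinh_0. apply sinh_lt, H. Qed.

(** For positive k the first positive zero is at PI / sqrt k, which lies beyond time 1 exactly when
    k < PI^2. *)
Lemma gsin_pos (k s : R) : k < PI * PI -> 0 < s <= 1 -> 0 < gsin k s.
Proof.
  intros Hk Hs. unfold gsin. destruct (Rlt_dec 0 k) as [H|H].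
  - pose proof (sqrt_lt_R0 k H) as H1.
    assert (sqrt k < PI).
    { rewrite <- (sqrt_square PI). apply sqrt_lt_1; try lra. pose proof PI_RGT_0; lra. }
    apply Rdiv_lt_0_compat; trivial. apply sin_gt_0; nra.
  - destruct (Req_EM_T k 0); [lra|].
    assert (H1 : 0 < sqrt (- k)) by (apply sqrt_lt_R0; lra).
    apply Rdiv_lt_0_compat; trivial. apply sinh_pos. nra.
Qed.

(** For k = K E, a zero at time 1 means that the far end of the side is conjugate to its start. *)
Lemma gsin_eq_0 (k : R) : gsin k 1 = 0 -> 0 < k /\ exists n : nat, (0 < n)%nat /\ sqrt k = INR n * PI.
Proof.
  unfold gsin. rewrite !Rmult_1_r. destruct (Rlt_dec 0 k) as [H|H].
  - intros Hs. split; trivial. pose proof (sqrt_lt_R0 k H) as H1.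
    assert (H2 : sin (sqrt k) = 0).
    { replace (sin (sqrt k)) with (sin (sqrt k) / sqrt k * sqrt k) by (field; lra). rewrite Hs; ring. }
    destruct (sin_eq_0_0 _ H2) as [z Hz].
    pose proof PI_RGT_0.
    assert (Hz0 : (0 < z)%Z).
    { apply lt_IZR. apply Rmult_lt_reg_r with PI; [trivial|]. lra. }
    exists (Z.to_nat z). split; [lia|]. rewrite INR_IZR_INZ, Z2Nat.id by lia. exact Hz.
  - destruct (Req_EM_T k 0); [lra|]. intros Hs. exfalso.
    assert (H1 : 0 < sqrt (- k)) by (apply sqrt_lt_R0; lra).
    pose proof (sinh_pos _ H1). pose proof (Rdiv_lt_0_compat _ _ H0 H1). lra.
Qed.

(** * Linear isometries of a scalar product on R^3 *)

Definition dot (J v w : triple) : R :=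
  co1 J * co1 v * co1 w + co2 J * co2 v * co2 w + co3 J * co3 v * co3 w.

(** All linear combinations are put in this one shape, shorter ones padded by zero coefficients, so
    that [isom_lin] alone expresses linearity. *)
Definition lin3 (a : R) (A : triple) (b : R) (B : triple) (c : R) (C : triple) : triple :=
  (a * co1 A + b * co1 B + c * co1 C,
   a * co2 A + b * co2 B + c * co2 C,
   a * co3 A + b * co3 B + c * co3 C).

Definition det3 (A B C : triple) : R :=
  co1 A * (co2 B * co3 C - co3 B * co2 C)
  - co2 A * (co1 B * co3 C - co3 B * co1 C)
  + co3 A * (co1 B * co2 C - co2 B * co1 C).

Definition unit_signs (J : triple) : Prop :=
  co1 J * co1 J = 1 /\ co2 J * co2 J = 1 /\ co3 J * co3 J = 1.

Lemma triple_eq (p q : triple) : co1 p = co1 q -> co2 p = co2 q -> co3 p = co3 q -> p = q.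
Proof.
  destruct p as [[p1 p2] p3], q as [[q1 q2] q3]; unfold co1, co2, co3; simpl.
  intros -> -> ->; reflexivity.
Qed.

Ltac coordwise := apply triple_eq; unfold lin3, co1, co2, co3; simpl.

Ltac triple_ring :=
  repeat match goal with p : triple |- _ => destruct p as [[? ?] ?] end;
  try apply triple_eq; unfold dot, det3, lin3, co1, co2, co3; simpl; ring.

Lemma dot_comm (J v w : triple) : dot J v w = dot J w v.
Proof. triple_ring. Qed.

Lemma dot_lin3_l (J A B C w : triple) (a b c : R) :
  dot J (lin3 a A b B c C) w = a * dot J A w + b * dot J B w + c * dot J C w.
Proof. triple_ring. Qed.

Lemma dot_lin3_r (J A B C w : triple) (a b c : R) :
  dot J w (lin3 a A b B c C) = a * dot J w A + b * dot J w B + c * dot J w C.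
Proof. triple_ring. Qed.

Lemma unit_signs_neq (J : triple) : unit_signs J -> co1 J * co2 J * co3 J <> 0.
Proof.
  intros (H1 & H2 & H3) H.
  assert (E : (co1 J * co2 J * co3 J) * (co1 J * co2 J * co3 J) = 1).
  { transitivity ((co1 J * co1 J) * (co2 J * co2 J) * (co3 J * co3 J)); [ring|].
    rewrite H1, H2, H3; ring. }
  rewrite H in E; lra.
Qed.

Definition gram_det (aa bb cc ab bc ac : R) : R :=
  aa * (bb * cc - bc * bc) - ab * (ab * cc - bc * ac) + ac * (ab * bc - bb * ac).

(** Hence the Gram matrix decides whether its vectors form a frame, whichever vectors realize it. *)
Lemma gram_det_eq (J A B C : triple) :
  gram_det (dot J A A) (dot J B B) (dot J C C) (dot J A B) (dot J B C) (dot J A C)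
  = co1 J * co2 J * co3 J * (det3 A B C * det3 A B C).
Proof. unfold gram_det. triple_ring. Qed.

Lemma cramer (A B C v : triple) : det3 A B C <> 0 ->
  v = lin3 (det3 v B C / det3 A B C) A (det3 A v C / det3 A B C) B (det3 A B v / det3 A B C) C.
Proof.
  intros H.
  repeat match goal with p : triple |- _ => destruct p as [[? ?] ?] end.
  unfold det3, co1, co2, co3 in H; simpl in H.
  unfold det3; coordwise; field; exact H.
Qed.

Lemma det3_lin3 (A B C P Q S : triple) (a b c : R) :
  det3 (lin3 a P b Q c S) B C = a * det3 P B C + b * det3 Q B C + c * det3 S B C /\
  det3 A (lin3 a P b Q c S) C = a * det3 A P C + b * det3 A Q C + c * det3 A S C /\
  det3 A B (lin3 a P b Q c S) = a * det3 A B P + b * det3 A B Q + c * det3 A B S.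
Proof. repeat split; triple_ring. Qed.

Record lin_isom (J : triple) (L : triple -> triple) : Prop := {
  isom_lin : forall a A b B c C, L (lin3 a A b B c C) = lin3 a (L A) b (L B) c (L C);
  isom_dot : forall v w, dot J (L v) (L w) = dot J v w
}.

(** The inverse is carried along because [isometry] asks for a smooth inverse map. *)
Record isom_pair (J : triple) (L L' : triple -> triple) : Prop := {
  pair_isom : lin_isom J L;
  pair_isom' : lin_isom J L';
  pair_l : forall v, L' (L v) = v;
  pair_r : forall v, L (L' v) = v
}.

Arguments isom_lin {J L} _.
Arguments isom_dot {J L} _.
Arguments pair_isom {J L L'} _.
Arguments pair_isom' {J L L'} _.
Arguments pair_l {J L L'} _.
Arguments pair_r {J L L'} _.

(** The Cramer coordinates of [v] in the frame A, B, C are reused in the frame A', B', C'. *)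
Definition frame_map (A B C A' B' C' v : triple) : triple :=
  lin3 (det3 v B C / det3 A B C) A' (det3 A v C / det3 A B C) B' (det3 A B v / det3 A B C) C'.

Lemma frame_map_frame (A B C A' B' C' : triple) : det3 A B C <> 0 ->
  frame_map A B C A' B' C' A = A' /\ frame_map A B C A' B' C' B = B' /\
  frame_map A B C A' B' C' C = C'.
Proof.
  intros H.
  assert (E : forall D : R, D <> 0 -> D / D = 1) by (intros; field; trivial).
  assert (H1 : det3 B B C = 0) by triple_ring.
  assert (H2 : det3 C B C = 0) by triple_ring.
  assert (H3 : det3 A A C = 0) by triple_ring.
  assert (H4 : det3 A C C = 0) by triple_ring.
  assert (H5 : det3 A B A = 0) by triple_ring.
  assert (H6 : det3 A B B = 0) by triple_ring.
  unfold frame_map. rewrite H1, H2, H3, H4, H5, H6, (E _ H). unfold Rdiv. rewrite !Rmult_0_l.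
  clear. repeat split; triple_ring.
Qed.

Lemma frame_map_lin (A B C A' B' C' P Q S : triple) (a b c : R) : det3 A B C <> 0 ->
  frame_map A B C A' B' C' (lin3 a P b Q c S) =
  lin3 a (frame_map A B C A' B' C' P) b (frame_map A B C A' B' C' Q) c (frame_map A B C A' B' C' S).
Proof.
  intros H. unfold frame_map.
  destruct (det3_lin3 A B C P Q S a b c) as (-> & -> & ->).
  coordwise; field; trivial.
Qed.

Lemma gram_basis_isom (J A B C A' B' C' : triple) :
  unit_signs J -> det3 A B C <> 0 ->
  dot J A A = dot J A' A' -> dot J B B = dot J B' B' -> dot J C C = dot J C' C' ->
  dot J A B = dot J A' B' -> dot J B C = dot J B' C' -> dot J A C = dot J A' C' ->
  exists L L', isom_pair J L L' /\ L A = A' /\ L B = B' /\ L C = C'.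
Proof.
  intros HJ HD HAA HBB HCC HAB HBC HAC.
  (* Equal Gram matrices have equal determinants, so the image vectors form a frame too. *)
  assert (HD' : det3 A' B' C' <> 0).
  { intros H0. pose proof (gram_det_eq J A B C) as H1. pose proof (gram_det_eq J A' B' C') as H2.
    rewrite HAA, HBB, HCC, HAB, HBC, HAC, H2, H0 in H1.
    pose proof (unit_signs_neq J HJ) as HJ0.
    apply (Rmult_integral_contrapositive_currified _ _ HD) in HD.
    apply (Rmult_integral_contrapositive_currified _ _ HJ0) in HD. lra. }
  assert (Hdot : forall A B C A' B' C', det3 A B C <> 0 ->
    dot J A A = dot J A' A' -> dot J B B = dot J B' B' -> dot J C C = dot J C' C' ->
    dot J A B = dot J A' B' -> dot J B C = dot J B' C' -> dot J A C = dot J A' C' ->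
    forall v w, dot J (frame_map A B C A' B' C' v) (frame_map A B C A' B' C' w) = dot J v w).
  { clear. intros A B C A' B' C' HD HAA HBB HCC HAB HBC HAC v w.
    rewrite (cramer A B C v HD) at 2. rewrite (cramer A B C w HD) at 2.
    unfold frame_map. rewrite !dot_lin3_l, !dot_lin3_r.
    rewrite (dot_comm J B A), (dot_comm J C A), (dot_comm J C B),
      (dot_comm J B' A'), (dot_comm J C' A'), (dot_comm J C' B').
    rewrite HAA, HBB, HCC, HAB, HBC, HAC. reflexivity. }
  assert (Hinv : forall A B C A' B' C', det3 A B C <> 0 -> det3 A' B' C' <> 0 ->
    forall v, frame_map A' B' C' A B C (frame_map A B C A' B' C' v) = v).
  { clear. intros A B C A' B' C' HD HD' v. unfold frame_map at 2.
    rewrite frame_map_lin by trivial.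
    destruct (frame_map_frame A' B' C' A B C HD') as (-> & -> & ->).
    symmetry; apply cramer, HD. }
  exists (frame_map A B C A' B' C'), (frame_map A' B' C' A B C).
  split; [split|apply frame_map_frame, HD].
  - split; [intros; apply frame_map_lin, HD | apply Hdot; trivial].
  - split; [intros; apply frame_map_lin, HD' | apply Hdot; auto].
  - apply Hinv; trivial.
  - apply Hinv; trivial.
Qed.

(** The cross product with its entries multiplied by [J]; since the signs square to 1, it is
    orthogonal to [A] and [B] for the scalar product. *)
Definition normal (J A B : triple) : triple :=
  (co1 J * (co2 A * co3 B - co3 A * co2 B),
   co2 J * (co3 A * co1 B - co1 A * co3 B),
   co3 J * (co1 A * co2 B - co2 A * co1 B)).

Lemma dot_normal (J A B C : triple) : unit_signs J -> dot J C (normal J A B) = det3 A B C.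
Proof.
  intros (H1 & H2 & H3). unfold dot, normal. unfold co1 at 3, co2 at 6, co3 at 9; simpl.
  transitivity (co1 J * co1 J * co1 C * (co2 A * co3 B - co3 A * co2 B) +
    co2 J * co2 J * co2 C * (co3 A * co1 B - co1 A * co3 B) +
    co3 J * co3 J * co3 C * (co1 A * co2 B - co2 A * co1 B)); [|rewrite H1, H2, H3; triple_ring].
  triple_ring.
Qed.

Lemma dot_normal_normal (J A B : triple) : unit_signs J ->
  dot J (normal J A B) (normal J A B) =
  co1 J * co2 J * co3 J * (dot J A A * dot J B B - dot J A B * dot J A B).
Proof.
  intros (H1 & H2 & H3).
  destruct J as [[j1 j2] j3], A as [[a1 a2] a3], B as [[b1 b2] b3].
  unfold dot, normal, co1, co2, co3 in *; simpl in *.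
  transitivity (j1 * (j1*j1) * (a2 * b3 - a3 * b2) * (a2 * b3 - a3 * b2)
    + j2 * (j2*j2) * (a3 * b1 - a1 * b3) * (a3 * b1 - a1 * b3)
    + j3 * (j3*j3) * (a1 * b2 - a2 * b1) * (a1 * b2 - a2 * b1)); [ring|].
  transitivity (j1 * (j2*j2) * (j3*j3) * (a2 * b3 - a3 * b2) * (a2 * b3 - a3 * b2)
    + j2 * (j1*j1)*(j3*j3) * (a3 * b1 - a1 * b3) * (a3 * b1 - a1 * b3)
    + j3 * (j1*j1)*(j2*j2) * (a1 * b2 - a2 * b1) * (a1 * b2 - a2 * b1)); [|ring].
  rewrite H1, H2, H3. ring.
Qed.

(** If the three vectors are dependent, the cross product N completes A, B to a frame because the
    plane of A, B is nondegenerate. Then C is a combination of A and B whose coefficients solve a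
    linear system with the Gram matrix of A, B. *)
Lemma gram_isom_first (J A B C A' B' C' : triple) :
  unit_signs J -> dot J A A * dot J B B - dot J A B * dot J A B <> 0 ->
  dot J A A = dot J A' A' -> dot J B B = dot J B' B' -> dot J C C = dot J C' C' ->
  dot J A B = dot J A' B' -> dot J B C = dot J B' C' -> dot J A C = dot J A' C' ->
  exists L L', isom_pair J L L' /\ L A = A' /\ L B = B' /\ L C = C'.
Proof.
  intros HJ Hnd HAA HBB HCC HAB HBC HAC.
  pose proof (unit_signs_neq J HJ) as HJ0.
  destruct (Req_dec (det3 A B C) 0) as [HD|HD]; [|apply gram_basis_isom; trivial].
  assert (HD' : det3 A' B' C' = 0).
  { pose proof (gram_det_eq J A B C) as H1. pose proof (gram_det_eq J A' B' C') as H2.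
    rewrite <- HAA, <- HBB, <- HCC, <- HAB, <- HBC, <- HAC, H1, HD in H2.
    assert (H3 : det3 A' B' C' * det3 A' B' C' = 0).
    { apply Rmult_eq_reg_l with (co1 J * co2 J * co3 J); [lra|trivial]. }
    apply Rmult_integral in H3; tauto. }
  set (N := normal J A B). set (N' := normal J A' B').
  assert (HN : det3 A B N <> 0).
  { unfold N. rewrite <- (dot_normal J A B) by trivial. rewrite dot_normal_normal by trivial.
    apply Rmult_integral_contrapositive_currified; trivial. }
  assert (HN' : det3 A' B' N' <> 0).
  { unfold N'. rewrite <- (dot_normal J A' B') by trivial. rewrite dot_normal_normal by trivial.
    rewrite <- HAA, <- HBB, <- HAB.
    apply Rmult_integral_contrapositive_currified; trivial. }
  assert (Z : forall A B, det3 A B A = 0 /\ det3 A B B = 0)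
    by (clear; intros; split; triple_ring).
  destruct (gram_basis_isom J A B N A' B' N') as (L & L' & HL & LA & LB & LN); trivial.
  { unfold N, N'. rewrite !dot_normal_normal by trivial. rewrite HAA, HBB, HAB; reflexivity. }
  { unfold N, N'. rewrite !dot_normal by trivial. rewrite !(proj2 (Z _ _)). reflexivity. }
  { unfold N, N'. rewrite !dot_normal by trivial. rewrite !(proj1 (Z _ _)). reflexivity. }
  exists L, L'. split; [trivial|]. split; [trivial|]. split; [trivial|].
  pose proof (cramer A B N C HN) as HC. rewrite HD in HC.
  pose proof (cramer A' B' N' C' HN') as HC'. rewrite HD' in HC'.
  set (a := det3 C B N / det3 A B N) in HC. set (b := det3 A C N / det3 A B N) in HC.
  set (a' := det3 C' B' N' / det3 A' B' N') in HC'. set (b' := det3 A' C' N' / det3 A' B' N') in HC'.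
  unfold Rdiv in HC, HC'. rewrite Rmult_0_l in HC, HC'.
  rewrite HC, (isom_lin (pair_isom HL)), LA, LB, LN. rewrite HC'.
  rewrite HC, HC', dot_lin3_r, dot_lin3_r in HBC, HAC.
  rewrite (dot_comm J B A), (dot_comm J B' A'), <- HAB, <- HBB in HBC.
  rewrite <- HAB, <- HAA in HAC.
  (* Cramer's rule for the Gram system, whose determinant is nonzero by [Hnd]. *)
  assert (a = a').
  { apply Rmult_eq_reg_l with (dot J A A * dot J B B - dot J A B * dot J A B); [|trivial].
    transitivity (dot J B B * (a * dot J A A + b * dot J A B + 0 * dot J A N)
     - dot J A B * (a * dot J A B + b * dot J B B + 0 * dot J B N)); [ring|].
    rewrite HAC, HBC; ring. }
  assert (b = b').
  { apply Rmult_eq_reg_l with (dot J A A * dot J B B - dot J A B * dot J A B); [|trivial].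
    transitivity (dot J A A * (a * dot J A B + b * dot J B B + 0 * dot J B N)
     - dot J A B * (a * dot J A A + b * dot J A B + 0 * dot J A N)); [ring|].
    rewrite HAC, HBC; ring. }
  congruence.
Qed.

Lemma gram_isom (J A B C A' B' C' : triple) :
  unit_signs J ->
  (dot J A A * dot J B B - dot J A B * dot J A B <> 0 \/
   dot J B B * dot J C C - dot J B C * dot J B C <> 0 \/
   dot J A A * dot J C C - dot J A C * dot J A C <> 0) ->
  dot J A A = dot J A' A' -> dot J B B = dot J B' B' -> dot J C C = dot J C' C' ->
  dot J A B = dot J A' B' -> dot J B C = dot J B' C' -> dot J A C = dot J A' C' ->
  exists L L', isom_pair J L L' /\ L A = A' /\ L B = B' /\ L C = C'.
Proof.
  intros HJ [H|[H|H]] HAA HBB HCC HAB HBC HAC.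
  - apply gram_isom_first; trivial.
  - destruct (gram_isom_first J B C A B' C' A') as (L & L' & HL & ? & ? & ?); trivial.
    + rewrite (dot_comm J C A), (dot_comm J C' A'); trivial.
    + rewrite (dot_comm J B A), (dot_comm J B' A'); trivial.
    + exists L, L'; auto.
  - destruct (gram_isom_first J A C B A' C' B') as (L & L' & HL & ? & ? & ?); trivial.
    + rewrite (dot_comm J C B), (dot_comm J C' B'); trivial.
    + exists L, L'; auto.
Qed.

(** * Calculus on curves and C^1 maps *)

(** [Derive] has a value even where no derivative exists; [has_vel] records differentiability
    together with the velocity. *)
Definition has_vel (c : R -> triple) (s : R) (v : triple) : Prop :=
  is_derive (fun u => co1 (c u)) s (co1 v) /\
  is_derive (fun u => co2 (c u)) s (co2 v) /\
  is_derive (fun u => co3 (c u)) s (co3 v).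

Lemma has_vel_derivable (c : R -> triple) (s : R) (v : triple) :
  has_vel c s v -> curve_derivable c s.
Proof. intros (H1 & H2 & H3). repeat split; eexists; eassumption. Qed.

Lemma has_vel_vel (c : R -> triple) (s : R) (v : triple) : has_vel c s v -> vel c s = v.
Proof.
  intros (H1 & H2 & H3). unfold vel.
  coordwise; apply is_derive_unique; assumption.
Qed.

Lemma derivable_has_vel (c : R -> triple) (s : R) : curve_derivable c s -> has_vel c s (vel c s).
Proof. intros (H1 & H2 & H3). repeat split; apply Derive_correct; assumption. Qed.

Lemma has_vel_ext_loc (c d : R -> triple) (s : R) (v : triple) :
  locally s (fun u => c u = d u) -> has_vel c s v -> has_vel d s v.
Proof.
  intros H (H1 & H2 & H3).
  repeat split; eapply is_derive_ext_loc; try eassumption;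
    (eapply filter_imp; [|exact H]); intros u ->; reflexivity.
Qed.

Lemma interval_locally (a b s : R) (P : R -> Prop) :
  a < s < b -> (forall t, a < t < b -> P t) -> locally s P.
Proof.
  intros Hs HP. assert (Hp : 0 < Rmin (s - a) (b - s)) by (apply Rmin_pos; lra).
  exists (mkposreal _ Hp). intros y Hy. apply HP.
  change (Rabs (y - s) < Rmin (s - a) (b - s)) in Hy.
  pose proof (Rmin_l (s - a) (b - s)); pose proof (Rmin_r (s - a) (b - s)).
  apply Rabs_def2 in Hy. lra.
Qed.

Lemma curve_derivable_ext_loc (c d : R -> triple) (s : R) :
  locally s (fun u => c u = d u) -> curve_derivable c s -> curve_derivable d s.
Proof.
  intros H Hc. apply derivable_has_vel in Hc.
  exact (has_vel_derivable _ _ _ (has_vel_ext_loc _ _ _ _ H Hc)).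
Qed.

Lemma is_derive_mult_R (f g : R -> R) (s a b : R) :
  is_derive f s a -> is_derive g s b -> is_derive (fun u => f u * g u) s (a * g s + f s * b).
Proof. intros Hf Hg. apply (is_derive_mult f g); trivial. intros; apply Rmult_comm. Qed.

Lemma is_derive_plus_R (f g : R -> R) (s a b : R) :
  is_derive f s a -> is_derive g s b -> is_derive (fun u => f u + g u) s (a + b).
Proof. exact (is_derive_plus f g s a b). Qed.

Lemma is_derive_comp_R (f g : R -> R) (s a b : R) :
  is_derive f (g s) a -> is_derive g s b -> is_derive (fun u => f (g u)) s (a * b).
Proof.
  intros Hf Hg. evar_last. apply (is_derive_comp f g); eassumption.
  unfold scal; simpl; unfold mult; simpl. apply Rmult_comm.
Qed.

Lemma is_derive_const_R (a s : R) : is_derive (fun _ => a) s 0.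
Proof. exact (is_derive_const (V := R_NormedModule) a s). Qed.

Lemma is_derive_id_R (s : R) : is_derive (fun u : R => u) s 1.
Proof. exact (is_derive_id s). Qed.

Lemma is_derive_eq (f : R -> R) (s a b : R) : is_derive f s a -> a = b -> is_derive f s b.
Proof. intros H <-; exact H. Qed.

Lemma is_derive_scal_R (f : R -> R) (k s a : R) :
  is_derive f s a -> is_derive (fun u => k * f u) s (k * a).
Proof. exact (is_derive_scal f s k a). Qed.

Lemma has_vel_lin3 (a b d : R -> R) (a' b' d' s : R) (A B C : triple) :
  is_derive a s a' -> is_derive b s b' -> is_derive d s d' ->
  has_vel (fun u => lin3 (a u) A (b u) B (d u) C) s (lin3 a' A b' B d' C).
Proof.
  intros Ha Hb Hd.
  assert (E : forall x y z, is_derive (fun u => a u * x + b u * y + d u * z) s (a' * x + b' * y + d' * z)).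
  { intros x y z. eapply is_derive_eq.
    - apply is_derive_plus_R; [apply is_derive_plus_R|];
      (apply is_derive_mult_R; [eassumption|apply is_derive_const_R]).
    - cbn beta; ring. }
  repeat split; apply E.
Qed.

Lemma is_derive_dot (J : triple) (c d : R -> triple) (s : R) (v w : triple) :
  has_vel c s v -> has_vel d s w ->
  is_derive (fun u => dot J (c u) (d u)) s (dot J v (d s) + dot J (c s) w).
Proof.
  intros (H1 & H2 & H3) (K1 & K2 & K3). unfold dot.
  eapply is_derive_eq.
  - apply is_derive_plus_R; [apply is_derive_plus_R|];
    (apply is_derive_mult_R; [apply is_derive_scal_R|]; eassumption).
  - cbn beta; ring.
Qed.

Lemma isom_matrix (J : triple) (L : triple -> triple) (p : triple) : lin_isom J L ->
  L p = lin3 (co1 p) (L (1, 0, 0)) (co2 p) (L (0, 1, 0)) (co3 p) (L (0, 0, 1)).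
Proof. intros HL. rewrite <- (isom_lin HL). f_equal. triple_ring. Qed.

Lemma has_vel_isom (J : triple) (L : triple -> triple) (c : R -> triple) (s : R) (v : triple) :
  lin_isom J L -> has_vel c s v -> has_vel (fun u => L (c u)) s (L v).
Proof.
  intros HL (H1 & H2 & H3).
  pose proof (fun p => isom_matrix J L p HL) as E.
  rewrite (E v).
  apply has_vel_ext_loc with
    (fun u => lin3 (co1 (c u)) (L (1, 0, 0)) (co2 (c u)) (L (0, 1, 0)) (co3 (c u)) (L (0, 0, 1))).
  { apply filter_forall. intros u. symmetry; apply E. }
  apply (has_vel_lin3 (fun u => co1 (c u)) (fun u => co2 (c u)) (fun u => co3 (c u))); assumption.
Qed.

(** * C^1 functions and maps of R^3 in coordinates *)

Notation R3 :=
  (prod_NormedModule R_AbsRing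
    (prod_NormedModule R_AbsRing R_NormedModule R_NormedModule) R_NormedModule).

(** The differential is given by a gradient with continuous entries, which makes closure under
    algebra and composition a matter of formulas; [C1_coord_C1_map] returns to [C1_map]. *)
Definition C1_real (f : triple -> R) : Prop :=
  exists g : triple -> triple, forall p,
    filterdiff f (locally p) (fun v => co1 (g p) * co1 v + co2 (g p) * co2 v + co3 (g p) * co3 v) /\
    continuous (fun q => co1 (g q)) p /\ continuous (fun q => co2 (g q)) p /\
    continuous (fun q => co3 (g q)) p.

Lemma C1_real_continuous (f : triple -> R) (p : triple) : C1_real f -> continuous f p.
Proof. intros (g & Hg). apply (filterdiff_continuous (U := R3) (V := R_NormedModule)). eexists. apply Hg. Qed.

Lemma filterdiff_pair {T U V : NormedModule R_AbsRing} (f : T -> U) (g : T -> V)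
  (x : T) (lf : T -> U) (lg : T -> V) :
  filterdiff f (locally x) lf -> filterdiff g (locally x) lg ->
  filterdiff (fun y => (f y, g y)) (locally x) (fun y => (lf y, lg y)).
Proof.
  intros Hf Hg.
  apply (filterdiff_comp'_2 f g (fun u v => (u, v)) x lf lg (fun u v => (u, v))); trivial.
  apply (filterdiff_ext (fun t => t)); [intros [a b]; reflexivity|].
  apply (filterdiff_ext_lin _ (fun t => t)); [|intros [a b]; reflexivity].
  apply filterdiff_id.
Qed.

Lemma filterdiff_triple {T : NormedModule R_AbsRing} (f : T -> triple) (x : T) (l1 l2 l3 : T -> R) :
  filterdiff (fun y => co1 (f y)) (locally x) l1 ->
  filterdiff (fun y => co2 (f y)) (locally x) l2 ->
  filterdiff (fun y => co3 (f y)) (locally x) l3 ->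
  filterdiff f (locally x) (fun y => (l1 y, l2 y, l3 y) : triple).
Proof.
  intros H1 H2 H3.
  apply (filterdiff_ext (fun y => (co1 (f y), co2 (f y), co3 (f y)) : triple)).
  - intros y. destruct (f y) as [[? ?] ?]; reflexivity.
  - apply (filterdiff_pair (fun y => (co1 (f y), co2 (f y)))); [apply filterdiff_pair|]; assumption.
Qed.

Lemma has_vel_filterdiff (c : R -> triple) (s : R) (v : triple) :
  has_vel c s v ->
  filterdiff c (locally s) (fun u => (u * co1 v, u * co2 v, u * co3 v) : triple).
Proof.
  intros (H1 & H2 & H3).
  apply (filterdiff_triple (T := R_NormedModule) c s (fun u => u * co1 v) (fun u => u * co2 v)); assumption.
Qed.

Lemma C1_real_chain (f : triple -> R) (c : R -> triple) (s : R) :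
  C1_real f -> curve_derivable c s -> ex_derive (fun u => f (c u)) s.
Proof.
  intros (g & Hg) Hc. apply derivable_has_vel in Hc.
  destruct (Hg (c s)) as (Hf & _).
  apply ex_derive_filterdiff. eexists.
  apply (filterdiff_comp' (U := R_NormedModule) (V := R3) (W := R_NormedModule) c f s); [apply has_vel_filterdiff, Hc | exact Hf].
Qed.

Definition C1_coord (f : triple -> triple) : Prop :=
  C1_real (fun p => co1 (f p)) /\ C1_real (fun p => co2 (f p)) /\ C1_real (fun p => co3 (f p)).

Lemma C1_coord_chain (f : triple -> triple) (c : R -> triple) (s : R) :
  C1_coord f -> curve_derivable c s -> curve_derivable (fun u => f (c u)) s.
Proof.
  intros (H1 & H2 & H3) Hc.
  repeat split; [apply (C1_real_chain _ c s H1 Hc)|apply (C1_real_chain _ c s H2 Hc)|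
    apply (C1_real_chain _ c s H3 Hc)].
Qed.

Lemma continuous_triple (f : triple -> triple) (p : triple) :
  continuous (fun q => co1 (f q)) p -> continuous (fun q => co2 (f q)) p ->
  continuous (fun q => co3 (f q)) p -> continuous f p.
Proof.
  intros H1 H2 H3.
  apply (continuous_ext (fun q => (co1 (f q), co2 (f q), co3 (f q)) : triple)).
  { intros y. destruct (f y) as [[? ?] ?]; reflexivity. }
  apply (continuous_comp_2 (fun q => (co1 (f q), co2 (f q))) (fun q => co3 (f q)) (fun u v => (u, v))); trivial.
  - apply (continuous_comp_2 (fun q => co1 (f q)) (fun q => co2 (f q)) (fun u v => (u, v))); trivial.
    apply (continuous_ext (fun t => t)); [intros [a b]; reflexivity | apply continuous_id].
  - apply (continuous_ext (fun t => t)); [intros [a b]; reflexivity | apply continuous_id].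
Qed.

Lemma C1_coord_C1_map (f : triple -> triple) : C1_coord f -> C1_map f.
Proof.
  intros ((g1 & H1) & (g2 & H2) & (g3 & H3)).
  exists (fun p v => (co1 (g1 p) * co1 v + co2 (g1 p) * co2 v + co3 (g1 p) * co3 v,
                 co1 (g2 p) * co1 v + co2 (g2 p) * co2 v + co3 (g2 p) * co3 v,
                 co1 (g3 p) * co1 v + co2 (g3 p) * co2 v + co3 (g3 p) * co3 v)).
  intros p. specialize (H1 p); specialize (H2 p); specialize (H3 p).
  split.
  - apply (filterdiff_triple (T := R3) f p); tauto.
  - intros v.
    assert (E : forall g : triple -> triple,
      continuous (fun q => co1 (g q)) p /\ continuous (fun q => co2 (g q)) p /\
      continuous (fun q => co3 (g q)) p ->
      continuous (fun q => co1 (g q) * co1 v + co2 (g q) * co2 v + co3 (g q) * co3 v) p).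
    { intros g (G1 & G2 & G3).
      apply (continuous_plus (V := R_NormedModule) (fun q => co1 (g q) * co1 v + co2 (g q) * co2 v)).
      apply (continuous_plus (V := R_NormedModule) (fun q => co1 (g q) * co1 v)).
      all: apply (continuous_mult (K := R_AbsRing)); trivial; apply continuous_const. }
    apply continuous_triple; unfold co1 at 1, co2 at 1, co3 at 1; simpl; apply E; tauto.
Qed.

Lemma C1_real_ext (f g : triple -> R) : (forall p, f p = g p) -> C1_real f -> C1_real g.
Proof.
  intros E (h & Hh). exists h. intros p. split; [|apply Hh].
  apply (filterdiff_ext (U := R3) (V := R_NormedModule) f); trivial. apply Hh.
Qed.

Lemma C1_real_const (a : R) : C1_real (fun _ => a).
Proof.
  exists (fun _ => (0, 0, 0)). intros p. unfold co1 at 1, co2 at 1, co3 at 1; simpl.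
  split; [|repeat split; apply continuous_const].
  apply (filterdiff_ext_lin (U := R3) (V := R_NormedModule) _ (fun _ => zero)).
  - apply filterdiff_const.
  - intros y. unfold zero; simpl. ring.
Qed.

Lemma is_linear_co : is_linear (U := R3) (V := R_NormedModule) co1
  /\ is_linear (U := R3) (V := R_NormedModule) co2
  /\ is_linear (U := R3) (V := R_NormedModule) co3.
Proof.
  repeat split; try (intros; reflexivity); exists 1; (split; [lra|]); intros x; rewrite Rmult_1_l.
  - eapply Rle_trans; [apply (norm_le_prod_norm_1 (fst x)) | apply (norm_le_prod_norm_1 x)].
  - eapply Rle_trans; [apply (norm_le_prod_norm_2 (fst x)) | apply (norm_le_prod_norm_1 x)].
  - apply (norm_le_prod_norm_2 x).
Qed.

Lemma C1_real_co : C1_real co1 /\ C1_real co2 /\ C1_real co3.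
Proof.
  destruct is_linear_co as (H1 & H2 & H3).
  repeat split; [exists (fun _ => (1, 0, 0))|exists (fun _ => (0, 1, 0))|exists (fun _ => (0, 0, 1))];
  intros p; (split; [|repeat split; apply continuous_const]).
  - apply (filterdiff_ext_lin (U := R3) (V := R_NormedModule) _ co1); [apply filterdiff_linear, H1|].
    intros y; change (@eq R (co1 y) (1 * co1 y + 0 * co2 y + 0 * co3 y)); ring.
  - apply (filterdiff_ext_lin (U := R3) (V := R_NormedModule) _ co2); [apply filterdiff_linear, H2|].
    intros y; change (@eq R (co2 y) (0 * co1 y + 1 * co2 y + 0 * co3 y)); ring.
  - apply (filterdiff_ext_lin (U := R3) (V := R_NormedModule) _ co3); [apply filterdiff_linear, H3|].
    intros y; change (@eq R (co3 y) (0 * co1 y + 0 * co2 y + 1 * co3 y)); ring.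
Qed.

(** Conditions on [h] are imposed only at the values of [f], so square roots of positive and
    reciprocals of nonvanishing functions are covered. *)
Lemma C1_real_comp (h h' : R -> R) (f : triple -> R) :
  C1_real f -> (forall p, is_derive h (f p) (h' (f p)) /\ continuous h' (f p)) ->
  C1_real (fun p => h (f p)).
Proof.
  intros (g & Hg) Hh.
  exists (fun p => (h' (f p) * co1 (g p), h' (f p) * co2 (g p), h' (f p) * co3 (g p))).
  intros p. destruct (Hg p) as (Hf & C1 & C2 & C3). destruct (Hh p) as (Hd & Hc).
  split.
  - apply (filterdiff_ext_lin (U := R3) (V := R_NormedModule) _ (fun v =>
      scal (co1 (g p) * co1 v + co2 (g p) * co2 v + co3 (g p) * co3 v : R) (h' (f p)))).
    + apply (filterdiff_comp' (U := R3) (V := R_NormedModule) (W := R_NormedModule) f h p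
        _ (fun y => scal y (h' (f p))) Hf Hd).
    + intros v. unfold scal; simpl; unfold mult; simpl. unfold co1, co2, co3; simpl. ring.
  - assert (Hhf : continuous (fun q => h' (f q)) p).
    { apply (continuous_comp (U := R3) (V := R_UniformSpace) (W := R_UniformSpace) f h'); trivial.
      apply C1_real_continuous. exists g; exact Hg. }
    repeat split; apply (continuous_mult (U := R3) (K := R_AbsRing) (fun q => h' (f q))); trivial.
Qed.

Lemma C1_real_plus (f g : triple -> R) : C1_real f -> C1_real g -> C1_real (fun p => f p + g p).
Proof.
  intros (f' & Hf) (g' & Hg).
  exists (fun p => (co1 (f' p) + co1 (g' p), co2 (f' p) + co2 (g' p), co3 (f' p) + co3 (g' p))).
  intros p. destruct (Hf p) as (F & F1 & F2 & F3). destruct (Hg p) as (G & G1 & G2 & G3).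
  split.
  - apply (filterdiff_ext_lin (U := R3) (V := R_NormedModule) _ (fun v =>
      plus (co1 (f' p) * co1 v + co2 (f' p) * co2 v + co3 (f' p) * co3 v : R)
           (co1 (g' p) * co1 v + co2 (g' p) * co2 v + co3 (g' p) * co3 v))).
    + apply (filterdiff_plus_fct (U := R3) (V := R_NormedModule) f g); trivial.
    + intros v. unfold plus; simpl. unfold co1, co2, co3; simpl. ring.
  - repeat split; apply (continuous_plus (U := R3) (V := R_NormedModule)); trivial.
Qed.

Lemma C1_real_mult (f g : triple -> R) : C1_real f -> C1_real g -> C1_real (fun p => f p * g p).
Proof.
  intros Cf Cg. pose proof (fun p => C1_real_continuous f p Cf) as Kf.
  pose proof (fun p => C1_real_continuous g p Cg) as Kg.
  destruct Cf as (f' & Hf), Cg as (g' & Hg).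
  exists (fun p => (co1 (f' p) * g p + f p * co1 (g' p), co2 (f' p) * g p + f p * co2 (g' p),
    co3 (f' p) * g p + f p * co3 (g' p))).
  intros p. destruct (Hf p) as (F & F1 & F2 & F3). destruct (Hg p) as (G & G1 & G2 & G3).
  split.
  - eapply (@filterdiff_ext_lin R_AbsRing R3 R_NormedModule _ _).
    + exact (filterdiff_mult_fct (K := R_AbsRing) (U := R3) f g p _ _ Rmult_comm F G).
    + intros v. unfold plus, mult; simpl. unfold co1, co2, co3; simpl. ring.
  - repeat split; apply (continuous_plus (U := R3) (V := R_NormedModule));
      apply (continuous_mult (U := R3) (K := R_AbsRing)); trivial.
Qed.

Lemma C1_real_comp_coord (f : triple -> R) (F : triple -> triple) :
  C1_real f -> C1_coord F -> C1_real (fun p => f (F p)).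
Proof.
  intros Cf ((g1 & H1) & (g2 & H2) & (g3 & H3)).
  destruct Cf as (g & Hg).
  set (D := fun p v => (co1 (g1 p) * co1 v + co2 (g1 p) * co2 v + co3 (g1 p) * co3 v,
                 co1 (g2 p) * co1 v + co2 (g2 p) * co2 v + co3 (g2 p) * co3 v,
                 co1 (g3 p) * co1 v + co2 (g3 p) * co2 v + co3 (g3 p) * co3 v) : triple).
  assert (HF : forall p, filterdiff F (locally p) (D p)).
  { intros p. apply (filterdiff_triple (T := R3) F p); [apply H1|apply H2|apply H3]. }
  exists (fun p =>
    lin3 (co1 (g (F p))) (g1 p) (co2 (g (F p))) (g2 p) (co3 (g (F p))) (g3 p)).
  intros p. split.
  - eapply (@filterdiff_ext_lin R_AbsRing R3 R_NormedModule _ _).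
    + exact (filterdiff_comp' (U := R3) (V := R3) (W := R_NormedModule) F f p _ _ (HF p) (proj1 (Hg (F p)))).
    + intros v. unfold D, lin3, co1, co2, co3; simpl. ring.
  - assert (CF : continuous F p).
    { apply (filterdiff_continuous (U := R3) (V := R3)). eexists. apply HF. }
    assert (G1 : continuous (fun q => co1 (g (F q))) p)

      by exact (continuous_comp (U := R3) (V := R3) (W := R_UniformSpace) F (fun q => co1 (g q)) p CF (proj1 (proj2 (Hg (F p))))).
    assert (G2 : continuous (fun q => co2 (g (F q))) p)

      by exact (continuous_comp (U := R3) (V := R3) (W := R_UniformSpace) F (fun q => co2 (g q)) p CF (proj1 (proj2 (proj2 (Hg (F p)))))).
    assert (G3 : continuous (fun q => co3 (g (F q))) p)

      by exact (continuous_comp (U := R3) (V := R3) (W := R_UniformSpace) F (fun q => co3 (g q)) p CF (proj2 (proj2 (proj2 (Hg (F p)))))).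
    specialize (H1 p); specialize (H2 p); specialize (H3 p).
    unfold lin3; repeat split;
    (apply (continuous_plus (U := R3) (V := R_NormedModule));
     [apply (continuous_plus (U := R3) (V := R_NormedModule))|]);
    apply (continuous_mult (U := R3) (K := R_AbsRing)); trivial; tauto.
Qed.

Lemma C1_coord_comp (f g : triple -> triple) :
  C1_coord f -> C1_coord g -> C1_coord (fun p => f (g p)).
Proof.
  intros (H1 & H2 & H3) Hg. repeat split.
  - apply (C1_real_comp_coord (fun p => co1 (f p)) g); trivial.
  - apply (C1_real_comp_coord (fun p => co2 (f p)) g); trivial.
  - apply (C1_real_comp_coord (fun p => co3 (f p)) g); trivial.
Qed.

Lemma C1_real_affine (a b c d : R) :
  C1_real (fun p => co1 p * a + co2 p * b + co3 p * c + d).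
Proof.
  destruct C1_real_co as (H1 & H2 & H3).
  apply (C1_real_plus (fun p => co1 p * a + co2 p * b + co3 p * c) (fun _ => d)); [|apply C1_real_const].
  apply (C1_real_plus (fun p => co1 p * a + co2 p * b) (fun p => co3 p * c)).
  - apply (C1_real_plus (fun p => co1 p * a) (fun p => co2 p * b)).
    + apply (C1_real_mult co1 (fun _ => a) H1), C1_real_const.
    + apply (C1_real_mult co2 (fun _ => b) H2), C1_real_const.
  - apply (C1_real_mult co3 (fun _ => c) H3), C1_real_const.
Qed.

Lemma C1_coord_affine (A B C D : triple) :
  C1_coord (fun p => lin3 1 (lin3 (co1 p) A (co2 p) B (co3 p) C) 1 D 0 D).
Proof.
  repeat split; unfold lin3.
  - apply (C1_real_ext (fun p => co1 p * co1 A + co2 p * co1 B + co3 p * co1 C + co1 D)).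
    + intros p; unfold co1, co2, co3; simpl; ring.
    + apply C1_real_affine.
  - apply (C1_real_ext (fun p => co1 p * co2 A + co2 p * co2 B + co3 p * co2 C + co2 D)).
    + intros p; unfold co1, co2, co3; simpl; ring.
    + apply C1_real_affine.
  - apply (C1_real_ext (fun p => co1 p * co3 A + co2 p * co3 B + co3 p * co3 C + co3 D)).
    + intros p; unfold co1, co2, co3; simpl; ring.
    + apply C1_real_affine.
Qed.

Lemma C1_coord_isom (J : triple) (L : triple -> triple) : lin_isom J L -> C1_coord L.
Proof.
  intros HL.
  pose proof (C1_coord_affine (L (1, 0, 0)) (L (0, 1, 0)) (L (0, 0, 1)) (0, 0, 0)) as (H1 & H2 & H3).
  assert (E : forall p, lin3 1 (lin3 (co1 p) (L (1, 0, 0)) (co2 p) (L (0, 1, 0)) (co3 p) (L (0, 0, 1)))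
    1 (0, 0, 0) 0 (0, 0, 0) = L p).
  { intros p. rewrite (isom_matrix J L p HL). triple_ring. }
  repeat split; [apply (C1_real_ext _ _ (fun p => f_equal co1 (E p)) H1)
    |apply (C1_real_ext _ _ (fun p => f_equal co2 (E p)) H2)
    |apply (C1_real_ext _ _ (fun p => f_equal co3 (E p)) H3)].
Qed.

(** * Uniqueness of triangles on quadrics *)

Definition sig (M : surface) : triple := (sg1 M, sg2 M, sg3 M).

Lemma form_dot (M : surface) (v w : triple) : form M v w = dot (sig M) v w.
Proof. reflexivity. Qed.

(** The signed square: the energy of a geodesic of signed length [l]. *)
Definition ssq (l : R) : R := l * Rabs l.

Lemma signed_sqrt_ssq (E l : R) : sign E * sqrt (Rabs E) = l <-> E = ssq l.
Proof.
  unfold ssq. split.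
  - intros <-. rewrite Rabs_mult, (Rabs_pos_eq (sqrt _)) by apply sqrt_pos.
    replace (_ * _) with (sign E * Rabs (sign E) * (sqrt (Rabs E) * sqrt (Rabs E))) by ring.
    rewrite sqrt_sqrt by apply Rabs_pos.
    destruct (total_order_T E 0) as [[H|H]|H].
    + rewrite sign_eq_m1, !Rabs_left by lra. ring.
    + subst E. rewrite sign_0, Rabs_R0. ring.
    + rewrite sign_eq_1, !Rabs_right by lra. ring.
  - intros ->. destruct (total_order_T l 0) as [[H|H]|H].
    + rewrite (Rabs_left l) by lra. rewrite sign_eq_m1 by nra.
      rewrite Rabs_left by nra. replace (- (l * - l)) with ((- l) * (- l)) by ring.
      rewrite sqrt_square by lra. ring.
    + subst l. rewrite Rmult_0_l, sign_0. ring.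
    + rewrite (Rabs_right l) by lra. rewrite sign_eq_1 by nra.
      rewrite Rabs_right by nra. rewrite sqrt_square by lra. ring.
Qed.

Lemma ssq_0 (l : R) : ssq l = 0 -> l = 0.
Proof.
  unfold ssq. intros H. apply Rmult_integral in H as [H|H]; [trivial|].
  destruct (Req_dec l 0); [trivial|]. exfalso; revert H; apply Rabs_no_R0; trivial.
Qed.

Lemma ssq_pos (l : R) : 0 <= l -> ssq l = l * l.
Proof. intros H; unfold ssq; rewrite Rabs_right; lra. Qed.

Lemma ssq_neg (l : R) : l <= 0 -> ssq l = - (l * l).
Proof. intros H; unfold ssq; rewrite Rabs_left1; lra. Qed.

Lemma derive_locally_const (f : R -> R) (a b c s df : R) :
  a < s < b -> (forall t, a < t < b -> f t = c) -> is_derive f s df -> df = 0.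
Proof.
  intros Hs Hf Hd.
  assert (H0 : is_derive f s 0).
  { apply (is_derive_ext_loc (fun _ => c)); [|apply is_derive_const_R].
    apply (interval_locally a b); trivial. intros t Ht. symmetry. apply Hf, Ht. }
  rewrite <- (is_derive_unique _ _ _ Hd). apply is_derive_unique, H0.
Qed.

(** The acceleration is [m * c] with unknown m. Differentiating <c, c> = 1/K gives <c, c'> = 0 and
    <c, c''> = - <c', c'>; the energy E is constant because c'' is orthogonal to c'. Hence m = - K
    E, and each coordinate is an oscillator. *)
Lemma quadric_curve (J : triple) (K : R) (c : R -> triple) (e : R) :
  K <> 0 -> 0 < e ->
  (forall s, - e < s < 1 + e ->
    curve_derivable c s /\ curve_derivable (vel c) s /\ dot J (c s) (c s) = / K /\
    exists m, vel (vel c) s = lin3 m (c s) 0 (c s) 0 (c s)) ->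
  dot J (c 0) (vel c 0) = 0 /\
  forall s, - e < s < 1 + e ->
    c s = lin3 (gcos (K * dot J (vel c 0) (vel c 0)) s) (c 0)
               (gsin (K * dot J (vel c 0) (vel c 0)) s) (vel c 0) 0 (c 0).
Proof.
  intros HK He Hc.
  assert (Hv : forall s, - e < s < 1 + e -> has_vel c s (vel c s)).
  { intros s Hs. apply derivable_has_vel, Hc, Hs. }
  assert (Ha : forall s, - e < s < 1 + e -> has_vel (vel c) s (vel (vel c) s)).
  { intros s Hs. apply derivable_has_vel, Hc, Hs. }
  assert (Hcv : forall s, - e < s < 1 + e -> dot J (c s) (vel c s) = 0).
  { intros s Hs. pose proof (is_derive_dot J _ _ s _ _ (Hv s Hs) (Hv s Hs)) as H.
    apply (derive_locally_const _ (- e) (1 + e) (/ K)) in H; [|trivial|intros t Ht; apply Hc, Ht].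
    rewrite (dot_comm J (vel c s)) in H. lra. }
  assert (Hca : forall s, - e < s < 1 + e ->
    dot J (vel c s) (vel c s) + dot J (c s) (vel (vel c) s) = 0).
  { intros s Hs. pose proof (is_derive_dot J _ _ s _ _ (Hv s Hs) (Ha s Hs)) as H.
    apply (derive_locally_const _ (- e) (1 + e) 0) in H; trivial. }
  assert (HE : forall s, - e < s < 1 + e -> dot J (vel c s) (vel c s) = dot J (vel c 0) (vel c 0)).
  { intros s Hs. apply (is_derive_zero_const (fun s => dot J (vel c s) (vel c s)) (- e) (1 + e)); try lra.
    intros t Ht. eapply is_derive_eq; [apply is_derive_dot; apply Ha, Ht|].
    destruct (Hc t Ht) as (_ & _ & _ & m & ->).
    rewrite dot_lin3_l, dot_lin3_r. rewrite (dot_comm J (vel c t) (c t)), (Hcv t Ht). ring. }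
  assert (Hac : forall s, - e < s < 1 + e -> vel (vel c) s =
    lin3 (- (K * dot J (vel c 0) (vel c 0))) (c s) 0 (c s) 0 (c s)).
  { intros s Hs. pose proof (Hca s Hs) as H. rewrite (HE s Hs) in H.
    destruct (Hc s Hs) as (_ & _ & HQ & m & Hm). rewrite Hm in H |- *.
    rewrite dot_lin3_r, HQ in H. f_equal.
    transitivity (m * / K * K); [field; trivial|].
    replace (m * / K) with (- dot J (vel c 0) (vel c 0)) by lra. ring. }
  split; [apply Hcv; lra|].
  set (k := K * _) in *. clearbody k.
  intros s Hs. apply triple_eq; unfold lin3; unfold co1 at 2, co2 at 2, co3 at 2; simpl;
  rewrite Rmult_0_l, Rplus_0_r.
  - rewrite (Rmult_comm (gcos k s)), (Rmult_comm (gsin k s)).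
    apply (oscillator_unique k (- e) (1 + e) (fun t => co1 (c t)) (fun t => co1 (vel c t))); trivial; try lra.
    + intros t Ht. exact (proj1 (Hv t Ht)).
    + intros t Ht. eapply is_derive_eq; [exact (proj1 (Ha t Ht))|]. rewrite (Hac t Ht). unfold lin3, co1; simpl; ring.
  - rewrite (Rmult_comm (gcos k s)), (Rmult_comm (gsin k s)).
    apply (oscillator_unique k (- e) (1 + e) (fun t => co2 (c t)) (fun t => co2 (vel c t))); trivial; try lra.
    + intros t Ht. exact (proj1 (proj2 (Hv t Ht))).
    + intros t Ht. eapply is_derive_eq; [exact (proj1 (proj2 (Ha t Ht)))|]. rewrite (Hac t Ht). unfold lin3, co2; simpl; ring.
  - rewrite (Rmult_comm (gcos k s)), (Rmult_comm (gsin k s)).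
    apply (oscillator_unique k (- e) (1 + e) (fun t => co3 (c t)) (fun t => co3 (vel c t))); trivial; try lra.
    + intros t Ht. exact (proj2 (proj2 (Hv t Ht))).
    + intros t Ht. eapply is_derive_eq; [exact (proj2 (proj2 (Ha t Ht)))|]. rewrite (Hac t Ht). unfold lin3, co3; simpl; ring.
Qed.

(** [li_curve] is included so that the image of a side can be fed to [qs_path], which compares
    differentiable curves. *)
Record lifts_isom (M : surface) (L f : triple -> triple) : Prop := {
  li_isometry : isometry M f;
  li_dev : forall p, carrier M p -> dev M (f p) = L (dev M p);
  li_curve : forall c s, curve_derivable c s -> curve_derivable (fun u => f (c u)) s
}.

(** [qs_lift] and [qs_path] stand in for covering theory: linear isometries lift with one prescribed
    value, and curves with the same development and the same start agree. For an embedded quadric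
    [qs_path] is immediate. *)
Record quadric_surface (M : surface) (K : R) : Prop := {
  qs_K : K <> 0;
  qs_signs : unit_signs (sig M);
  qs_carrier : forall p, carrier M p -> dot (sig M) (dev M p) (dev M p) = / K;
  qs_curve : forall c s, curve_derivable c s -> curve_derivable (fun u => dev M (c u)) s;
  qs_geodesic : forall g, geodesic M g -> exists e, 0 < e /\
    forall s, - e < s < 1 + e ->
      carrier M (g s) /\ curve_derivable g s /\
      curve_derivable (fun u => dev M (g u)) s /\ curve_derivable (dvel M g) s /\
      exists m, vel (dvel M g) s = lin3 m (dev M (g s)) 0 (dev M (g s)) 0 (dev M (g s));
  qs_lift : forall L L' A A', isom_pair (sig M) L L' -> carrier M A -> carrier M A' ->
    L (dev M A) = dev M A' -> exists f, lifts_isom M L f /\ f A = A';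
  qs_path : forall g h e, 0 < e ->
    (forall s, - e < s < 1 + e -> carrier M (g s) /\ carrier M (h s) /\
       curve_derivable g s /\ curve_derivable h s) ->
    (forall s, 0 <= s <= 1 -> dev M (g s) = dev M (h s)) ->
    g 0 = h 0 -> forall s, 0 <= s <= 1 -> g s = h s
}.

Arguments li_isometry {M L f} _.
Arguments li_dev {M L f} _.
Arguments li_curve {M L f} _.
Arguments qs_K {M K} _.
Arguments qs_signs {M K} _.
Arguments qs_carrier {M K} _.
Arguments qs_curve {M K} _.
Arguments qs_geodesic {M K} _.
Arguments qs_lift {M K} _.
Arguments qs_path {M K} _.

(** The solution of u'' = - k u with value P at time 0 and Q at time 1, unique when [gsin k 1] is
    nonzero. Being linear in P and Q, it commutes with linear isometries. *)
Definition arc (k : R) (P Q : triple) (s : R) : triple :=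
  lin3 (gcos k s - gsin k s / gsin k 1 * gcos k 1) P (gsin k s / gsin k 1) Q 0 P.

Lemma arc_isom (J : triple) (L : triple -> triple) (k s : R) (P Q : triple) :
  lin_isom J L -> L (arc k P Q s) = arc k (L P) (L Q) s.
Proof. intros HL. apply (isom_lin HL). Qed.

Section Quadric.

Variables (M : surface) (K : R).
Hypothesis HM : quadric_surface M K.

Lemma quadric_geodesic_formula (g : R -> triple) (l : R) :
  geodesic M g -> signed_length M g = l ->
  exists V, dot (sig M) (dev M (g 0)) V = 0 /\ dot (sig M) V V = ssq l /\
  forall s, 0 <= s <= 1 ->
    dev M (g s) = lin3 (gcos (K * ssq l) s) (dev M (g 0)) (gsin (K * ssq l) s) V 0 (dev M (g 0)).
Proof.
  intros Hg Hl. apply signed_sqrt_ssq in Hl. rewrite form_dot in Hl.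
  destruct (qs_geodesic HM g Hg) as (e & He & H).
  destruct (quadric_curve (sig M) K (fun u => dev M (g u)) e) as (H0 & H1).
  - apply (qs_K HM).
  - exact He.
  - intros s Hs. destruct (H s Hs) as (H1 & _ & H3 & H4 & H5).
    repeat (split; [trivial|]); [apply (qs_carrier HM), H1|exact H5].
  - exists (dvel M g 0). split; [exact H0|]. split; [exact Hl|].
    intros s Hs. rewrite <- Hl. apply H1. lra.
Qed.

(** The initial velocity is orthogonal to the position, so the product depends on the length alone;
    conjugate lengths are included. *)
Lemma quadric_side_dot (g : R -> triple) (A B : triple) (l : R) :
  joins M g A B -> signed_length M g = l -> carrier M A ->
  dot (sig M) (dev M A) (dev M B) = gcos (K * ssq l) 1 / K.
Proof.
  intros (Hg & H0 & H1) Hl HA.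
  destruct (quadric_geodesic_formula g l Hg Hl) as (V & HV & _ & HF).
  rewrite <- H1, (HF 1) by lra. rewrite H0 in *.
  rewrite dot_lin3_r, HV, (qs_carrier HM A HA). field. apply (qs_K HM).
Qed.

Lemma quadric_side_arc (g : R -> triple) (A B : triple) (l : R) :
  joins M g A B -> signed_length M g = l -> gsin (K * ssq l) 1 <> 0 ->
  forall s, 0 <= s <= 1 -> dev M (g s) = arc (K * ssq l) (dev M A) (dev M B) s.
Proof.
  intros (Hg & H0 & H1) Hl Hk s Hs.
  destruct (quadric_geodesic_formula g l Hg Hl) as (V & _ & _ & HF).
  rewrite <- H1, (HF s Hs), (HF 1) by lra. rewrite H0. unfold arc.
  coordwise; field; trivial.
Qed.

Lemma geodesic_carrier (g : R -> triple) (A B : triple) :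
  joins M g A B -> carrier M A /\ carrier M B.
Proof.
  intros (Hg & <- & <-). destruct (qs_geodesic HM g Hg) as (e & He & H).
  split; apply H; lra.
Qed.

(** The image of the first side and the second side both develop onto the same arc and start at A';
    [qs_path] identifies them. *)
Lemma lift_side (L f : triple -> triple) (g g' : R -> triple) (A B A' B' : triple) (l : R) :
  lin_isom (sig M) L -> lifts_isom M L f ->
  joins M g A B -> joins M g' A' B' -> signed_length M g = l -> signed_length M g' = l ->
  gsin (K * ssq l) 1 <> 0 ->
  f A = A' -> L (dev M A) = dev M A' -> L (dev M B) = dev M B' ->
  forall s, 0 <= s <= 1 -> f (g s) = g' s.
Proof.
  intros HL Hf Hg Hg' Hl Hl' Hk HA HdA HdB.
  destruct (qs_geodesic HM g (proj1 Hg)) as (e & He & H).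
  destruct (qs_geodesic HM g' (proj1 Hg')) as (e' & He' & H').
  assert (Hm : 0 < Rmin e e') by (apply Rmin_pos; trivial).
  pose proof (Rmin_l e e'); pose proof (Rmin_r e e').
  apply (qs_path HM (fun s => f (g s)) g' (Rmin e e') Hm).
  - intros s Hs. destruct (H s) as (C & D & _); [lra|]. destruct (H' s) as (C' & D' & _); [lra|].
    split; [|split; [|split]]; trivial; [|apply (li_curve Hf), D].
    destruct (li_isometry Hf) as (_ & (f' & _ & Hinv) & _). apply Hinv, C.
  - intros s Hs. rewrite (li_dev Hf) by (apply H; lra).
    rewrite (quadric_side_arc g A B l), (quadric_side_arc g' A' B' l) by trivial.
    rewrite (arc_isom (sig M)) by trivial. congruence.
  - destruct Hg as (_ & -> & _), Hg' as (_ & -> & _). exact HA.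
Qed.

(** By [gcos2_gsin2] the determinant is k [gsin k 1]^2 / K^2 with k = K E, which vanishes only for a
    null side or a conjugate length. *)
Lemma nondegenerate_pair (l : R) (P Q : triple) :
  dot (sig M) P P = / K -> dot (sig M) Q Q = / K -> dot (sig M) P Q = gcos (K * ssq l) 1 / K ->
  gsin (K * ssq l) 1 <> 0 -> l <> 0 ->
  dot (sig M) P P * dot (sig M) Q Q - dot (sig M) P Q * dot (sig M) P Q <> 0.
Proof.
  intros -> -> -> Hk Hl. pose proof (qs_K HM) as HK.
  assert (Hs : ssq l <> 0) by (intros H; apply Hl, ssq_0, H).
  replace (_ - _) with ((1 - gcos (K * ssq l) 1 * gcos (K * ssq l) 1) * (/ K * / K)) by (field; trivial).
  pose proof (gcos2_gsin2 (K * ssq l) 1) as HI. set (k := K * ssq l) in *.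
  replace (1 - gcos k 1 * gcos k 1) with (k * (gsin k 1 * gsin k 1)) by lra.
  unfold k in *.
  apply Rmult_integral_contrapositive_currified; apply Rmult_integral_contrapositive_currified;
    try (apply Rinv_neq_0_compat; trivial);
    apply Rmult_integral_contrapositive_currified; trivial.
Qed.

Lemma quadric_unique (x : triple) (T T' : geodesic_triangle) :
  x <> tzero ->
  gsin (K * ssq (co1 x)) 1 <> 0 -> gsin (K * ssq (co2 x)) 1 <> 0 -> gsin (K * ssq (co3 x)) 1 <> 0 ->
  realizes M T x -> realizes M T' x ->
  exists f, isometry M f /\ maps_vertices f T T' /\ maps_sides f T T'.
Proof.
  intros Hx Hk1 Hk2 Hk3 ((JAB & JBC & JAC) & L1 & L2 & L3) ((JAB' & JBC' & JAC') & L1' & L2' & L3').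
  destruct (geodesic_carrier _ _ _ JAB) as (CA & CB). destruct (geodesic_carrier _ _ _ JBC) as (_ & CC).
  destruct (geodesic_carrier _ _ _ JAB') as (CA' & CB'). destruct (geodesic_carrier _ _ _ JBC') as (_ & CC').
  pose proof (quadric_side_dot _ _ _ _ JAB L1 CA) as DAB.
  pose proof (quadric_side_dot _ _ _ _ JBC L2 CB) as DBC.
  pose proof (quadric_side_dot _ _ _ _ JAC L3 CA) as DAC.
  pose proof (quadric_side_dot _ _ _ _ JAB' L1' CA') as DAB'.
  pose proof (quadric_side_dot _ _ _ _ JBC' L2' CB') as DBC'.
  pose proof (quadric_side_dot _ _ _ _ JAC' L3' CA') as DAC'.
  pose proof (qs_carrier HM) as HC.
  pose proof (HC _ CA) as DA; pose proof (HC _ CB) as DB; pose proof (HC _ CC) as DC.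
  pose proof (HC _ CA') as DA'; pose proof (HC _ CB') as DB'; pose proof (HC _ CC') as DC'.
  destruct (gram_isom (sig M) (dev M (vA T)) (dev M (vB T)) (dev M (vC T))
    (dev M (vA T')) (dev M (vB T')) (dev M (vC T'))) as (L & L' & HL & LA & LB & LC); try congruence.
  - apply (qs_signs HM).
  (* Some side is not null as [x] is nonzero; its endpoints form the nondegenerate pair. *)
  - destruct (Req_dec (co1 x) 0) as [Z1|Z1].
    + destruct (Req_dec (co2 x) 0) as [Z2|Z2].
      * destruct (Req_dec (co3 x) 0) as [Z3|Z3].
        -- exfalso. apply Hx, triple_eq; trivial.
        -- right; right. apply (nondegenerate_pair (co3 x)); trivial.
      * right; left. apply (nondegenerate_pair (co2 x)); trivial.
    + left. apply (nondegenerate_pair (co1 x)); trivial.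
  (* The lift is prescribed only at A. That B and C go to B' and C', and not to other points with
     the same development, follows by moving along AB and then BC. *)
  - destruct (qs_lift HM L L' (vA T) (vA T') HL CA CA' LA) as (f & Hf & fA).
    pose proof (pair_isom HL) as HLi.
    pose proof (lift_side L f _ _ _ _ _ _ _ HLi Hf JAB JAB' L1 L1' Hk1 fA LA LB) as SAB.
    assert (fB : f (vB T) = vB T').
    { destruct JAB as (_ & _ & <-), JAB' as (_ & _ & <-). apply SAB; lra. }
    pose proof (lift_side L f _ _ _ _ _ _ _ HLi Hf JBC JBC' L2 L2' Hk2 fB LB LC) as SBC.
    assert (fC : f (vC T) = vC T').
    { destruct JBC as (_ & _ & <-), JBC' as (_ & _ & <-). apply SBC; lra. }
    pose proof (lift_side L f _ _ _ _ _ _ _ HLi Hf JAC JAC' L3 L3' Hk3 fA LA LC) as SAC.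
    exists f. split; [apply (li_isometry Hf)|]. split; [repeat split; trivial|].
    intros s Hs. repeat split; auto.
Qed.

End Quadric.

(** * The sphere and the hyperbolic plane *)

Ltac coords := repeat match goal with p : triple |- _ => destruct p as [[? ?] ?] end;
  unfold dot, lin3, co1, co2, co3 in *; simpl in *.

(** Reversed Cauchy-Schwarz: the spatial product is smaller than the product of the positive time
    components. *)
Lemma timelike_cone (v w : triple) :
  dot (-1, 1, 1) v v < 0 -> dot (-1, 1, 1) w w < 0 -> 0 < co1 v -> 0 < co1 w ->
  dot (-1, 1, 1) v w < 0.
Proof.
  coords. intros Hv Hw Hv1 Hw1.
  match goal with |- -1 * ?a * ?b + 1 * ?c * ?d + 1 * ?e * ?f < 0 =>
    assert (H1 : (c * d + e * f) * (c * d + e * f) <= (c * c + e * e) * (d * d + f * f))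
      by (pose proof (Rle_0_sqr (c * f - e * d)) as H0; unfold Rsqr in H0; lra);
    assert (H2 : (c * c + e * e) * (d * d + f * f) < (a * a) * (b * b))
      by (apply Rmult_le_0_lt_compat; nra);
    assert (H3 : 0 < a * b) by (apply Rmult_lt_0_compat; trivial);
    destruct (Rlt_dec (c * d + e * f) (a * b)); [lra|nra]
  end.
Qed.

(** If [co1 v] were negative, [timelike_cone] for - v and w would contradict the sign of the
    product. *)
Lemma timelike_future (v w : triple) :
  dot (-1, 1, 1) v v < 0 -> dot (-1, 1, 1) w w < 0 -> 0 < co1 w ->
  dot (-1, 1, 1) v w < 0 -> 0 < co1 v.
Proof.
  intros Hv Hw Hw1 H. destruct (Rlt_dec 0 (co1 v)) as [|Hn]; [trivial|exfalso].
  destruct (Req_dec (co1 v) 0) as [H0|H0].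
  - coords. subst. nra.
  - pose proof (timelike_cone (lin3 (-1) v 0 v 0 v) w) as Hc.
    rewrite !dot_lin3_l, !dot_lin3_r in Hc.
    assert (H1 : 0 < co1 (lin3 (-1) v 0 v 0 v)).
    { unfold lin3; unfold co1 at 1; simpl. lra. }
    specialize (Hc ltac:(lra) Hw H1 Hw1). lra.
Qed.

(** A vector a with zero cross product against p = (x, y, z) is a multiple of p; pairing with p
    gives the factor K <p, a>, since <p, p> = 1/K. *)
Lemma cross_zero (s K a1 a2 a3 x y z : R) :
  s * s = 1 -> K <> 0 -> s * x * x + y * y + z * z = / K ->
  x * a2 = y * a1 -> x * a3 = z * a1 -> y * a3 = z * a2 ->
  exists m, a1 = m * x /\ a2 = m * y /\ a3 = m * z.
Proof.
  intros Hs HK HQ H1 H2 H3. exists (K * (s * x * a1 + y * a2 + z * a3)).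
  assert (E : forall a, a = K * (s * x * x + y * y + z * z) * a).
  { intros a. rewrite HQ. field; trivial. }
  repeat split.
  - transitivity (K * (s * x * x + y * y + z * z) * a1); [apply E|]. transitivity (K * (s * x * a1 * x + y * (y * a1) + z * (z * a1))); [ring|].
    rewrite <- H1, <- H2. ring.
  - transitivity (K * (s * x * x + y * y + z * z) * a2); [apply E|]. transitivity (K * (s * x * (x * a2) + y * y * a2 + z * (z * a2))); [ring|].
    rewrite H1, <- H3. ring.
  - transitivity (K * (s * x * x + y * y + z * z) * a3); [apply E|]. transitivity (K * (s * x * (x * a3) + y * (y * a3) + z * z * a3)); [ring|].
    rewrite H2, H3. ring.
Qed.

Lemma dot_sign (s K : R) (p : triple) : s * s = 1 -> 0 < s * K ->
  dot (s, 1, 1) p p = / K -> s < 0 -> s = -1 /\ dot (-1, 1, 1) p p < 0.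
Proof.
  intros Hs HsK Hp Hs0. assert (E : s = -1) by nra. subst s. split; trivial. rewrite Hp.
  apply Rinv_lt_0_compat. lra.
Qed.

Lemma gcos_neg_pos (k s : R) : k < 0 -> 0 < gcos k s.
Proof.
  intros H. unfold gcos. destruct (Rlt_dec 0 k); [lra|]. destruct (Req_EM_T k 0); [lra|]. apply cosh_pos.
Qed.

(** For [s] = 1 this is a rotation and for [s] = -1 a boost in the (x, y)-plane; the second claim
    says that boosts preserve the future cone. *)
Lemma mixed_carrier (s u x y z : R) :
  let C := gcos s u in let S := gsin s u in
  s * (x * C - y * S) * (x * C - y * S) + (s * x * S + y * C) * (s * x * S + y * C) + z * z
  = s * x * x + y * y + z * z /\
  (s = -1 -> 0 < x -> - 1 * x * x + y * y + z * z < 0 -> 0 < x * C - y * S).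
Proof.
  intros C S. pose proof (gcos2_gsin2 s u) as HI. fold C S in HI. split.
  - transitivity (s * x * x * (C * C + s * (S * S)) + y * y * (C * C + s * (S * S)) + z * z); [ring|].
    rewrite HI. ring.
  - intros E Hx Hq. assert (HC : 0 < C) by (unfold C; apply gcos_neg_pos; lra).
    clearbody C S. subst s.
    assert (H1 : 0 < x * C) by (apply Rmult_lt_0_compat; trivial).
    destruct (Rlt_dec 0 (x * C - y * S)); [trivial|exfalso].
    assert (H2 : (x * C) * (x * C) <= (y * S) * (y * S)) by nra.
    assert (H3 : (y * S) * (y * S) <= (y * y) * (C * C)) by nra.
    assert (H4 : (y * y) * (C * C) < (x * x) * (C * C)) by (apply Rmult_lt_compat_r; nra).
    lra.
Qed.

Lemma riemann_K (s K : R) : 0 < s * K -> K <> 0.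
Proof. intros H E. rewrite E in H. lra. Qed.

Section Riemann.

(** [s] is 1 for the sphere and -1 for the hyperbolic plane, whose upper sheet is selected by the
    last clause of [HQ]. *)
Variables (Q : triple -> Prop) (s K : R).
Hypothesis Hs : s * s = 1.
Hypothesis HsK : 0 < s * K.
Hypothesis HQ : forall p, Q p <-> dot (s, 1, 1) p p = / K /\ (s < 0 -> 0 < co1 p).

Let M := Surface Q (fun p => p) s 1 1.

(** The test curves are orbits of three one-parameter groups of linear isometries, which stay on the
    carrier for all times as [curve_in] demands. Orthogonality to their velocities is the vanishing
    of the cross product of [a] with the position. *)
Lemma riemann_tangent (g : R -> triple) (t : R) (a : triple) :
  Q (g t) ->
  (forall c : R -> triple, curve_in M c -> c 0 = g t -> curve_derivable c 0 ->
    dot (s, 1, 1) a (vel c 0) = 0) ->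
  exists m, a = lin3 m (g t) 0 (g t) 0 (g t).
Proof.
  intros Hg H. destruct (proj1 (HQ _) Hg) as (Hd & Hp).
  assert (Hneg : s < 0 -> s = -1 /\ dot (-1, 1, 1) (g t) (g t) < 0).
  { apply (dot_sign s K); trivial. }
  destruct (g t) as [[x y] z]. destruct a as [[a1 a2] a3].
  unfold dot in Hd; unfold co1, co2, co3 in Hd, Hp; simpl in Hd, Hp.
  assert (Hd' : s * x * x + y * y + z * z = / K) by lra.
  pose (c1 := fun u => (x * gcos s u - y * gsin s u, s * x * gsin s u + y * gcos s u, z) : triple).
  pose (c2 := fun u => (x * gcos s u - z * gsin s u, y, s * x * gsin s u + z * gcos s u) : triple).
  pose (c3 := fun u => (x, y * cos u - z * sin u, y * sin u + z * cos u) : triple).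
  assert (D : forall p q r : R,
    is_derive (fun u => p * gcos s u - q * gsin s u) 0 (- q) /\
    is_derive (fun u => r * p * gsin s u + q * gcos s u) 0 (r * p)).
  { intros p q r. split.
    - eapply is_derive_eq. apply (is_derive_minus (fun u => p * gcos s u) (fun u => q * gsin s u)).
      apply is_derive_scal_R, is_derive_gcos. apply is_derive_scal_R, is_derive_gsin.
      rewrite gcos_0, gsin_0. unfold minus, plus, opp; simpl; ring.
    - eapply is_derive_eq. apply is_derive_plus_R.
      apply is_derive_scal_R, is_derive_gsin. apply is_derive_scal_R, is_derive_gcos.
      rewrite gcos_0, gsin_0. ring. }
  assert (V1 : has_vel c1 0 (- y, s * x, 0)).
  { split; [apply (D x y s)|split; [apply (D x y s)|exact (is_derive_const_R z 0)]]. }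
  assert (V2 : has_vel c2 0 (- z, 0, s * x)).
  { split; [apply (D x z s)|split; [exact (is_derive_const_R y 0)|apply (D x z s)]]. }
  assert (V3 : has_vel c3 0 (0, - z, y)).
  { split; [exact (is_derive_const_R x 0)|split].
    - unfold c3, co2; simpl. auto_derive; trivial. rewrite sin_0, cos_0. ring.
    - unfold c3, co3; simpl. auto_derive; trivial. rewrite sin_0, cos_0. ring. }
  assert (T1 : dot (s, 1, 1) (a1, a2, a3) (- y, s * x, 0) = 0).
  { rewrite <- (has_vel_vel _ _ _ V1). apply H.
    - intros u. apply HQ. unfold c1, dot, co1, co2, co3; simpl.
      destruct (mixed_carrier s u x y z) as (E1 & E2). split.
      + rewrite <- Hd. lra.
      + intros Hs0. destruct (Hneg Hs0) as (-> & Hn). apply E2; auto.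
        unfold dot, co1, co2, co3 in Hn; simpl in Hn. lra.
    - unfold c1. rewrite gcos_0, gsin_0. coordwise; ring.
    - apply (has_vel_derivable _ _ _ V1). }
  assert (T2 : dot (s, 1, 1) (a1, a2, a3) (- z, 0, s * x) = 0).
  { rewrite <- (has_vel_vel _ _ _ V2). apply H.
    - intros u. apply HQ. unfold c2, dot, co1, co2, co3; simpl.
      destruct (mixed_carrier s u x z y) as (E1 & E2). split.
      + rewrite <- Hd. lra.
      + intros Hs0. destruct (Hneg Hs0) as (-> & Hn). apply E2; auto.
        unfold dot, co1, co2, co3 in Hn; simpl in Hn. lra.
    - unfold c2. rewrite gcos_0, gsin_0. coordwise; ring.
    - apply (has_vel_derivable _ _ _ V2). }
  assert (T3 : dot (s, 1, 1) (a1, a2, a3) (0, - z, y) = 0).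
  { rewrite <- (has_vel_vel _ _ _ V3). apply H.
    - intros u. apply HQ. unfold c3, dot, co1, co2, co3; simpl. split; [|exact Hp].
      pose proof (sin2_cos2 u) as HI. unfold Rsqr in HI. rewrite <- Hd.
      transitivity (s * x * x + (y * y + z * z) * (sin u * sin u + cos u * cos u)); [ring|].
      rewrite HI; ring.
    - unfold c3. rewrite sin_0, cos_0. coordwise; ring.
    - apply (has_vel_derivable _ _ _ V3). }
  unfold dot, co1, co2, co3 in T1, T2, T3; simpl in T1, T2, T3.
  assert (Hs0 : s <> 0) by (intros ->; lra).
  destruct (cross_zero s K a1 a2 a3 x y z Hs (riemann_K s K HsK) Hd') as (m & -> & -> & ->).
  - apply (Rmult_eq_reg_l s); trivial. lra.
  - apply (Rmult_eq_reg_l s); trivial. lra.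
  - lra.
  - exists m. coordwise; ring.
Qed.

(** Only the sheet is at issue: <L p, L A> = <p, A> is negative there, so L p lies in the same cone
    as L A. *)
Lemma riemann_isometry_carrier (L : triple -> triple) (A : triple) :
  lin_isom (s, 1, 1) L -> Q A -> Q (L A) -> forall p, Q p -> Q (L p).
Proof.
  intros HL HA HLA p Hp. apply HQ in HA, HLA, Hp. apply HQ.
  split; [rewrite (isom_dot HL); tauto|]. intros Hs0.
  destruct (dot_sign s K (L A) Hs HsK (proj1 HLA) Hs0) as (Es & HLA0).
  destruct (dot_sign s K A Hs HsK (proj1 HA) Hs0) as (_ & HA0).
  destruct (dot_sign s K p Hs HsK (proj1 Hp) Hs0) as (_ & Hp0).
  rewrite Es in HL.
  apply (timelike_future _ (L A)); trivial; try tauto.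
  - rewrite (isom_dot HL). trivial.
  - rewrite (isom_dot HL). apply timelike_cone; tauto.
Qed.

Lemma riemann_quadric_surface : quadric_surface M K.
Proof.
  split.
  - apply (riemann_K s K HsK).
  - repeat split; unfold co1, co2, co3; simpl; lra.
  - intros p Hp. apply HQ, Hp.
  - trivial.
  - intros g (e & He & H). exists e. split; trivial. intros t Ht.
    destruct (H t Ht) as (C & D1 & D2 & HT). repeat (split; [assumption|]).
    apply riemann_tangent; trivial.
  - intros L L' A A' HL CA CA' HA. simpl in HA. change (sig M) with (s, 1, 1) in HL.
    pose proof (pair_isom HL) as H1. pose proof (pair_isom' HL) as H2.
    exists L. split; [|exact HA]. split.
    + split; [apply C1_coord_C1_map, (C1_coord_isom (s, 1, 1)); trivial|]. split.
      * exists L'. split; [apply C1_coord_C1_map, (C1_coord_isom (s, 1, 1)); trivial|].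
        intros p Hp. repeat split.
        -- apply (riemann_isometry_carrier L A); trivial. simpl in *. congruence.
        -- apply (riemann_isometry_carrier L' A'); trivial. rewrite <- HA, (pair_l HL). exact CA.
        -- apply (pair_l HL).
        -- apply (pair_r HL).
      * intros c t _ Hc. rewrite !form_dot.
        change (dot (s, 1, 1) (vel (fun u => L (c u)) t) (vel (fun u => L (c u)) t)
          = dot (s, 1, 1) (vel c t) (vel c t)).
        rewrite (has_vel_vel _ _ _ (has_vel_isom _ _ _ _ _ H1 (derivable_has_vel c t Hc))).
        apply (isom_dot H1).
    + reflexivity.
    + intros c t Hc. apply C1_coord_chain; trivial. apply (C1_coord_isom (s, 1, 1)); trivial.
  - intros g h e _ _ H _ t Ht. exact (H t Ht).
Qed.

End Riemann.

Lemma riemann_model_form (K : R) : K <> 0 -> exists Q s,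
  riemann_model K = Surface Q (fun p => p) s 1 1 /\ s * s = 1 /\ 0 < s * K /\
  forall p, Q p <-> dot (s, 1, 1) p p = / K /\ (s < 0 -> 0 < co1 p).
Proof.
  intros HK. unfold riemann_model. destruct (Req_EM_T K 0); [contradiction|].
  destruct (Rlt_dec 0 K); eexists; eexists; (split; [reflexivity|]);
    (split; [ring|]); (split; [lra|]); intros p; unfold dot.
  - unfold co1 at 2, co2 at 2, co3 at 2; simpl.
    split; [intros H; split; [lra|intros; lra] | intros (H & _); lra].
  - unfold co1 at 3, co2 at 2, co3 at 2; simpl.
    split; [intros (H & H1); split; [lra|intros; lra] | intros (H & H1); split; [lra|apply H1; lra]].
Qed.

(** * The universal covering of the one-sheeted hyperboloid *)

Lemma is_derive_continuous_R (h : R -> R) (x l : R) : is_derive h x l -> continuous h x.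
Proof. intros H. apply (ex_derive_continuous (V := R_NormedModule)). exists l. exact H. Qed.

Lemma C1_real_sin (f : triple -> R) : C1_real f -> C1_real (fun p => sin (f p)).
Proof.
  intros H. apply (C1_real_comp sin cos f H). intros p. split; [apply is_derive_sin|].
  apply (is_derive_continuous_R cos _ _ (is_derive_cos _)).
Qed.

Lemma C1_real_cos (f : triple -> R) : C1_real f -> C1_real (fun p => cos (f p)).
Proof.
  intros H. apply (C1_real_comp cos (fun x => - sin x) f H). intros p. split; [apply is_derive_cos|].
  apply (is_derive_continuous_R _ _ (- cos (f p))). apply (is_derive_opp sin), is_derive_sin.
Qed.

Lemma C1_real_sinh (f : triple -> R) : C1_real f -> C1_real (fun p => sinh (f p)).
Proof.
  intros H. apply (C1_real_comp sinh cosh f H). intros p. split; [apply is_derive_sinh|].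
  apply (is_derive_continuous_R cosh _ _ (is_derive_cosh _)).
Qed.

Lemma C1_real_cosh (f : triple -> R) : C1_real f -> C1_real (fun p => cosh (f p)).
Proof.
  intros H. apply (C1_real_comp cosh sinh f H). intros p. split; [apply is_derive_cosh|].
  apply (is_derive_continuous_R sinh _ _ (is_derive_sinh _)).
Qed.

Lemma C1_real_sqrt (f : triple -> R) : C1_real f -> (forall p, 0 < f p) -> C1_real (fun p => sqrt (f p)).
Proof.
  intros H H0. apply (C1_real_comp sqrt (fun x => / (2 * sqrt x)) f H). intros p.
  pose proof (sqrt_lt_R0 _ (H0 p)). split.
  - apply is_derive_Reals, derivable_pt_lim_sqrt, H0.
  - apply (ex_derive_continuous (V := R_NormedModule) (fun x => / (2 * sqrt x))).
    auto_derive. repeat split; try apply H0; lra.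
Qed.

Lemma C1_real_inv (f : triple -> R) : C1_real f -> (forall p, f p <> 0) -> C1_real (fun p => / f p).
Proof.
  intros H H0. apply (C1_real_comp Rinv (fun x => - 1 / x ^ 2) f H). intros p. split.
  - apply (is_derive_inv (fun x => x)); [apply is_derive_id_R | apply H0].
  - apply (ex_derive_continuous (V := R_NormedModule) (fun x => - 1 / x ^ 2)).
    auto_derive. specialize (H0 p). repeat split. intros E. apply H0. nra.
Qed.

Lemma C1_real_atan (f : triple -> R) : C1_real f -> C1_real (fun p => atan (f p)).
Proof.
  intros H. apply (C1_real_comp atan (fun x => / (1 + x * x)) f H). intros p. split.
  - apply is_derive_atan.
  - apply (ex_derive_continuous (V := R_NormedModule) (fun x => / (1 + x * x))).
    auto_derive. repeat split. nra.
Qed.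

Lemma C1_real_arcsinh (f : triple -> R) : C1_real f -> C1_real (fun p => arcsinh (f p)).
Proof.
  intros H. apply (C1_real_comp arcsinh (fun x => / sqrt (x * x + 1)) f H). intros p. split.
  - eapply is_derive_eq; [apply is_derive_Reals, derivable_pt_lim_arcsinh|].
    do 2 f_equal; ring.
  - apply (ex_derive_continuous (V := R_NormedModule) (fun x => / sqrt (x * x + 1))).
    assert (H1 : 0 < f p * f p + 1) by nra. pose proof (sqrt_lt_R0 _ H1).
    auto_derive. repeat split; lra.
Qed.

Definition J2 : triple := (-1, 1, 1).

Section Cover.

Variable k : R.
Hypothesis Hk : 0 < k.

Let M := Surface plane (quadric_cover k) (-1) 1 1.
Let dv := quadric_cover k.

Lemma cover_C1 : C1_coord dv.
Proof.
  destruct C1_real_co as (H1 & H2 & _).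
  assert (K1 : C1_real (fun p => k * co1 p)) by (apply (C1_real_mult (fun _ => k) co1); trivial; apply C1_real_const).
  assert (K2 : C1_real (fun p => k * co2 p)) by (apply (C1_real_mult (fun _ => k) co2); trivial; apply C1_real_const).
  repeat split.
  - apply (C1_real_mult (fun p => sinh (k * co1 p)) (fun _ => / k)); [|apply C1_real_const].
    apply C1_real_sinh, K1.
  - apply (C1_real_mult (fun p => cosh (k * co1 p) * cos (k * co2 p)) (fun _ => / k)); [|apply C1_real_const].
    apply C1_real_mult; [apply C1_real_cosh, K1 | apply C1_real_cos, K2].
  - apply (C1_real_mult (fun p => cosh (k * co1 p) * sin (k * co2 p)) (fun _ => / k)); [|apply C1_real_const].
    apply C1_real_mult; [apply C1_real_cosh, K1 | apply C1_real_sin, K2].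
Qed.

Lemma cover_quadric (p : triple) : dot J2 (dv p) (dv p) = / (k * k).
Proof.
  destruct p as [[t u] w]. unfold dv, quadric_cover, J2, dot, co1, co2, co3; simpl.
  pose proof (cosh2_sinh2 (k * t)) as H1. pose proof (sin2_cos2 (k * u)) as H2. unfold Rsqr in H2.
  transitivity ((- (sinh (k * t) * sinh (k * t)) + cosh (k * t) * cosh (k * t) *
    (sin (k * u) * sin (k * u) + cos (k * u) * cos (k * u))) * / (k * k)).
  - field. lra.
  - rewrite H2, H1. field. lra.
Qed.

(** The differential of the covering; the inner factors k cancel the division by k. *)
Definition cover_deriv (p v : triple) : triple :=
  (cosh (k * co1 p) * co1 v,
   sinh (k * co1 p) * cos (k * co2 p) * co1 v - cosh (k * co1 p) * sin (k * co2 p) * co2 v,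
   sinh (k * co1 p) * sin (k * co2 p) * co1 v + cosh (k * co1 p) * cos (k * co2 p) * co2 v).

Lemma cover_has_vel (c : R -> triple) (s : R) (v : triple) :
  has_vel c s v -> has_vel (fun u => dv (c u)) s (cover_deriv (c s) v).
Proof.
  intros (H1 & H2 & _).
  assert (K1 : is_derive (fun u => k * co1 (c u)) s (k * co1 v)) by (apply is_derive_scal_R, H1).
  assert (K2 : is_derive (fun u => k * co2 (c u)) s (k * co2 v)) by (apply is_derive_scal_R, H2).
  pose proof (is_derive_comp_R cosh _ _ _ _ (is_derive_cosh _) K1) as Hch.
  pose proof (is_derive_comp_R sinh _ _ _ _ (is_derive_sinh _) K1) as Hsh.
  pose proof (is_derive_comp_R cos _ _ _ _ (is_derive_cos _) K2) as Hc.
  pose proof (is_derive_comp_R sin _ _ _ _ (is_derive_sin _) K2) as Hs.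
  assert (F : forall (f : R -> R) (a b : R), is_derive f s a -> a = k * b ->
    is_derive (fun u => f u / k) s b).
  { intros f a b Hf ->. eapply is_derive_eq.
    - apply (is_derive_mult_R f (fun _ => / k) _ _ _ Hf (is_derive_const_R _ _)).
    - cbn beta. field. lra. }
  split; [|split].
  - apply (F _ _ (cosh (k * co1 (c s)) * co1 v) Hsh). ring.
  - apply (F _ _ (sinh (k * co1 (c s)) * cos (k * co2 (c s)) * co1 v
      - cosh (k * co1 (c s)) * sin (k * co2 (c s)) * co2 v) (is_derive_mult_R _ _ _ _ _ Hch Hc)). cbn beta. ring.
  - apply (F _ _ (sinh (k * co1 (c s)) * sin (k * co2 (c s)) * co1 v
      + cosh (k * co1 (c s)) * cos (k * co2 (c s)) * co2 v) (is_derive_mult_R _ _ _ _ _ Hch Hs)). cbn beta. ring.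
Qed.

Lemma cover_tangent (p a : triple) :
  dot J2 a (cover_deriv p (1, 0, 0)) = 0 -> dot J2 a (cover_deriv p (0, 1, 0)) = 0 ->
  exists m, a = lin3 m (dv p) 0 (dv p) 0 (dv p).
Proof.
  intros H1 H2.
  pose proof (cosh2_sinh2 (k * co1 p)) as HI. pose proof (sin2_cos2 (k * co2 p)) as HJ. unfold Rsqr in HJ.
  pose proof (cosh_pos (k * co1 p)) as HC.
  unfold cover_deriv, J2, dot in H1, H2. unfold dv, quadric_cover.
  set (ch := cosh (k * co1 p)) in *. set (sh := sinh (k * co1 p)) in *.
  set (cs := cos (k * co2 p)) in *. set (sn := sin (k * co2 p)) in *. clearbody ch sh cs sn.
  destruct a as [[a1 a2] a3]. unfold co1, co2, co3 in H1, H2; simpl in H1, H2.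
  assert (E2 : a3 * cs = a2 * sn) by (apply (Rmult_eq_reg_l ch); lra).
  (* The factor is k^2 <a, dv p>, because <dv p, dv p> = 1/k^2. *)
  exists (k * (- sh * a1 + ch * cs * a2 + ch * sn * a3)).
  assert (R1 : a2 * cs + a3 * sn = ch * (- sh * a1 + ch * cs * a2 + ch * sn * a3)).
  { transitivity ((ch * ch - sh * sh) * (a2 * cs + a3 * sn)); [rewrite HI; ring|].
    transitivity (ch * (ch * cs * a2 + ch * sn * a3) - sh * (sh * (a2 * cs + a3 * sn))); [ring|].
    replace (sh * (a2 * cs + a3 * sn)) with (ch * a1) by lra. ring. }
  assert (R0 : a1 = sh * (- sh * a1 + ch * cs * a2 + ch * sn * a3)).
  { transitivity ((ch * ch - sh * sh) * a1); [rewrite HI; ring|].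
    transitivity (ch * (ch * a1) - sh * sh * a1); [ring|].
    replace (ch * a1) with (sh * (a2 * cs + a3 * sn)) by lra. ring. }
  set (m := - sh * a1 + ch * cs * a2 + ch * sn * a3) in *. clearbody m.
  apply triple_eq; unfold lin3, co1, co2, co3; simpl.
  - rewrite R0. field. lra.
  - transitivity (ch * m * cs); [|field; lra]. rewrite <- R1.
    transitivity (a2 * (sn * sn + cs * cs)); [rewrite HJ; ring|].
    transitivity (a2 * sn * sn + a2 * cs * cs); [ring|]. rewrite <- E2. ring.
  - transitivity (ch * m * sn); [|field; lra]. rewrite <- R1.
    transitivity (a3 * (sn * sn + cs * cs)); [rewrite HJ; ring|].
    transitivity (a3 * sn * sn + a3 * cs * cs); [ring|]. rewrite E2. ring.
Qed.

Lemma cover_deriv_derivable (c v : R -> triple) (s : R) :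
  curve_derivable c s -> curve_derivable v s -> curve_derivable (fun u => cover_deriv (c u) (v u)) s.
Proof.
  intros Hc (V1 & V2 & _). apply derivable_has_vel in Hc as (H1 & H2 & _).
  assert (K1 : is_derive (fun u => k * co1 (c u)) s (k * co1 (vel c s))) by (apply is_derive_scal_R, H1).
  assert (K2 : is_derive (fun u => k * co2 (c u)) s (k * co2 (vel c s))) by (apply is_derive_scal_R, H2).
  assert (Hch : ex_derive (fun u => cosh (k * co1 (c u))) s)
    by (eexists; apply (is_derive_comp_R cosh _ _ _ _ (is_derive_cosh _) K1)).
  assert (Hsh : ex_derive (fun u => sinh (k * co1 (c u))) s)
    by (eexists; apply (is_derive_comp_R sinh _ _ _ _ (is_derive_sinh _) K1)).
  assert (Hcs : ex_derive (fun u => cos (k * co2 (c u))) s)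
    by (eexists; apply (is_derive_comp_R cos _ _ _ _ (is_derive_cos _) K2)).
  assert (Hsn : ex_derive (fun u => sin (k * co2 (c u))) s)
    by (eexists; apply (is_derive_comp_R sin _ _ _ _ (is_derive_sin _) K2)).
  split; [|split].
  - apply (ex_derive_mult (fun u => cosh (k * co1 (c u))) (fun u => co1 (v u))); trivial.
  - apply (ex_derive_minus (V := R_NormedModule)
      (fun u => sinh (k * co1 (c u)) * cos (k * co2 (c u)) * co1 (v u))
      (fun u => cosh (k * co1 (c u)) * sin (k * co2 (c u)) * co2 (v u)));
    apply ex_derive_mult; trivial; apply ex_derive_mult; trivial.
  - apply (ex_derive_plus (V := R_NormedModule)
      (fun u => sinh (k * co1 (c u)) * sin (k * co2 (c u)) * co1 (v u))
      (fun u => cosh (k * co1 (c u)) * cos (k * co2 (c u)) * co2 (v u)));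
    apply ex_derive_mult; trivial; apply ex_derive_mult; trivial.
Qed.

Lemma cover_geodesic (g : R -> triple) : geodesic M g -> exists e, 0 < e /\
  forall s, - e < s < 1 + e ->
    carrier M (g s) /\ curve_derivable g s /\
    curve_derivable (fun u => dev M (g u)) s /\ curve_derivable (dvel M g) s /\
    exists m, vel (dvel M g) s = lin3 m (dev M (g s)) 0 (dev M (g s)) 0 (dev M (g s)).
Proof.
  intros (e & He & H). exists e. split; trivial. intros s Hs.
  destruct (H s Hs) as (C & D1 & D2 & HT).
  split; [trivial|]. split; [trivial|]. split; [apply C1_coord_chain; trivial; apply cover_C1|].
  split.
  - apply (curve_derivable_ext_loc (fun u => cover_deriv (g u) (vel g u))).
    + apply (interval_locally (- e) (1 + e)); trivial. intros t Ht. symmetry.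
      apply has_vel_vel, cover_has_vel, derivable_has_vel. apply H, Ht.
    + apply cover_deriv_derivable; trivial.
  (* Straight lines in the coordinate plane provide all tangent vectors at [g s]. *)
  - assert (HV : forall a b : R,
      dot J2 (vel (dvel M g) s) (cover_deriv (g s) (a, b, 0)) = 0).
    { intros a b.
      set (c := fun u => (co1 (g s) + u * a, co2 (g s) + u * b, 0) : triple).
      assert (E0 : c 0 = g s).
      { apply triple_eq;
          [change (co1 (g s) + 0 * a = co1 (g s)); ring
          |change (co2 (g s) + 0 * b = co2 (g s)); ring
          |symmetry; exact C]. }
      assert (Hc : has_vel c 0 (a, b, 0)).
      { split; [|split]; unfold c; unfold co1, co2, co3; simpl; auto_derive; trivial; ring. }
      rewrite <- E0. rewrite <- (has_vel_vel _ _ _ (cover_has_vel _ _ _ Hc)).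
      apply HT; trivial; [intros u; reflexivity | apply (has_vel_derivable _ _ _ Hc)]. }
    apply cover_tangent; apply HV.
Qed.

Lemma sinh_inj (x y : R) : sinh x = sinh y -> x = y.
Proof. intros H. rewrite <- (arcsinh_sinh x), <- (arcsinh_sinh y), H. reflexivity. Qed.

Lemma cover_eq (p q : triple) : dv p = dv q ->
  co1 p = co1 q /\ cos (k * co2 p) = cos (k * co2 q) /\ sin (k * co2 p) = sin (k * co2 q).
Proof.
  intros H.
  assert (E1 : sinh (k * co1 p) / k = sinh (k * co1 q) / k) by exact (f_equal co1 H).
  assert (E2 : cosh (k * co1 p) * cos (k * co2 p) / k = cosh (k * co1 q) * cos (k * co2 q) / k) by exact (f_equal co2 H).
  assert (E3 : cosh (k * co1 p) * sin (k * co2 p) / k = cosh (k * co1 q) * sin (k * co2 q) / k) by exact (f_equal co3 H).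
  assert (F : forall x y, x / k = y / k -> x = y).
  { intros x y E. apply (Rmult_eq_reg_r (/ k)); [exact E | apply Rinv_neq_0_compat; lra]. }
  apply F, sinh_inj in E1. rewrite E1 in E2, E3. apply F, Rmult_eq_reg_l in E2; [|pose proof (cosh_pos (k * co1 q)); lra].
  apply F, Rmult_eq_reg_l in E3; [|pose proof (cosh_pos (k * co1 q)); lra].
  split; [apply (Rmult_eq_reg_l k); lra|]. split; trivial.
Qed.

(** Half the difference lies strictly between -PI and PI and has zero sine. *)
Lemma angle_eq (x y : R) : cos x = cos y -> sin x = sin y -> Rabs (x - y) < 2 * PI -> x = y.
Proof.
  intros Hc Hs Hd.
  assert (H1 : cos (x - y) = 1).
  { rewrite cos_minus, Hc, Hs. pose proof (sin2_cos2 y) as H; unfold Rsqr in H; lra. }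
  assert (H2 : sin ((x - y) / 2) = 0).
  { assert (H : cos (2 * ((x - y) / 2)) = 1) by (rewrite <- H1; f_equal; field).
    rewrite cos_2a_sin in H. nra. }
  apply Rabs_def2 in Hd. destruct (Req_dec x y) as [|Hn]; [trivial|exfalso].
  destruct (Rlt_dec x y).
  - pose proof (sin_gt_0 (- ((x - y) / 2))) as H. rewrite sin_neg in H. lra.
  - pose proof (sin_gt_0 ((x - y) / 2)) as H. lra.
Qed.

(** The angle difference d satisfies cos d = 1 and sin d = 0 throughout. Differentiating sin d = 0
    gives d' = 0, so d keeps its initial value 0. *)
Lemma cover_path (g h : R -> triple) (e : R) : 0 < e ->
  (forall s, - e < s < 1 + e -> plane (g s) /\ plane (h s) /\
     curve_derivable g s /\ curve_derivable h s) ->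
  (forall s, 0 <= s <= 1 -> dv (g s) = dv (h s)) ->
  g 0 = h 0 -> forall s, 0 <= s <= 1 -> g s = h s.
Proof.
  intros He H HE H0.
  set (d := fun s => k * co2 (g s) - k * co2 (h s)).
  assert (Hd : forall s, - e < s < 1 + e -> ex_derive d s).
  { intros s Hs. destruct (H s Hs) as (_ & _ & (_ & G & _) & (_ & G' & _)).
    apply (ex_derive_minus (V := R_NormedModule) (fun s => k * co2 (g s)) (fun s => k * co2 (h s)));
    apply (ex_derive_scal (fun s => co2 _)); trivial. }
  assert (Hcs : forall s, 0 <= s <= 1 -> cos (d s) = 1 /\ sin (d s) = 0).
  { intros s Hs. destruct (cover_eq _ _ (HE s Hs)) as (_ & E2 & E3). unfold d.
    rewrite cos_minus, sin_minus, E2, E3.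
    pose proof (sin2_cos2 (k * co2 (h s))) as HI; unfold Rsqr in HI. split; lra. }
  assert (Hd0 : forall s, 0 < s < 1 -> is_derive d s 0).
  { intros s Hs. assert (Hs' : - e < s < 1 + e) by lra. destruct (Hd s Hs') as (l & Hl).
    pose proof (is_derive_comp_R sin d s _ _ (is_derive_sin _) Hl) as HS.
    apply (derive_locally_const _ 0 1 0) in HS; trivial.
    - destruct (Hcs s) as (Ec & _); [lra|]. rewrite Ec in HS.
      eapply is_derive_eq; [exact Hl|]. lra.
    - intros t Ht. apply Hcs; lra. }
  assert (Hd00 : d 0 = 0) by (unfold d; rewrite H0; ring).
  assert (HZ : forall s, 0 <= s <= 1 -> d s = 0).
  { intros s Hs. destruct (Req_dec s 0) as [->|Hs0]; [trivial|].
    destruct (MVT_gen d 0 s (fun _ => 0)) as (c & _ & Hc).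
    - intros t Ht. apply Hd0. rewrite Rmin_left, Rmax_right in Ht by lra. lra.
    - intros t Ht. rewrite Rmin_left, Rmax_right in Ht by lra.
      apply continuity_pt_filterlim, (ex_derive_continuous (V := R_NormedModule)). apply Hd. lra.
    - lra. }
  intros s Hs. destruct (cover_eq _ _ (HE s Hs)) as (E1 & _).
  destruct (H s) as (P1 & P2 & _); [lra|].
  apply triple_eq; trivial.
  - pose proof (HZ s Hs) as Hz. unfold d in Hz. apply (Rmult_eq_reg_l k); lra.
  - unfold plane in P1, P2. congruence.
Qed.

Lemma cover_inj (p q : triple) : dv p = dv q -> co3 p = co3 q ->
  Rabs (k * co2 p - k * co2 q) < 2 * PI -> p = q.
Proof.
  intros H H3 Hd. destruct (cover_eq _ _ H) as (E1 & E2 & E3).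
  apply triple_eq; trivial. apply (Rmult_eq_reg_l k); [|lra]. apply angle_eq; trivial.
Qed.

(** Lift and inverse are required on all of R^3 and not only on the plane, which makes the class
    closed under composition and inversion. Keeping the third coordinate keeps the carrier. *)
Record lift_pair (f f' L L' : triple -> triple) : Prop := {
  lp_C1 : C1_coord f;
  lp_C1' : C1_coord f';
  lp_plane : forall p, co3 (f p) = co3 p;
  lp_plane' : forall p, co3 (f' p) = co3 p;
  lp_l : forall p, f' (f p) = p;
  lp_r : forall p, f (f' p) = p;
  lp_dev : forall p, dv (f p) = L (dv p);
  lp_dev' : forall p, dv (f' p) = L' (dv p);
  lp_isom : isom_pair J2 L L'
}.

Lemma isom_pair_sym (J : triple) (L L' : triple -> triple) : isom_pair J L L' -> isom_pair J L' L.
Proof. intros [H1 H2 H3 H4]; split; trivial. Qed.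

Lemma isom_pair_comp (J : triple) (L1 L1' L2 L2' : triple -> triple) :
  isom_pair J L1 L1' -> isom_pair J L2 L2' ->
  isom_pair J (fun v => L1 (L2 v)) (fun v => L2' (L1' v)).
Proof.
  intros [[A1 A2] [A1' A2'] A3 A4] [[B1 B2] [B1' B2'] B3 B4].
  split; [split|split| |]; intros; congruence.
Qed.

Lemma lift_pair_sym (f f' L L' : triple -> triple) : lift_pair f f' L L' -> lift_pair f' f L' L.
Proof. intros [H1 H2 H3 H4 H5 H6 H7 H8 H9]; split; trivial. apply isom_pair_sym, H9. Qed.

Lemma lift_pair_comp (f f' L L' g g' N N' : triple -> triple) :
  lift_pair f f' L L' -> lift_pair g g' N N' ->
  lift_pair (fun p => f (g p)) (fun p => g' (f' p)) (fun v => L (N v)) (fun v => N' (L' v)).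
Proof.
  intros [H1 H2 H3 H4 H5 H6 H7 H8 H9] [G1 G2 G3 G4 G5 G6 G7 G8 G9].
  split; try (intros; congruence).
  - apply C1_coord_comp; trivial.
  - apply C1_coord_comp; trivial.
  - apply isom_pair_comp; trivial.
Qed.

Lemma lift_pair_isometry (f f' L L' : triple -> triple) : lift_pair f f' L L' -> lifts_isom M L f.
Proof.
  intros [H1 H2 H3 H4 H5 H6 H7 H8 H9]. split.
  - split; [apply C1_coord_C1_map, H1|]. split.
    + exists f'. split; [apply C1_coord_C1_map, H2|]. intros p Hp.
      change (co3 p = 0) in Hp. repeat split; trivial; red; simpl; unfold plane; congruence.
    + intros c s _ Hc. rewrite !form_dot. change (sig M) with J2.
      assert (Hd : has_vel (fun u => dv (c u)) s (vel (fun u => dv (c u)) s)).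
      { apply derivable_has_vel, C1_coord_chain; trivial. apply cover_C1. }
      assert (E : vel (fun u => dv (f (c u))) s = L (vel (fun u => dv (c u)) s)).
      { apply has_vel_vel. apply (has_vel_ext_loc (fun u => L (dv (c u)))).
        - apply filter_forall. intros u. symmetry; apply H7.
        - apply (has_vel_isom J2); trivial. apply (pair_isom H9). }
      change (dot J2 (vel (fun u => dv (f (c u))) s) (vel (fun u => dv (f (c u))) s) =
        dot J2 (vel (fun u => dv (c u)) s) (vel (fun u => dv (c u)) s)).
      rewrite E. apply (isom_dot (pair_isom H9)).
  - intros p _. apply H7.
  - intros c s Hc. apply C1_coord_chain; trivial.
Qed.

Definition cover_shift (a : R) (p : triple) : triple := (co1 p, co2 p + a, co3 p).

Definition rot (a : R) (v : triple) : triple :=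
  (co1 v, cos a * co2 v - sin a * co3 v, sin a * co2 v + cos a * co3 v).

Lemma rot_isom (a : R) : lin_isom J2 (rot a).
Proof.
  pose proof (sin2_cos2 a) as H. unfold Rsqr in H.
  split.
  - intros; unfold rot; triple_ring.
  - intros [[v1 v2] v3] [[w1 w2] w3]. unfold rot, J2, dot, co1, co2, co3; simpl.
    transitivity (-1 * v1 * w1 + (sin a * sin a + cos a * cos a) * (v2 * w2 + v3 * w3)); [ring|].
    rewrite H; ring.
Qed.

Lemma rot_inv (a : R) (v : triple) : rot (- a) (rot a v) = v.
Proof.
  pose proof (sin2_cos2 a) as H. unfold Rsqr in H.
  unfold rot. rewrite cos_neg, sin_neg. destruct v as [[v1 v2] v3].
  coordwise; [ring| |].
  - transitivity ((sin a * sin a + cos a * cos a) * v2); [ring|rewrite H; ring].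
  - transitivity ((sin a * sin a + cos a * cos a) * v3); [ring|rewrite H; ring].
Qed.

Lemma cover_shift_C1 (a : R) : C1_coord (cover_shift a).
Proof.
  destruct C1_real_co as (H1 & H2 & H3). split; [exact H1|split; [|exact H3]].
  apply (C1_real_plus co2 (fun _ => a) H2), C1_real_const.
Qed.

Lemma cover_shift_dev (a : R) (p : triple) : dv (cover_shift a p) = rot (k * a) (dv p).
Proof.
  unfold dv, quadric_cover, cover_shift, rot. destruct p as [[p1 p2] p3]. unfold co1, co2, co3; simpl.
  rewrite Rmult_plus_distr_l, cos_plus, sin_plus.
  coordwise; field; lra.
Qed.

Lemma cover_shift_lift_pair (a : R) : lift_pair (cover_shift a) (cover_shift (- a)) (rot (k * a)) (rot (k * - a)).
Proof.
  split; try (intros; reflexivity).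
  - apply cover_shift_C1.
  - apply cover_shift_C1.
  - intros [[p1 p2] p3]. unfold cover_shift. coordwise; ring.
  - intros [[p1 p2] p3]. unfold cover_shift. coordwise; ring.
  - intros; apply cover_shift_dev.
  - intros; apply cover_shift_dev.
  - split; try apply rot_isom; intros v.
    + replace (k * - a) with (- (k * a)) by ring. apply rot_inv.
    + replace (k * a) with (- (k * - a)) by ring. apply rot_inv.
Qed.

Definition refl (d e : R) (v : triple) : triple := (d * co1 v, co2 v, e * co3 v).
Definition refl_cover (d e : R) (p : triple) : triple := (d * co1 p, e * co2 p, co3 p).

Lemma sign_cases (d : R) : d * d = 1 -> d = 1 \/ d = -1.
Proof. intros H. destruct (Rlt_dec d 0); [right|left]; nra. Qed.

Lemma refl_lift_pair (d e : R) : d * d = 1 -> e * e = 1 ->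
  lift_pair (refl_cover d e) (refl_cover d e) (refl d e) (refl d e).
Proof.
  intros Hd He.
  assert (HC : C1_coord (refl_cover d e)).
  { destruct C1_real_co as (H1 & H2 & H3). split; [|split; [|exact H3]].
    - apply (C1_real_mult (fun _ => d) co1); trivial; apply C1_real_const.
    - apply (C1_real_mult (fun _ => e) co2); trivial; apply C1_real_const. }
  assert (HI : forall p, refl_cover d e (refl_cover d e p) = p).
  { intros [[p1 p2] p3]. unfold refl_cover. coordwise; try reflexivity.
    - transitivity (d * d * p1); [ring|rewrite Hd; ring].
    - transitivity (e * e * p2); [ring|rewrite He; ring]. }
  assert (HL : forall p, refl d e (refl d e p) = p).
  { intros [[p1 p2] p3]. unfold refl. coordwise; try reflexivity.
    - transitivity (d * d * p1); [ring|rewrite Hd; ring].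
    - transitivity (e * e * p3); [ring|rewrite He; ring]. }
  assert (HD : forall p, dv (refl_cover d e p) = refl d e (dv p)).
  { intros [[p1 p2] p3]. unfold dv, quadric_cover, refl_cover, refl. unfold co1, co2, co3; simpl.
    assert (S1 : sinh (k * (d * p1)) = d * sinh (k * p1) /\ cosh (k * (d * p1)) = cosh (k * p1)).
    { destruct (sign_cases d Hd) as [-> | ->]; [rewrite !Rmult_1_l; split; reflexivity|].
      replace (k * (-1 * p1)) with (- (k * p1)) by ring.
      unfold sinh, cosh. rewrite Ropp_involutive. split; field. }
    assert (S2 : sin (k * (e * p2)) = e * sin (k * p2) /\ cos (k * (e * p2)) = cos (k * p2)).
    { destruct (sign_cases e He) as [-> | ->]; [rewrite !Rmult_1_l; split; reflexivity|].
      replace (k * (-1 * p2)) with (- (k * p2)) by ring. rewrite sin_neg, cos_neg. split; ring. }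
    destruct S1 as (-> & ->), S2 as (-> & ->).
    coordwise; field; lra. }
  assert (HS : lin_isom J2 (refl d e)).
  { split.
    - intros; unfold refl; triple_ring.
    - intros [[v1 v2] v3] [[w1 w2] w3]. unfold refl, J2, dot, co1, co2, co3; simpl.
      transitivity (- (d * d) * v1 * w1 + v2 * w2 + (e * e) * v3 * w3); [ring|].
      rewrite Hd, He; ring. }
  split; trivial; try (intros; reflexivity). split; trivial.
Qed.

End Cover.

Arguments lp_C1 {k f f' L L'} _.
Arguments lp_C1' {k f f' L L'} _.
Arguments lp_plane {k f f' L L'} _.
Arguments lp_plane' {k f f' L L'} _.
Arguments lp_l {k f f' L L'} _.
Arguments lp_r {k f f' L L'} _.
Arguments lp_dev {k f f' L L'} _.
Arguments lp_dev' {k f f' L L'} _.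
Arguments lp_isom {k f f' L L'} _.
Arguments lift_pair_sym {k f f' L L'} _.
Arguments lift_pair_comp {k f f' L L' g g' N N'} _ _.

(** * Lifting Lorentz transformations *)

Lemma cosh_arcsinh (x : R) : cosh (arcsinh x) = sqrt (1 + x * x).
Proof.
  symmetry. apply sqrt_lem_1.
  - nra.
  - pose proof (cosh_pos (arcsinh x)); lra.
  - rewrite cosh2_sinh2, sinh_arcsinh. reflexivity.
Qed.

Lemma cos_sin_2atan (q : R) :
  cos (2 * atan q) = (1 - q * q) / (1 + q * q) /\ sin (2 * atan q) = 2 * q / (1 + q * q).
Proof.
  rewrite cos_2a, sin_2a, cos_atan, sin_atan. unfold Rsqr.
  assert (H : 0 < 1 + q * q) by nra. pose proof (sqrt_lt_R0 _ H) as H1.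
  pose proof (sqrt_sqrt (1 + q * q) (Rlt_le _ _ H)) as H2.
  split.
  - transitivity ((1 - q * q) / (sqrt (1 + q * q) * sqrt (1 + q * q))); [field; lra|rewrite H2; reflexivity].
  - transitivity (2 * q / (sqrt (1 + q * q) * sqrt (1 + q * q))); [field; lra|rewrite H2; reflexivity].
Qed.

Lemma half_angle (I N r : R) : I * I + N * N = r * r -> 0 < r -> 0 < r + I ->
  r * cos (2 * atan (N / (r + I))) = I /\ r * sin (2 * atan (N / (r + I))) = N.
Proof.
  intros HI Hr H. destruct (cos_sin_2atan (N / (r + I))) as (-> & ->).
  assert (E : 1 + N / (r + I) * (N / (r + I)) = 2 * r / (r + I)).
  { transitivity ((r * r + 2 * r * I + (I * I + N * N)) / ((r + I) * (r + I))); [field; lra|].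
    rewrite HI. field. lra. }
  assert (E' : 1 - N / (r + I) * (N / (r + I)) = 2 * I / (r + I)).
  { transitivity ((r * r + 2 * r * I + I * I - N * N) / ((r + I) * (r + I))); [field; lra|].
    replace (N * N) with (r * r - I * I) by lra. field. lra. }
  rewrite E, E'. split; field; lra.
Qed.

Definition boost (a : R) (v : triple) : triple :=
  (cosh a * co1 v + sinh a * co2 v, sinh a * co1 v + cosh a * co2 v, co3 v).

Lemma boost_isom (a : R) : lin_isom J2 (boost a).
Proof.
  pose proof (cosh2_sinh2 a) as H.
  split.
  - intros; unfold boost; triple_ring.
  - intros [[v1 v2] v3] [[w1 w2] w3]. unfold boost, J2, dot, co1, co2, co3; simpl.
    transitivity ((cosh a * cosh a - sinh a * sinh a) * (-1 * v1 * w1 + v2 * w2) + v3 * w3); [ring|].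
    rewrite H; ring.
Qed.

Lemma cosh_sinh_opp (a : R) : cosh (- a) = cosh a /\ sinh (- a) = - sinh a.
Proof. unfold cosh, sinh. rewrite Ropp_involutive. split; field. Qed.

Lemma boost_inv (a : R) (v : triple) : boost (- a) (boost a v) = v.
Proof.
  pose proof (cosh2_sinh2 a) as H. unfold boost. destruct (cosh_sinh_opp a) as (-> & ->).
  destruct v as [[v1 v2] v3]. coordwise; [| |reflexivity].
  - transitivity ((cosh a * cosh a - sinh a * sinh a) * v1); [ring|rewrite H; ring].
  - transitivity ((cosh a * cosh a - sinh a * sinh a) * v2); [ring|rewrite H; ring].
Qed.

Section Boost.

Variable k : R.
Hypothesis Hk : 0 < k.

(** [boost_x], [boost_y] and [boost_z] are k times the coordinates of the boosted point, and
    [boost_radius] is the distance of this scaled point from the x-axis, as y^2 + z^2 = 1 + x^2.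
    [boost_inner] and [boost_cross] are that distance times the cosine and sine of the turn of the
    polar direction. *)
Definition boost_x (a : R) (p : triple) : R :=
  cosh a * sinh (k * co1 p) + sinh a * (cosh (k * co1 p) * cos (k * co2 p)).
Definition boost_y (a : R) (p : triple) : R :=
  sinh a * sinh (k * co1 p) + cosh a * (cosh (k * co1 p) * cos (k * co2 p)).
Definition boost_z (p : triple) : R := cosh (k * co1 p) * sin (k * co2 p).
Definition boost_inner (a : R) (p : triple) : R :=
  boost_y a p * cos (k * co2 p) + boost_z p * sin (k * co2 p).
Definition boost_cross (a : R) (p : triple) : R :=
  boost_z p * cos (k * co2 p) - boost_y a p * sin (k * co2 p).
Definition boost_radius (a : R) (p : triple) : R := sqrt (1 + boost_x a p * boost_x a p).

(* The polar angle is turned by the angle between the old and the new (y,z)-direction,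
   which stays in (-pi, pi): the two directions are never opposite. *)
Definition boost_cover (a : R) (p : triple) : triple :=
  (arcsinh (boost_x a p) / k,
   co2 p + 2 * atan (boost_cross a p / (boost_radius a p + boost_inner a p)) / k,
   co3 p).

Lemma boost_radius_sqr (a : R) (p : triple) :
  0 < boost_radius a p /\
  boost_radius a p * boost_radius a p = 1 + boost_x a p * boost_x a p /\
  1 + boost_x a p * boost_x a p = boost_y a p * boost_y a p + boost_z p * boost_z p /\
  boost_inner a p * boost_inner a p + boost_cross a p * boost_cross a p
    = boost_radius a p * boost_radius a p.
Proof.
  assert (H : 0 < 1 + boost_x a p * boost_x a p) by nra.
  assert (E : boost_radius a p * boost_radius a p = 1 + boost_x a p * boost_x a p)
    by (apply sqrt_sqrt; lra).
  assert (E' : 1 + boost_x a p * boost_x a p = boost_y a p * boost_y a p + boost_z p * boost_z p).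
  { unfold boost_x, boost_y, boost_z.
    pose proof (cosh2_sinh2 a) as Ha. pose proof (cosh2_sinh2 (k * co1 p)) as Ht.
    pose proof (sin2_cos2 (k * co2 p)) as Hs; unfold Rsqr in Hs.
    generalize dependent (cosh a). generalize (sinh a).
    generalize dependent (cosh (k * co1 p)). generalize (sinh (k * co1 p)).
    generalize dependent (cos (k * co2 p)). generalize (sin (k * co2 p)).
    intros sn cs Hs sh ch Ht sa ca Ha.
    transitivity (1 + (ca * sh + sa * (ch * cs)) * (ca * sh + sa * (ch * cs))); [reflexivity|].
    replace ((ch * sn) * (ch * sn)) with (ch * ch * (sn * sn)) by ring.
    replace (sn * sn) with (1 - cs * cs) by lra.
    assert ((ca * ca - sa * sa) * (ch * ch * cs * cs - sh * sh) = ch * ch * cs * cs - sh * sh)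
      by (replace (ca * ca - sa * sa) with 1 by lra; ring).
    lra. }
  split; [apply sqrt_lt_R0, H|]. split; [exact E|]. split; [exact E'|].
  rewrite E, E'. unfold boost_inner, boost_cross.
  pose proof (sin2_cos2 (k * co2 p)) as Hs; unfold Rsqr in Hs.
  set (y := boost_y a p). set (z := boost_z p).
  transitivity ((y * y + z * z) * (sin (k * co2 p) * sin (k * co2 p) + cos (k * co2 p) * cos (k * co2 p))); [ring|].
  rewrite Hs; ring.
Qed.

(** A nonzero cross term forces |inner| < radius. If it vanishes, either the point lies in the plane
    z = 0, where |sinh a sinh (k t)| < cosh a cosh (k t) preserves the sign of y, or the boost
    leaves y unchanged, and then inner = cosh (k t). *)
Lemma boost_not_opposite (a : R) (p : triple) : 0 < boost_radius a p + boost_inner a p.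
Proof.
  destruct (boost_radius_sqr a p) as (Hr & _ & _ & HI).
  destruct (Req_dec (boost_cross a p) 0) as [H0|H0].
  - assert (H : 0 < boost_inner a p); [|lra].
    unfold boost_cross, boost_inner, boost_y, boost_z in *. clear HI Hr.
    pose proof (cosh2_sinh2 a) as Ha. pose proof (cosh2_sinh2 (k * co1 p)) as Ht.
    pose proof (sin2_cos2 (k * co2 p)) as Hs; unfold Rsqr in Hs.
    pose proof (cosh_pos a) as Pa. pose proof (cosh_pos (k * co1 p)) as Pt.
    generalize dependent (cosh a). generalize (sinh a).
    generalize dependent (cosh (k * co1 p)). generalize (sinh (k * co1 p)).
    generalize dependent (cos (k * co2 p)). generalize (sin (k * co2 p)).
    intros sn cs Hs sh ch Ht Pt sa ca H0 Ha Pa.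
    assert (F : sn * (ch * cs - (sa * sh + ca * (ch * cs))) = 0) by lra.
    apply Rmult_integral in F as [F|F].
    + subst sn. assert (Hcs : cs * cs = 1) by lra.
      assert (Hb : (sa * sh) * (sa * sh) < (ca * ch) * (ca * ch)).
      { replace ((ca * ch) * (ca * ch)) with ((ca * ca) * (ch * ch)) by ring. rewrite Ha, Ht. nra. }
      assert (Hp : 0 < ca * ch) by (apply Rmult_lt_0_compat; trivial).
      destruct (sign_cases cs Hcs) as [-> | ->]; nra.
    + replace (sa * sh + ca * (ch * cs)) with (ch * cs) by lra.
      replace (ch * cs * cs + ch * sn * sn) with (ch * (sn * sn + cs * cs)) by ring.
      rewrite Hs; lra.
  - destruct (Rlt_dec 0 (boost_radius a p + boost_inner a p)); [trivial|exfalso].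
    assert (0 < boost_cross a p * boost_cross a p) by (destruct (Rlt_dec 0 (boost_cross a p)); nra).
    nra.
Qed.

Lemma boost_dev (a : R) (p : triple) :
  quadric_cover k (boost_cover a p) = boost a (quadric_cover k p).
Proof.
  destruct (boost_radius_sqr a p) as (Hr & Hr2 & HX & HI).
  destruct (half_angle _ _ _ HI Hr (boost_not_opposite a p)) as (Hc & Hs).
  set (d := 2 * atan (boost_cross a p / (boost_radius a p + boost_inner a p))) in *.
  pose proof (sin2_cos2 (k * co2 p)) as HS; unfold Rsqr in HS.
  assert (E1 : k * co1 (boost_cover a p) = arcsinh (boost_x a p)).
  { unfold boost_cover; unfold co1 at 1; simpl. field. lra. }
  assert (E2 : k * co2 (boost_cover a p) = k * co2 p + d).
  { unfold boost_cover; fold d. unfold co2 at 1; simpl. field. lra. }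
  unfold quadric_cover at 1. rewrite E1, E2, sinh_arcsinh, cosh_arcsinh. fold (boost_radius a p).
  rewrite cos_plus, sin_plus.
  apply triple_eq.
  - change (boost_x a p / k = cosh a * (sinh (k * co1 p) / k) + sinh a * (cosh (k * co1 p) * cos (k * co2 p) / k)).
    unfold boost_x. field. lra.
  - change (boost_radius a p * (cos (k * co2 p) * cos d - sin (k * co2 p) * sin d) / k =
      sinh a * (sinh (k * co1 p) / k) + cosh a * (cosh (k * co1 p) * cos (k * co2 p) / k)).
    transitivity ((boost_radius a p * cos d * cos (k * co2 p) - boost_radius a p * sin d * sin (k * co2 p)) / k);
      [field; lra|].
    rewrite Hc, Hs. transitivity (boost_y a p / k); [|unfold boost_y; field; lra].
    f_equal. unfold boost_inner, boost_cross.
    transitivity (boost_y a p * (sin (k * co2 p) * sin (k * co2 p) + cos (k * co2 p) * cos (k * co2 p)));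
      [ring|rewrite HS; ring].
  - change (boost_radius a p * (sin (k * co2 p) * cos d + cos (k * co2 p) * sin d) / k = boost_z p / k).
    f_equal.
    transitivity (boost_radius a p * cos d * sin (k * co2 p) + boost_radius a p * sin d * cos (k * co2 p)); [ring|].
    rewrite Hc, Hs. unfold boost_inner, boost_cross.
    transitivity (boost_z p * (sin (k * co2 p) * sin (k * co2 p) + cos (k * co2 p) * cos (k * co2 p)));
      [ring|rewrite HS; ring].
Qed.

Lemma boost_displacement (a : R) (p : triple) :
  Rabs (k * co2 (boost_cover a p) - k * co2 p) < PI.
Proof.
  unfold boost_cover; unfold co2 at 1; simpl.
  replace (_ - _) with (2 * atan (boost_cross a p / (boost_radius a p + boost_inner a p))) by (field; lra).
  pose proof (atan_bound (boost_cross a p / (boost_radius a p + boost_inner a p))).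
  apply Rabs_def1; lra.
Qed.

Lemma boost_C1 (a : R) : C1_coord (boost_cover a).
Proof.
  destruct C1_real_co as (H1 & H2 & H3).
  assert (K1 : C1_real (fun p => k * co1 p)) by (apply (C1_real_mult (fun _ => k) co1); trivial; apply C1_real_const).
  assert (K2 : C1_real (fun p => k * co2 p)) by (apply (C1_real_mult (fun _ => k) co2); trivial; apply C1_real_const).
  pose proof (C1_real_sinh _ K1) as Csh. pose proof (C1_real_cosh _ K1) as Cch.
  pose proof (C1_real_sin _ K2) as Csn. pose proof (C1_real_cos _ K2) as Ccs.
  assert (Cm : forall c f, C1_real f -> C1_real (fun p => c * f p)).
  { intros c f Hf. apply (C1_real_mult (fun _ => c) f); trivial. apply C1_real_const. }
  pose proof (C1_real_mult _ _ Cch Ccs) as Cy.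
  assert (Cx' : C1_real (boost_x a)).
  { apply (C1_real_plus _ _ (Cm (cosh a) _ Csh) (Cm (sinh a) _ Cy)). }
  assert (Cy' : C1_real (boost_y a)).
  { apply (C1_real_plus _ _ (Cm (sinh a) _ Csh) (Cm (cosh a) _ Cy)). }
  pose proof (C1_real_mult _ _ Cch Csn : C1_real boost_z) as Cz'.
  assert (Ci : C1_real (boost_inner a)).
  { apply (C1_real_plus _ _ (C1_real_mult _ _ Cy' Ccs) (C1_real_mult _ _ Cz' Csn)). }
  assert (Cc : C1_real (boost_cross a)).
  { apply (C1_real_ext (fun p => boost_z p * cos (k * co2 p) + -1 * (boost_y a p * sin (k * co2 p)))).
    - intros p. unfold boost_cross. ring.
    - apply (C1_real_plus _ _ (C1_real_mult _ _ Cz' Ccs) (Cm (-1) _ (C1_real_mult _ _ Cy' Csn))). }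
  assert (Cr : C1_real (boost_radius a)).
  { apply (C1_real_sqrt (fun p => 1 + boost_x a p * boost_x a p)).
    - apply (C1_real_plus (fun _ => 1)); [apply C1_real_const|apply C1_real_mult; trivial].
    - intros p. nra. }
  split; [|split; [|exact H3]].
  - apply (C1_real_mult (fun p => arcsinh (boost_x a p)) (fun _ => / k)); [|apply C1_real_const].
    apply C1_real_arcsinh, Cx'.
  - apply (C1_real_plus co2 (fun p => 2 * atan (boost_cross a p / (boost_radius a p + boost_inner a p)) / k) H2).
    apply (C1_real_mult (fun p => 2 * atan (boost_cross a p / (boost_radius a p + boost_inner a p))) (fun _ => / k));
      [|apply C1_real_const].
    apply Cm, C1_real_atan. apply (C1_real_mult (boost_cross a)); trivial.
    apply (C1_real_inv (fun p => boost_radius a p + boost_inner a p)).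
    + apply C1_real_plus; trivial.
    + intros p. pose proof (boost_not_opposite a p). lra.
Qed.

(** The composite has the development of p and displaces the angle by less than 2 PI, so [cover_inj]
    applies. *)
Lemma boost_cover_inv (a : R) (p : triple) : boost_cover (- a) (boost_cover a p) = p.
Proof.
  apply (cover_inj k Hk); [|reflexivity|].
  - rewrite !boost_dev. apply boost_inv.
  - pose proof (boost_displacement a p) as H1. pose proof (boost_displacement (- a) (boost_cover a p)) as H2.
    apply Rabs_def2 in H1, H2. apply Rabs_def1; lra.
Qed.

Lemma boost_lift_pair (a : R) : lift_pair k (boost_cover a) (boost_cover (- a)) (boost a) (boost (- a)).
Proof.
  split; try (intros; reflexivity).
  - apply boost_C1.
  - apply boost_C1.
  - apply boost_cover_inv.
  - intros p. rewrite <- (Ropp_involutive a) at 1. apply boost_cover_inv.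
  - apply boost_dev.
  - apply boost_dev.
  - split; try apply boost_isom.
    + apply boost_inv.
    + intros v. rewrite <- (Ropp_involutive a) at 1. apply boost_inv.
Qed.

(** The inverse is determined by [N], so it suffices to compare the maps in one direction. *)
Lemma lift_pair_ext (f f' L L' N N' : triple -> triple) :
  (forall v, N v = L v) -> isom_pair J2 N N' -> lift_pair k f f' L L' -> lift_pair k f f' N N'.
Proof.
  intros HN HI [H1 H2 H3 H4 H5 H6 H7 H8 H9]. split; trivial.
  - intros p. rewrite HN. apply H7.
  - intros p. rewrite H8. rewrite <- (pair_l HI (L' (quadric_cover k p))).
    f_equal. rewrite HN. apply (pair_r H9).
Qed.

Lemma dev_origin : quadric_cover k (0, 0, 0) = (0, / k, 0).
Proof.
  unfold quadric_cover, co1, co2; simpl. rewrite Rmult_0_r, sinh_0, cosh_0, cos_0, sin_0.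
  coordwise; field; lra.
Qed.

(** An isometry fixing the y-axis acts on the (x, z)-plane as reflections followed by a boost. A
    quarter turn conjugates this boost to one of the (x, y)-plane, whose lift is explicit. *)
Lemma origin_lift (L L' : triple -> triple) :
  isom_pair J2 L L' -> L (0, / k, 0) = (0, / k, 0) ->
  exists f f', lift_pair k f f' L L' /\ f (0, 0, 0) = (0, 0, 0) /\
    exists e, e * e = 1 /\ forall p, Rabs (k * co2 (f p) - e * (k * co2 p)) < PI.
Proof.
  intros HL H0. pose proof (pair_isom HL) as HLi.
  assert (H2 : L (0, 1, 0) = (0, 1, 0)).
  { transitivity (L (lin3 k (0, / k, 0) 0 (0, 0, 0) 0 (0, 0, 0))).
    - f_equal. coordwise; field; lra.
    - rewrite (isom_lin HLi), H0. coordwise; field; lra. }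
  pose proof (isom_dot HLi (1, 0, 0) (1, 0, 0)) as D11.
  pose proof (isom_dot HLi (1, 0, 0) (0, 1, 0)) as D12.
  pose proof (isom_dot HLi (1, 0, 0) (0, 0, 1)) as D13.
  pose proof (isom_dot HLi (0, 1, 0) (0, 0, 1)) as D23.
  pose proof (isom_dot HLi (0, 0, 1) (0, 0, 1)) as D33.
  pose proof (fun p => isom_matrix J2 L p HLi) as HM.
  rewrite H2 in D12, D23. rewrite H2 in HM.
  destruct (L (1, 0, 0)) as [[p m] q]. destruct (L (0, 0, 1)) as [[p' m'] q'].
  unfold J2, dot, co1, co2, co3 in D11, D12, D13, D23, D33; simpl in D11, D12, D13, D23, D33.
  assert (Hm : m = 0) by lra. assert (Hm' : m' = 0) by lra. subst m m'.
  assert (Hpq : p * p = 1 + q * q) by lra. assert (Hpq' : q' * q' = 1 + p' * p') by lra.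
  assert (Hx : p * p' = q * q') by lra.
  assert (Hp0 : p <> 0) by (intros ->; nra). assert (Hq0 : q' <> 0) by (intros ->; nra).
  assert (Hsg : forall x : R, x <> 0 -> exists d, d * d = 1 /\ 0 < d * x).
  { intros x Hx0. destruct (Rlt_dec 0 x); [exists 1|exists (-1)]; lra. }
  (* [d] and [e] are the signs of the diagonal entries; once they are removed, d p is cosh a and - d
     q is sinh a for a rapidity a. *)
  destruct (Hsg p Hp0) as (d & Hd & Hdp). destruct (Hsg q' Hq0) as (e & He & Heq).
  set (a := arcsinh (- d * q)).
  assert (Sa : sinh a = - d * q) by apply sinh_arcsinh.
  assert (Ca : cosh a = d * p).
  { unfold a. rewrite cosh_arcsinh. apply sqrt_lem_1; [nra|lra|].
    transitivity (d * d * (p * p)); [ring|]. rewrite Hpq, Hd.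
    transitivity (1 + (d * d) * (q * q)); [rewrite Hd; ring|ring]. }
  assert (Eq : e * q' = d * p).
  { assert (E : (e * q' - d * p) * (e * q' + d * p) = 0).
    { transitivity (e * e * (q' * q') - d * d * (p * p)); [ring|]. rewrite He, Hd.
      assert (E2 : p * p * (q' * q') = p * p + (q * q) * (q' * q')).
      { rewrite Hpq' at 1. transitivity (p * p + (p * p') * (p * p')); [ring|]. rewrite Hx; ring. }
      assert (E3 : q' * q' = p * p); [|lra].
      transitivity ((p * p) * (q' * q') - (q * q) * (q' * q')); [rewrite Hpq; ring|]. rewrite E2; ring. }
    apply Rmult_integral in E as [E|E]; lra. }
  assert (Ep : p' = - e * (- d * q)).
  { apply (Rmult_eq_reg_l p); trivial. rewrite Hx.
    transitivity (q * e * (e * q')).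
    - transitivity (q * (e * e) * q'); [rewrite He; ring|ring].
    - rewrite Eq. ring. }
  assert (Ep1 : p = d * (d * p)) by (transitivity (d * d * p); [rewrite Hd; ring|ring]).
  assert (Eq1 : q' = e * (d * p)) by (rewrite <- Eq; transitivity (e * e * q'); [rewrite He; ring|ring]).
  assert (Eqq : q = - d * (- d * q)) by (transitivity (d * d * q); [rewrite Hd; ring|ring]).
  (* The shift by [h] covers a quarter turn. *)
  set (h := PI / 2 / k). assert (Hh : k * h = PI / 2) by (unfold h; field; lra).
  pose proof (lift_pair_comp (cover_shift_lift_pair k Hk (- h))
    (lift_pair_comp (boost_lift_pair a)
      (lift_pair_comp (cover_shift_lift_pair k Hk h) (refl_lift_pair k Hk d e Hd He)))) as HP.
  eexists; eexists. split; [|split].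
  - refine (lift_pair_ext _ _ _ _ L L' _ HL HP).
    intros [[v1 v2] v3]. rewrite HM. cbn beta.
    unfold rot, boost, refl. replace (k * - h) with (- (PI / 2)) by lra. rewrite Hh.
    rewrite cos_neg, sin_neg, cos_PI2, sin_PI2, Ca, Sa.
    rewrite Ep1 at 1. rewrite Eqq at 1. rewrite Ep, Eq1.
    coordwise; ring.
  - cbn beta.
    assert (E : cover_shift h (refl_cover d e (0, 0, 0)) = (0, h, 0)).
    { unfold cover_shift, refl_cover; coordwise; ring. }
    rewrite E.
    (* This point lies over the z-axis, which boosts of the (x, y)-plane fix; its turn is 0. *)
    assert (B : boost_cover a (0, h, 0) = (0, h, 0)).
    { unfold boost_cover.
      assert (X0 : boost_x a (0, h, 0) = 0).
      { unfold boost_x, co1, co2; simpl. rewrite Hh, cos_PI2, (Rmult_0_r k), sinh_0. ring. }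
      assert (N0 : boost_cross a (0, h, 0) = 0).
      { unfold boost_cross, boost_y, boost_z, co1, co2; simpl. rewrite Hh, cos_PI2, (Rmult_0_r k), sinh_0. ring. }
      rewrite X0, N0, arcsinh_0, !Rdiv_0_l, atan_0.
      coordwise; field; lra. }
    rewrite B. unfold cover_shift; coordwise; ring.
  (* The shifts by h and - h cancel, so the displacement from the reflected angle is that of the
     boost alone. *)
  - exists e. split; trivial. intros x. cbn beta.
    pose proof (boost_displacement a (cover_shift h (refl_cover d e x))) as HB.
    assert (E1 : forall b v, co2 (cover_shift b v) = co2 v + b) by reflexivity.
    assert (E2 : co2 (refl_cover d e x) = e * co2 x) by reflexivity.
    rewrite E1. rewrite (E1 h), E2 in HB.
    replace (k * (_ + - h) - e * (k * co2 x))
      with (k * co2 (boost_cover a (cover_shift h (refl_cover d e x))) - k * (e * co2 x + h)) by ring.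
    exact HB.
Qed.

Lemma move_to_origin (A : triple) : plane A ->
  exists f f' L L', lift_pair k f f' L L' /\ f A = (0, 0, 0).
Proof.
  (* After the shift to angle 0, the boost of rapidity - k t brings the height t to 0. *)
  intros HA. destruct A as [[t s] w]. unfold plane, co3 in HA; simpl in HA. subst w.
  pose proof (lift_pair_comp (boost_lift_pair (- (k * t))) (cover_shift_lift_pair k Hk (- s))) as HP.
  do 4 eexists. split; [exact HP|]. cbn beta.
  assert (E : cover_shift (- s) (t, s, 0) = (t, 0, 0)).
  { unfold cover_shift; coordwise; ring. }
  rewrite E. unfold boost_cover.
  assert (X0 : boost_x (- (k * t)) (t, 0, 0) = 0).
  { unfold boost_x, co1, co2; simpl. destruct (cosh_sinh_opp (k * t)) as (-> & ->).
    rewrite (Rmult_0_r k), cos_0. ring. }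
  assert (N0 : boost_cross (- (k * t)) (t, 0, 0) = 0).
  { unfold boost_cross, boost_y, boost_z, co1, co2; simpl. rewrite (Rmult_0_r k), sin_0. ring. }
  rewrite X0, N0, arcsinh_0, !Rdiv_0_l, atan_0.
  coordwise; field; lra.
Qed.

(** Moving A and A' to the origin conjugates the problem to the stabilizer of the origin, which
    [origin_lift] settles. *)
Lemma cover_lift (L L' : triple -> triple) (A A' : triple) :
  isom_pair J2 L L' -> plane A -> plane A' ->
  L (quadric_cover k A) = quadric_cover k A' ->
  exists f f', lift_pair k f f' L L' /\ f A = A'.
Proof.
  intros HL HA HA' HLA.
  destruct (move_to_origin A HA) as (g & g' & N & N' & HN & gA).
  destruct (move_to_origin A' HA') as (h & h' & P & P' & HP & hA').
  pose proof (isom_pair_comp _ _ _ _ _ (lp_isom HP)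
    (isom_pair_comp _ _ _ _ _ HL (isom_pair_sym _ _ _ (lp_isom HN)))) as H0.
  destruct (origin_lift _ _ H0) as (f0 & f0' & HF & F0 & _).
  - rewrite <- dev_origin at 1. rewrite <- gA, <- (lp_dev' HN), (lp_l HN), HLA.
    rewrite <- (lp_dev HP), hA'. apply dev_origin.
  - pose proof (lift_pair_comp (lift_pair_sym HP)
      (lift_pair_comp HF HN)) as HC.
    eexists; eexists. split; [refine (lift_pair_ext _ _ _ _ L L' _ HL HC)|].
    + intros v. cbn beta. rewrite (pair_l (lp_isom HN)), (pair_l (lp_isom HP)).
      reflexivity.
    + cbn beta. rewrite gA, F0, <- hA'. apply (lp_l HP).
Qed.

Lemma cover_quadric_surface : quadric_surface (Surface plane (quadric_cover k) (-1) 1 1) (k * k).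
Proof.
  split.
  - nra.
  - repeat split; unfold co1, co2, co3; simpl; lra.
  - intros p _. apply (cover_quadric k Hk).
  - intros c s Hc. apply C1_coord_chain; trivial. apply cover_C1.
  - apply (cover_geodesic k Hk).
  - intros L L' A A' HL HA HA' HLA.
    destruct (cover_lift L L' A A' HL HA HA' HLA) as (f & f' & Hf & fA).
    exists f. split; trivial. apply (lift_pair_isometry k f f' L L' Hf).
  - apply (cover_path k Hk).
Qed.

End Boost.

Lemma lorentz_model_pos (K : R) : 0 < K ->
  lorentz_model K = Surface plane (quadric_cover (sqrt K)) (-1) 1 1.
Proof.
  intros HK. unfold lorentz_model. destruct (Req_EM_T K 0); [lra|]. destruct (Rlt_dec 0 K); [reflexivity|lra].
Qed.

Lemma lorentz_model_quadric (K : R) : 0 < K -> quadric_surface (lorentz_model K) K.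
Proof.
  intros HK. rewrite lorentz_model_pos by trivial.
  rewrite <- (sqrt_sqrt K) at 2 by lra. apply cover_quadric_surface, sqrt_lt_R0, HK.
Qed.

(** * Uniqueness of triangles in flat planes *)

Definition affine_point (A B : triple) (s : R) : triple := lin3 (1 - s) A s B 0 A.

Definition vsub (p q : triple) : triple := lin3 1 p (-1) q 0 p.

Lemma vsub_vsub (a b c : triple) : vsub (vsub c a) (vsub b a) = vsub c b.
Proof. unfold vsub. triple_ring. Qed.

Lemma lin3_cancel (a b : triple) : lin3 1 a (-1) a 0 a = lin3 1 b (-1) b 0 b.
Proof. triple_ring. Qed.

Lemma vsub_plane (p q : triple) : plane p -> plane q -> plane (vsub p q).
Proof.
  destruct p as [[p1 p2] p3], q as [[q1 q2] q3].
  unfold plane, vsub, lin3, co1, co2, co3; simpl. intros -> ->; ring.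
Qed.

Lemma vsub_add (a b : triple) : lin3 1 (vsub a b) 1 b 0 b = a.
Proof. unfold vsub. triple_ring. Qed.

Lemma gcos_gsin_zero (s : R) : gcos 0 s = 1 /\ gsin 0 s = s.
Proof.
  unfold gcos, gsin. destruct (Rlt_dec 0 0); [lra|]. destruct (Req_EM_T 0 0); [auto|lra].
Qed.

Lemma affine_unique (a b : R) (u v : R -> R) : a < 0 < b ->
  (forall s, a < s < b -> is_derive u s (v s)) ->
  (forall s, a < s < b -> is_derive v s 0) ->
  forall s, a < s < b -> u s = u 0 + s * v 0.
Proof.
  intros H0 Hu Hv s Hs.
  rewrite (oscillator_unique 0 a b u v); trivial.
  - destruct (gcos_gsin_zero s) as (-> & ->). ring.
  - intros t Ht. eapply is_derive_eq; [apply Hv, Ht|ring].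
Qed.

Lemma C1_coord_translate (f : triple -> triple) (D : triple) :
  C1_coord f -> C1_coord (fun p => lin3 1 (f p) 1 D 0 D).
Proof.
  intros (H1 & H2 & H3). split; [|split].
  - apply (C1_real_ext (fun p => co1 (f p) + co1 D)).
    + intros p. unfold lin3; unfold co1 at 3; simpl. ring.
    + apply C1_real_plus; trivial; apply C1_real_const.
  - apply (C1_real_ext (fun p => co2 (f p) + co2 D)).
    + intros p. unfold lin3; unfold co2 at 3; simpl. ring.
    + apply C1_real_plus; trivial; apply C1_real_const.
  - apply (C1_real_ext (fun p => co3 (f p) + co3 D)).
    + intros p. unfold lin3; unfold co3 at 3; simpl. ring.
    + apply C1_real_plus; trivial; apply C1_real_const.
Qed.

Lemma planar_gram_isom (s : R) (u v u' v' : triple) :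
  s * s = 1 -> let J := (s, 1, 1) in
  plane u -> plane v -> plane u' -> plane v' ->
  dot J u u = dot J u' u' -> dot J v v = dot J v' v' ->
  dot J (vsub v u) (vsub v u) = dot J (vsub v' u') (vsub v' u') ->
  (dot J u u <> 0 \/ dot J v v <> 0 \/ dot J (vsub v u) (vsub v u) <> 0) ->
  exists L L', isom_pair J L L' /\ L u = u' /\ L v = v' /\ L (0, 0, 1) = (0, 0, 1).
Proof.
  intros Hs J Pu Pv Pu' Pv' Huu Hvv Hww Hnd.
  assert (HJ : unit_signs J) by (repeat split; unfold J, co1, co2, co3; simpl; lra).
  assert (Huv : dot J u v = dot J u' v').
  { unfold vsub in Hww. rewrite !dot_lin3_l, !dot_lin3_r in Hww.
    rewrite (dot_comm J v u), (dot_comm J v' u') in Hww. lra. }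
  set (n := (0, 0, 1) : triple).
  assert (Hn : forall w, plane w -> dot J w n = 0).
  { intros [[w1 w2] w3]. unfold plane, J, n, dot, co1, co2, co3; simpl. intros ->; ring. }
  assert (Hnn : dot J n n = 1) by (unfold J, n, dot, co1, co2, co3; simpl; ring).
  pose proof vsub_plane as Pw.
  assert (Hvs : forall a b c, dot J (vsub a b) c = dot J a c - dot J b c).
  { intros a b c. unfold vsub. rewrite dot_lin3_l. ring. }
  destruct Hnd as [H|[H|H]].
  - destruct (gram_isom_first J u n v u' n v') as (L & L' & HL & ? & ? & ?); trivial.
    + rewrite Hnn, Hn by trivial. lra.
    + rewrite !Hn by trivial. reflexivity.
    + rewrite (dot_comm J n v), (dot_comm J n v'), !Hn by trivial. reflexivity.
    + exists L, L'; auto.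
  - destruct (gram_isom_first J v n u v' n u') as (L & L' & HL & ? & ? & ?); trivial.
    + rewrite Hnn, Hn by trivial. lra.
    + rewrite !Hn by trivial. reflexivity.
    + rewrite (dot_comm J n u), (dot_comm J n u'), !Hn by trivial. reflexivity.
    + rewrite (dot_comm J v u), (dot_comm J v' u'). trivial.
    + exists L, L'; auto.
  - destruct (gram_isom_first J (vsub v u) n u (vsub v' u') n u') as (L & L' & HL & Hw & HLn & Hu); trivial.
    + rewrite Hnn, Hn by auto. lra.
    + rewrite !Hn by auto. reflexivity.
    + rewrite (dot_comm J n u), (dot_comm J n u'), !Hn by trivial. reflexivity.
    + rewrite !Hvs, (dot_comm J v u), (dot_comm J v' u'). lra.
    + exists L, L'. split; [exact HL|]. split; [exact Hu|]. split; [|exact HLn].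
      rewrite <- (vsub_add v u), (isom_lin (pair_isom HL)), Hw, Hu. apply vsub_add.
Qed.

Section Plane.

Variable s : R.
Hypothesis Hs : s * s = 1.

Let J : triple := (s, 1, 1).
Let M := Surface plane (fun p => p) s 1 1.

Lemma plane_geodesic (g : R -> triple) (l : R) : geodesic M g -> signed_length M g = l ->
  plane (g 0) /\ plane (g 1) /\ dot J (vsub (g 1) (g 0)) (vsub (g 1) (g 0)) = ssq l /\
  forall t, 0 <= t <= 1 -> g t = affine_point (g 0) (g 1) t.
Proof.
  intros (e & He & H) Hl. apply signed_sqrt_ssq in Hl. rewrite form_dot in Hl.
  change (dvel M g 0) with (vel g 0) in Hl. change (sig M) with J in Hl.
  assert (Hv : forall t, - e < t < 1 + e -> has_vel g t (vel g t)).
  { intros t Ht. apply derivable_has_vel, H, Ht. }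
  assert (Hp : forall t, - e < t < 1 + e -> co3 (g t) = 0) by (intros t Ht; apply H, Ht).
  assert (Ha : forall t, - e < t < 1 + e ->
    is_derive (fun t => co1 (vel g t)) t 0 /\ is_derive (fun t => co2 (vel g t)) t 0).
  { intros t Ht. destruct (H t Ht) as (C & D1 & D2 & HT).
    apply derivable_has_vel in D2. destruct D2 as (A1 & A2 & _).
    assert (HV : forall a b : R, dot J (vel (vel g) t) (a, b, 0) = 0).
    { intros a b. set (c := fun u => (co1 (g t) + u * a, co2 (g t) + u * b, 0) : triple).
      assert (Hc : has_vel c 0 (a, b, 0)).
      { split; [|split]; unfold c; unfold co1, co2, co3; simpl; auto_derive; trivial; ring. }
      rewrite <- (has_vel_vel _ _ _ Hc). apply HT.
      - intros u; reflexivity.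
      - apply triple_eq;
          [change (co1 (g t) + 0 * a = co1 (g t)); ring
          |change (co2 (g t) + 0 * b = co2 (g t)); ring
          |symmetry; exact C].
      - apply (has_vel_derivable _ _ _ Hc). }
    pose proof (HV 1 0) as V1. pose proof (HV 0 1) as V2.
    unfold dot, J in V1, V2. unfold co1 at 1 3, co2 at 1 3, co3 at 1 3 in V1.
    unfold co1 at 1 3, co2 at 1 3, co3 at 1 3 in V2. simpl in V1, V2.
    assert (Hs0 : s <> 0) by (intros ->; lra).
    split; [eapply is_derive_eq; [exact A1|] | eapply is_derive_eq; [exact A2|]].
    - apply (Rmult_eq_reg_l s); trivial. lra.
    - lra. }
  assert (HF : forall t, - e < t < 1 + e -> g t = lin3 1 (g 0) t (vel g 0) 0 (g 0)).
  { intros t Ht.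
    assert (E1 : co1 (g t) = co1 (g 0) + t * co1 (vel g 0)).
    { apply (affine_unique (- e) (1 + e) (fun t => co1 (g t)) (fun t => co1 (vel g t))); trivial; try lra.
      - intros r Hr. exact (proj1 (Hv r Hr)).
      - intros r Hr. exact (proj1 (Ha r Hr)). }
    assert (E2 : co2 (g t) = co2 (g 0) + t * co2 (vel g 0)).
    { apply (affine_unique (- e) (1 + e) (fun t => co2 (g t)) (fun t => co2 (vel g t))); trivial; try lra.
      - intros r Hr. exact (proj1 (proj2 (Hv r Hr))).
      - intros r Hr. exact (proj2 (Ha r Hr)). }
    assert (E3 : co3 (vel g 0) = 0).
    { apply (derive_locally_const (fun t => co3 (g t)) (- e) (1 + e) 0 0); try lra; trivial.
      apply (Hv 0). lra. }
    apply triple_eq.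
    - change (co1 (g t) = 1 * co1 (g 0) + t * co1 (vel g 0) + 0 * co1 (g 0)). rewrite E1. ring.
    - change (co2 (g t) = 1 * co2 (g 0) + t * co2 (vel g 0) + 0 * co2 (g 0)). rewrite E2. ring.
    - change (co3 (g t) = 1 * co3 (g 0) + t * co3 (vel g 0) + 0 * co3 (g 0)).
      rewrite E3, !Hp by lra. ring. }
  assert (HV : vsub (g 1) (g 0) = vel g 0).
  { rewrite (HF 1) by lra. unfold vsub. coordwise; ring. }
  split; [apply Hp; lra|]. split; [apply Hp; lra|]. split; [rewrite HV; exact Hl|].
  intros t Ht. rewrite (HF 1), (HF t) by lra. unfold affine_point.
  coordwise; ring.
Qed.

(** [L] keeps third coordinates because these are the products with the fixed vector (0, 0, 1). *)
Lemma planar_isometry (L L' : triple -> triple) (A A' : triple) :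
  isom_pair J L L' -> L (0, 0, 1) = (0, 0, 1) -> plane A -> plane A' ->
  exists f, isometry M f /\ (forall p, f p = lin3 1 (L (vsub p A)) 1 A' 0 A') /\
    forall P Q t, f (affine_point P Q t) = affine_point (f P) (f Q) t.
Proof.
  intros HL LN PA PA'.
  pose proof (pair_isom HL) as HLi. pose proof (pair_isom' HL) as HLi'.
  assert (Hd3 : forall w, dot J w (0, 0, 1) = co3 w).
  { intros [[w1 w2] w3]. unfold dot, J, co1, co2, co3; simpl. ring. }
  assert (LP : forall w, co3 (L w) = co3 w).
  { intros w. rewrite <- !Hd3. rewrite <- LN at 1. apply (isom_dot HLi). }
  assert (LP' : forall w, co3 (L' w) = co3 w).
  { intros w. rewrite <- (LP (L' w)), (pair_r HL). reflexivity. }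
  set (f := fun p => lin3 1 (L p) 1 (vsub A' (L A)) 0 (vsub A' (L A))).
  set (f' := fun p => lin3 1 (L' p) 1 (vsub A (L' A')) 0 (vsub A (L' A'))).
  assert (f'f : forall p, f' (f p) = p).
  { intros p. unfold f', f. unfold vsub. rewrite !(isom_lin HLi'), !(pair_l HL).
    generalize (L' A'). clear. intros q. triple_ring. }
  assert (ff' : forall p, f (f' p) = p).
  { intros p. unfold f', f. unfold vsub. rewrite !(isom_lin HLi), !(pair_r HL).
    generalize (L A). clear. intros q. triple_ring. }
  assert (Pt : forall p a b, plane p -> plane a -> plane b -> plane (lin3 1 p 1 (vsub a b) 0 (vsub a b))).
  { clear. intros p a b Pp Pa Pb. pose proof (vsub_plane a b Pa Pb) as Pv.
    unfold plane in *.
    change (1 * co3 p + 1 * co3 (vsub a b) + 0 * co3 (vsub a b) = 0). rewrite Pp, Pv. ring. }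
  exists f. split; [split; [|split]|split].
  - apply C1_coord_C1_map, C1_coord_translate, (C1_coord_isom J); trivial.
  - exists f'. split; [apply C1_coord_C1_map, C1_coord_translate, (C1_coord_isom J); trivial|].
    intros p Hp. unfold plane in *. repeat split; simpl; auto; apply Pt; unfold plane;
      rewrite ?LP, ?LP'; trivial.
  - intros c t _ Hc. rewrite !form_dot.
    change (dot J (vel (fun u => f (c u)) t) (vel (fun u => f (c u)) t) = dot J (vel c t) (vel c t)).
    pose proof (has_vel_isom _ _ _ _ _ HLi (derivable_has_vel c t Hc)) as (V1 & V2 & V3).
    rewrite (has_vel_vel _ _ (L (vel c t))); [apply (isom_dot HLi)|].
    assert (E : forall (h : R -> R) a d, is_derive h t a -> is_derive (fun u => 1 * h u + 1 * d + 0 * d) t a).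
    { intros h a d Hh. eapply is_derive_eq.
      - apply is_derive_plus_R; [apply is_derive_plus_R|].
        + apply is_derive_scal_R, Hh.
        + apply (is_derive_const_R (1 * d)).
        + apply (is_derive_const_R (0 * d)).
      - ring. }
    split; [exact (E _ _ _ V1)|split; [exact (E _ _ _ V2)|exact (E _ _ _ V3)]].
  - intros p. unfold f, vsub. rewrite (isom_lin HLi).
    generalize (L A) (L p). clear. intros q r. triple_ring.
  - intros P Q t. unfold f, affine_point. rewrite (isom_lin HLi).
    generalize (L P) (L Q) (vsub A' (L A)). clear. intros P' Q' D. triple_ring.
Qed.

Lemma plane_unique (x : triple) (T T' : geodesic_triangle) : x <> tzero ->
  realizes M T x -> realizes M T' x ->
  exists f, isometry M f /\ maps_vertices f T T' /\ maps_sides f T T'.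
Proof.
  intros Hx (((GAB & A1 & A2) & (GBC & B1 & B2) & (GAC & C1 & C2)) & L1 & L2 & L3)
    (((GAB' & A1' & A2') & (GBC' & B1' & B2') & (GAC' & C1' & C2')) & L1' & L2' & L3').
  destruct (plane_geodesic _ _ GAB L1) as (PA & PB & DAB & FAB).
  destruct (plane_geodesic _ _ GBC L2) as (_ & PC & DBC & FBC).
  destruct (plane_geodesic _ _ GAC L3) as (_ & _ & DAC & FAC).
  destruct (plane_geodesic _ _ GAB' L1') as (PA' & PB' & DAB' & FAB').
  destruct (plane_geodesic _ _ GBC' L2') as (_ & PC' & DBC' & FBC').
  destruct (plane_geodesic _ _ GAC' L3') as (_ & _ & DAC' & FAC').
  rewrite ?A1, ?A2, ?B1, ?B2, ?C1, ?C2, ?A1', ?A2', ?B1', ?B2', ?C1', ?C2' in *.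
  set (A := vA T) in *. set (B := vB T) in *. set (C := vC T) in *.
  set (A' := vA T') in *. set (B' := vB T') in *. set (C' := vC T') in *.
  pose proof vsub_plane as Pw.
  destruct (planar_gram_isom s (vsub B A) (vsub C A) (vsub B' A') (vsub C' A')) as (L & L' & HL & LB & LC & LN);
    auto; fold J; rewrite ?vsub_vsub; try congruence.
  { rewrite DAB, DAC, DBC. destruct (Req_dec (ssq (co1 x)) 0) as [Z1|Z1]; [|tauto].
    destruct (Req_dec (ssq (co2 x)) 0) as [Z2|Z2]; [|tauto].
    destruct (Req_dec (ssq (co3 x)) 0) as [Z3|Z3]; [|tauto].
    exfalso. apply Hx, triple_eq; apply ssq_0; trivial. }
  destruct (planar_isometry L L' A A' HL LN PA PA') as (f & Hf & Ef & fa).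
  assert (fA : f A = A').
  { rewrite Ef. unfold vsub. rewrite (isom_lin (pair_isom HL)), (lin3_cancel (L A) A').
    apply vsub_add. }
  assert (fB : f B = B') by (rewrite Ef, LB; apply vsub_add).
  assert (fC : f C = C') by (rewrite Ef, LC; apply vsub_add).
  exists f. split; [exact Hf|split].
  - repeat split; trivial.
  - intros t Ht. rewrite FAB, FBC, FAC, FAB', FBC', FAC' by trivial. rewrite !fa, fA, fB, fC. auto.
Qed.

End Plane.

(** * Existence of sides *)

Definition side (M : surface) (A B : triple) (l : R) : Prop :=
  exists g, joins M g A B /\ signed_length M g = l.

Lemma triangle_of_sides (M : surface) (A B C x : triple) :
  side M A B (co1 x) -> side M B C (co2 x) -> side M A C (co3 x) -> exists T, realizes M T x.
Proof.
  intros (g & Hg & Lg) (h & Hh & Lh) (i & Hi & Li).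
  exists (Triangle A B C g h i). repeat (split; trivial).
Qed.

(** [b] and [c] are the positions of B and C on a line with A at 0. When [co2 x] is the sum, A lies
    between the others, hence the negative [b]. *)
Lemma degenerate_positions (x : triple) : D_pos x ->
  exists b c, co1 x = Rabs b /\ co2 x = Rabs (c - b) /\ co3 x = Rabs c.
Proof.
  intros (_ & H1 & H2 & H3 & [H|[H|H]]).
  - exists (co1 x), (co3 x). rewrite (Rabs_pos_eq (co1 x)), (Rabs_pos_eq (co3 x)) by trivial.
    rewrite Rabs_left1 by lra. repeat split; lra.
  - exists (- co1 x), (co3 x). rewrite Rabs_left1, (Rabs_pos_eq (co3 x)) by lra.
    rewrite Rabs_pos_eq by lra. repeat split; lra.
  - exists (co1 x), (co3 x). rewrite (Rabs_pos_eq (co1 x)), (Rabs_pos_eq (co3 x)) by trivial.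
    rewrite Rabs_pos_eq by lra. repeat split; lra.
Qed.

Lemma line_triangle (M : surface) (eta : R -> triple) (x : triple) :
  (forall p q, side M (eta p) (eta q) (Rabs (q - p))) -> D_pos x -> exists T, realizes M T x.
Proof.
  intros H Hx. destruct (degenerate_positions x Hx) as (b & c & E1 & E2 & E3).
  apply (triangle_of_sides M (eta 0) (eta b) (eta c)).
  - rewrite E1. replace b with (b - 0) at 2 by ring. apply H.
  - rewrite E2. apply H.
  - rewrite E3. replace c with (c - 0) at 2 by ring. apply H.
Qed.

Lemma line_triangle_neg (M : surface) (eta : R -> triple) (x : triple) :
  (forall p q, side M (eta p) (eta q) (- Rabs (q - p))) -> D_neg x -> exists T, realizes M T x.
Proof.
  intros H Hx. destruct (degenerate_positions _ Hx) as (b & c & E1 & E2 & E3).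
  change (co1 (topp x)) with (- co1 x) in E1. change (co2 (topp x)) with (- co2 x) in E2.
  change (co3 (topp x)) with (- co3 x) in E3.
  apply (triangle_of_sides M (eta 0) (eta b) (eta c)).
  - replace (co1 x) with (- Rabs (b - 0)) by (rewrite Rminus_0_r; lra). apply H.
  - replace (co2 x) with (- Rabs (c - b)) by lra. apply H.
  - replace (co3 x) with (- Rabs (c - 0)) by (rewrite Rminus_0_r; lra). apply H.
Qed.

Lemma ssq_Rabs (d : R) : ssq (Rabs d) = d * d.
Proof. unfold ssq. rewrite Rabs_Rabsolu, <- Rabs_mult. apply Rabs_pos_eq. nra. Qed.

Lemma ssq_opp (l : R) : ssq (- l) = - ssq l.
Proof. unfold ssq. rewrite Rabs_Ropp. ring. Qed.

Lemma has_vel_affine (A V : triple) (p d t : R) :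
  has_vel (fun u => lin3 1 A (p + u * d) V 0 A) t (lin3 0 A d V 0 A).
Proof.
  apply has_vel_lin3; [apply is_derive_const_R| |apply is_derive_const_R].
  auto_derive; trivial; ring.
Qed.

Lemma curve_derivable_vel (g w : R -> triple) (a b t : R) :
  a < t < b -> (forall u, a < u < b -> has_vel g u (w u)) -> curve_derivable w t ->
  curve_derivable (vel g) t.
Proof.
  intros Ht H Hw. apply (curve_derivable_ext_loc w); trivial.
  apply (interval_locally a b); trivial. intros u Hu. symmetry. apply has_vel_vel, H, Hu.
Qed.

Lemma has_vel_const (A : triple) (t : R) : has_vel (fun _ => A) t (0, 0, 0).
Proof.
  split; [|split]; [exact (is_derive_const_R (co1 A) t)|exact (is_derive_const_R (co2 A) t)
    |exact (is_derive_const_R (co3 A) t)].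
Qed.

Lemma plane_side (s : R) (A B : triple) (l : R) :
  plane A -> plane B -> dot (s, 1, 1) (vsub B A) (vsub B A) = ssq l ->
  side (Surface plane (fun p => p) s 1 1) A B l.
Proof.
  intros HA HB Hl.
  set (V := vsub B A) in *. set (g := fun u => lin3 1 A (0 + u * 1) V 0 A).
  assert (PV : plane V) by (apply vsub_plane; trivial).
  assert (Hg : forall t, has_vel g t (lin3 0 A 1 V 0 A)) by (intros t; apply has_vel_affine).
  assert (EV : lin3 0 A 1 V 0 A = V) by (clearbody V; clear; triple_ring).
  rewrite EV in Hg.
  assert (Ev : forall t, vel g t = V) by (intros t; apply has_vel_vel, Hg).
  assert (Ha : forall t, has_vel (vel g) t (0, 0, 0)).
  { intros t. apply (has_vel_ext_loc (fun _ => V)).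
    - apply filter_forall. intros u. symmetry; apply Ev.
    - apply has_vel_const. }
  exists g. split; [split; [|split]|].
  - exists 1. split; [lra|]. intros t _. repeat split; try apply (has_vel_derivable _ _ _ (Hg t));
      try apply (has_vel_derivable _ _ _ (Ha t)).
    + unfold plane in *. simpl. unfold plane. unfold g.
      change (1 * co3 A + (0 + t * 1) * co3 V + 0 * co3 A = 0). rewrite HA, PV. ring.
    + intros c _ _ _. change (dvel _ g) with (vel g). rewrite (has_vel_vel _ _ _ (Ha t)).
      unfold form, co1, co2, co3; simpl. ring.
  - unfold g. clear - A. triple_ring.
  - unfold g, V. clear. unfold vsub. triple_ring.
  - apply signed_sqrt_ssq. rewrite form_dot. change (dvel _ g) with (vel g). rewrite Ev. exact Hl.
Qed.

(** An acceleration along the position is normal, since by <p, p> = 1/K every test curve has a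
    velocity orthogonal to its developed position. *)
Lemma quadric_geodesic_intro (M : surface) (K : R) (g w : R -> triple) (e l : R) :
  quadric_surface M K -> 0 < e ->
  (forall t, - e < t < 1 + e -> carrier M (g t) /\ curve_derivable g t /\ curve_derivable (vel g) t /\
    has_vel (fun u => dev M (g u)) t (w t) /\
    exists m, has_vel w t (lin3 m (dev M (g t)) 0 (dev M (g t)) 0 (dev M (g t)))) ->
  dot (sig M) (w 0) (w 0) = ssq l ->
  geodesic M g /\ signed_length M g = l.
Proof.
  intros HM He H Hl.
  assert (Ew : forall t, - e < t < 1 + e -> dvel M g t = w t).
  { intros t Ht. apply has_vel_vel, H, Ht. }
  split.
  - exists e. split; trivial. intros t Ht. destruct (H t Ht) as (C & D1 & D2 & _ & m & Hm).
    repeat (split; [assumption|]). intros c Hc Hc0 Hcd.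
    rewrite (has_vel_vel (dvel M g) t (lin3 m (dev M (g t)) 0 (dev M (g t)) 0 (dev M (g t)))).
    + rewrite form_dot, dot_lin3_l.
      pose proof (derivable_has_vel _ _ (qs_curve HM c 0 Hcd)) as HV.
      pose proof (is_derive_dot (sig M) _ _ _ _ _ HV HV) as HD.
      apply (derive_locally_const _ (-1) 1 (/ K)) in HD; [|lra|].
      * rewrite Hc0 in HD. rewrite (dot_comm _ (vel _ 0)) in HD.
        change (dvel M c 0) with (vel (fun u => dev M (c u)) 0).
        replace (dot _ _ _) with 0 by lra. ring.
      * intros u _. apply (qs_carrier HM), Hc.
    + apply (has_vel_ext_loc w); trivial. apply (interval_locally (- e) (1 + e)); trivial.
      intros u Hu. symmetry. apply Ew, Hu.
  - apply signed_sqrt_ssq. rewrite form_dot, Ew by lra. exact Hl.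
Qed.

(** The time change p + u d covers both uses: arcs with given ends (p = 0, d = 1) and pieces of a
    complete geodesic. *)
Lemma has_vel_gcos_gsin (k p d t : R) (A V : triple) :
  has_vel (fun u => lin3 (gcos k (p + u * d)) A (gsin k (p + u * d)) V 0 A) t
    (lin3 (- k * d * gsin k (p + t * d)) A (d * gcos k (p + t * d)) V 0 A) /\
  has_vel (fun u => lin3 (- k * d * gsin k (p + u * d)) A (d * gcos k (p + u * d)) V 0 A) t
    (let G := lin3 (gcos k (p + t * d)) A (gsin k (p + t * d)) V 0 A in
     lin3 (- k * d * d) G 0 G 0 G).
Proof.
  assert (D : is_derive (fun u => p + u * d) t d) by (auto_derive; trivial; ring).
  pose proof (is_derive_comp_R (gcos k) _ _ _ _ (is_derive_gcos k _) D) as Hc.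
  pose proof (is_derive_comp_R (gsin k) _ _ _ _ (is_derive_gsin k _) D) as Hs.
  cbn beta in Hc, Hs. split.
  - apply has_vel_lin3; [|eapply is_derive_eq; [exact Hs|ring]|apply is_derive_const_R].
    eapply is_derive_eq; [exact Hc|ring].
  - cbv zeta.
    assert (E : forall c s, lin3 (- k * d * d) (lin3 c A s V 0 A) 0 (lin3 c A s V 0 A) 0 (lin3 c A s V 0 A)
      = lin3 (- k * d * (c * d)) A (d * (- k * s * d)) V 0 A) by (clear; intros; triple_ring).
    rewrite E.
    apply has_vel_lin3; [|eapply is_derive_eq; [apply is_derive_scal_R, Hc|ring]|apply is_derive_const_R].
    eapply is_derive_eq; [apply is_derive_scal_R, Hs|ring].
Qed.

(** [V] is the initial velocity that makes the arc end at Q. *)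
Lemma arc_velocity (J P Q : triple) (K l : R) : K <> 0 ->
  let k := K * ssq l in
  dot J P P = / K -> dot J Q Q = / K -> dot J P Q = gcos k 1 / K -> gsin k 1 <> 0 ->
  let V := lin3 (/ gsin k 1) Q (- (gcos k 1 / gsin k 1)) P 0 P in
  dot J P V = 0 /\ dot J V V = ssq l /\
  forall t, arc k P Q t = lin3 (gcos k t) P (gsin k t) V 0 P.
Proof.
  intros HK k HP HQ HPQ Hk V.
  assert (E1 : dot J P V = 0) by (unfold V; rewrite dot_lin3_r, HP, HPQ; field; split; trivial).
  split; [exact E1|]. split.
  - unfold V at 1. rewrite dot_lin3_l, E1. unfold V. rewrite dot_lin3_r, (dot_comm J Q P), HQ, HPQ.
    pose proof (gcos2_gsin2 k 1) as HI.
    transitivity ((1 - gcos k 1 * gcos k 1) / (K * (gsin k 1 * gsin k 1))); [field; split; trivial|].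
    replace (1 - gcos k 1 * gcos k 1) with (k * (gsin k 1 * gsin k 1)) by lra.
    unfold k at 1. field. split; trivial.
  - intros t. unfold arc, V. clear - Hk. coordwise; field; trivial.
Qed.

Lemma arc_ends (k : R) (P Q : triple) : gsin k 1 <> 0 -> arc k P Q 0 = P /\ arc k P Q 1 = Q.
Proof.
  intros H. unfold arc. rewrite gcos_0, gsin_0.
  split; coordwise; field; trivial.
Qed.

Lemma circle_dot (J P V : triple) (K l t : R) : K <> 0 ->
  dot J P P = / K -> dot J P V = 0 -> dot J V V = ssq l ->
  let k := K * ssq l in
  let G := lin3 (gcos k t) P (gsin k t) V 0 P in
  dot J G G = / K /\ dot J G P = gcos k t / K.
Proof.
  intros HK HP HPV HV k G. unfold G. rewrite !dot_lin3_l, !dot_lin3_r, (dot_comm J V P), HP, HPV, HV.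
  pose proof (gcos2_gsin2 k t) as HI. split; [|field; trivial].
  transitivity ((gcos k t * gcos k t + k * (gsin k t * gsin k t)) / K); [unfold k; field; trivial|].
  rewrite HI. field; trivial.
Qed.

Section RiemannSides.

Variables (Q : triple -> Prop) (s K : R).
Hypothesis Hs : s * s = 1.
Hypothesis HsK : 0 < s * K.
Hypothesis HQ : forall p, Q p <-> dot (s, 1, 1) p p = / K /\ (s < 0 -> 0 < co1 p).

Let M := Surface Q (fun p => p) s 1 1.

Lemma riemann_arc_side (A B : triple) (l : R) : Q A -> Q B ->
  dot (s, 1, 1) A B = gcos (K * ssq l) 1 / K -> gsin (K * ssq l) 1 <> 0 -> (s < 0 -> 0 <= l) ->
  side M A B l.
Proof.
  intros HA HB HAB Hk Hl. pose proof (riemann_K s K HsK) as HK.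
  pose proof (proj1 (HQ A) HA) as (DA & PA). pose proof (proj1 (HQ B) HB) as (DB & PB).
  destruct (arc_velocity (s, 1, 1) A B K l HK DA DB HAB Hk) as (E1 & E2 & E3).
  set (V := lin3 _ B _ A 0 A) in *. set (k := K * ssq l) in *. clearbody V.
  set (g := fun u => lin3 (gcos k (0 + u * 1)) A (gsin k (0 + u * 1)) V 0 A).
  assert (Eg : forall t, g t = arc k A B t).
  { intros t. rewrite E3. unfold g. replace (0 + t * 1) with t by ring. reflexivity. }
  assert (Hg : geodesic M g /\ signed_length M g = l).
  { apply (quadric_geodesic_intro M K g
      (fun u => lin3 (- k * 1 * gsin k (0 + u * 1)) A (1 * gcos k (0 + u * 1)) V 0 A) 1).
    - apply riemann_quadric_surface; trivial.
    - lra.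
    - intros t _. destruct (has_vel_gcos_gsin k 0 1 t A V) as (V1 & V2).
      split; [|split; [|split; [|split]]].
      + apply HQ. destruct (circle_dot (s, 1, 1) A V K l (0 + t * 1) HK DA E1 E2) as (F1 & F2).
        split; [exact F1|]. intros Hs0.
        (* On the hyperboloid the product with A is gcos / K, where gcos is positive as K l^2 <= 0.
           It is therefore negative, and the arc stays in the cone of A. *)
        destruct (dot_sign s K _ Hs HsK F1 Hs0) as (_ & N1).
        destruct (dot_sign s K _ Hs HsK DA Hs0) as (Es & N2).
        apply (timelike_future _ A); auto.
        rewrite Es in F2. fold k in F2. unfold g. rewrite F2.
        assert (HK0 : K < 0) by nra.
        assert (Hc : 0 < gcos k (0 + t * 1)).
        { destruct (Req_dec k 0) as [Hk0|Hk0].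
          - rewrite Hk0. destruct (gcos_gsin_zero (0 + t * 1)) as (-> & _). lra.
          - apply gcos_neg_pos. assert (k <= 0); [|lra]. unfold k. rewrite ssq_pos by auto. nra. }
        apply Rmult_pos_neg; [exact Hc|]. apply Rinv_lt_0_compat, HK0.
      + apply (has_vel_derivable _ _ _ V1).
      + eapply (curve_derivable_vel g) with (a := t - 1) (b := t + 1);
          [lra| |apply (has_vel_derivable _ _ _ V2)].
        intros u _. apply has_vel_gcos_gsin.
      + exact V1.
      + exists (- k * 1 * 1). exact V2.
    - cbn beta. replace (0 + 0 * 1) with 0 by ring. rewrite gcos_0, gsin_0.
      change (sig M) with (s, 1, 1). rewrite dot_lin3_l, !dot_lin3_r, (dot_comm _ V A), E1, E2. ring. }
  destruct (arc_ends k A B Hk) as (A0 & A1).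
  exists g. split; [split; [|split]|]; try apply Hg; rewrite Eg; trivial.
Qed.

(** [eta] is a complete unit speed geodesic through (1/r, 0, 0); the side from [eta p] to [eta q]
    runs along it with speed |q - p|. *)
Lemma riemann_line_side : exists eta, forall p q, side M (eta p) (eta q) (Rabs (q - p)).
Proof.
  pose proof (riemann_K s K HsK) as HK.
  set (r := sqrt (s * K)). assert (Hr : 0 < r) by (apply sqrt_lt_R0, HsK).
  assert (Hrr : r * r = s * K) by (apply sqrt_sqrt; lra).
  set (A := (/ r, 0, 0) : triple). set (V := (0, 1, 0) : triple).
  assert (DA : dot (s, 1, 1) A A = / K).
  { unfold dot, A, co1, co2, co3; simpl. transitivity (s / (r * r)); [field; lra|].
    rewrite Hrr. field. split; trivial. intros E; rewrite E in Hs; lra. }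
  assert (DAV : dot (s, 1, 1) A V = 0) by (unfold dot, A, V, co1, co2, co3; simpl; ring).
  assert (DV : dot (s, 1, 1) V V = 1) by (unfold dot, A, V, co1, co2, co3; simpl; ring).
  set (eta := fun u => lin3 (gcos K u) A (gsin K u) V 0 A).
  exists eta. intros p q. set (d := q - p).
  set (g := fun u => lin3 (gcos K (p + u * d)) A (gsin K (p + u * d)) V 0 A).
  assert (Hg : geodesic M g /\ signed_length M g = Rabs d).
  { apply (quadric_geodesic_intro M K g
      (fun u => lin3 (- K * d * gsin K (p + u * d)) A (d * gcos K (p + u * d)) V 0 A) 1).
    - apply riemann_quadric_surface; trivial.
    - lra.
    - intros t _. destruct (has_vel_gcos_gsin K p d t A V) as (V1 & V2).
      split; [|split; [|split; [|split]]].
      + apply HQ. split.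
        * unfold g. rewrite dot_lin3_l, !dot_lin3_r, (dot_comm _ V A), DA, DAV, DV.
          pose proof (gcos2_gsin2 K (p + t * d)) as HI.
          transitivity ((gcos K (p + t * d) * gcos K (p + t * d) + K * (gsin K (p + t * d) * gsin K (p + t * d))) / K);
            [field; trivial|rewrite HI; field; trivial].
        * intros Hs0. unfold g, lin3, A, V, co1, co2, co3; simpl.
          assert (0 < gcos K (p + t * d)) by (apply gcos_neg_pos; nra).
          assert (0 < gcos K (p + t * d) * / r) by (apply Rmult_lt_0_compat; trivial; apply Rinv_0_lt_compat; trivial).
          lra.
      + apply (has_vel_derivable _ _ _ V1).
      + eapply (curve_derivable_vel g) with (a := t - 1) (b := t + 1);
          [lra| |apply (has_vel_derivable _ _ _ V2)].
        intros u _. apply has_vel_gcos_gsin.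
      + exact V1.
      + exists (- K * d * d). exact V2.
    - cbn beta. rewrite ssq_Rabs. replace (p + 0 * d) with p by ring.
      change (sig M) with (s, 1, 1). rewrite dot_lin3_l, !dot_lin3_r, (dot_comm _ V A), DA, DAV, DV.
      pose proof (gcos2_gsin2 K p) as HI.
      transitivity (d * d * (gcos K p * gcos K p + K * (gsin K p * gsin K p))); [field; trivial|].
      rewrite HI; ring. }
  exists g. split; [split; [|split]|]; try apply Hg.
  - unfold g, eta. replace (p + 0 * d) with p by ring. reflexivity.
  - unfold g, eta, d. replace (p + 1 * (q - p)) with q by ring. reflexivity.
Qed.

End RiemannSides.

(** * Sides in the Lorentz quadric *)

(** [geodesic] demands a differentiable velocity. For a lifted arc, composed of arcsinh, atan and a
    quotient, this follows from closure properties of this class. *)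
Definition twice_derivable (a b : R) (u : R -> R) : Prop :=
  exists u', forall s, a < s < b -> is_derive u s (u' s) /\ ex_derive u' s.

Lemma twice_derivable_comp (a b : R) (h h' u : R -> R) :
  twice_derivable a b u ->
  (forall s, a < s < b -> is_derive h (u s) (h' (u s)) /\ ex_derive h' (u s)) ->
  twice_derivable a b (fun s => h (u s)).
Proof.
  intros (u' & Hu) Hh. exists (fun s => h' (u s) * u' s). intros s Hs.
  destruct (Hu s Hs) as (U1 & U2). destruct (Hh s Hs) as (H1 & H2). split.
  - apply is_derive_comp_R; trivial.
  - apply (ex_derive_mult (fun s => h' (u s)) u'); trivial.
    apply (ex_derive_comp h' u); trivial. exists (u' s); exact U1.
Qed.

Lemma twice_derivable_mult (a b : R) (u v : R -> R) :
  twice_derivable a b u -> twice_derivable a b v -> twice_derivable a b (fun s => u s * v s).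
Proof.
  intros (u' & Hu) (v' & Hv). exists (fun s => u' s * v s + u s * v' s). intros s Hs.
  destruct (Hu s Hs) as (U1 & U2). destruct (Hv s Hs) as (V1 & V2). split.
  - apply is_derive_mult_R; trivial.
  - apply (ex_derive_plus (V := R_NormedModule) (fun s => u' s * v s) (fun s => u s * v' s));
    apply ex_derive_mult; trivial; eexists; eassumption.
Qed.

Lemma twice_derivable_const (a b c : R) : twice_derivable a b (fun _ => c).
Proof.
  exists (fun _ => 0). intros s _. split; [apply is_derive_const_R|].
  exists 0. apply is_derive_const_R.
Qed.

Lemma twice_derivable_curve (a b : R) (g : R -> triple) :
  twice_derivable a b (fun s => co1 (g s)) -> twice_derivable a b (fun s => co2 (g s)) ->
  twice_derivable a b (fun s => co3 (g s)) ->
  forall s, a < s < b -> curve_derivable g s /\ curve_derivable (vel g) s.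
Proof.
  intros (u & Hu) (v & Hv) (w & Hw) s Hs.
  assert (H : forall t, a < t < b -> has_vel g t (u t, v t, w t)).
  { intros t Ht. split; [apply Hu, Ht|split; [apply Hv, Ht|apply Hw, Ht]]. }
  split; [apply (has_vel_derivable _ _ _ (H s Hs))|].
  apply (curve_derivable_vel g (fun t => (u t, v t, w t)) a b); trivial.
  split; [apply Hu, Hs|split; [apply Hv, Hs|apply Hw, Hs]].
Qed.

Lemma twice_derivable_has_vel (a b : R) (g v w : R -> triple) :
  (forall s, a < s < b -> has_vel g s (v s) /\ has_vel v s (w s)) ->
  twice_derivable a b (fun s => co1 (g s)) /\ twice_derivable a b (fun s => co2 (g s)) /\
  twice_derivable a b (fun s => co3 (g s)).
Proof.
  intros H. split; [|split].
  - exists (fun s => co1 (v s)). intros s Hs. destruct (H s Hs) as (H1 & H2).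
    split; [apply H1|exists (co1 (w s)); apply H2].
  - exists (fun s => co2 (v s)). intros s Hs. destruct (H s Hs) as (H1 & H2).
    split; [apply H1|exists (co2 (w s)); apply H2].
  - exists (fun s => co3 (v s)). intros s Hs. destruct (H s Hs) as (H1 & H2).
    split; [apply H1|exists (co3 (w s)); apply H2].
Qed.

Section CoverSides.

Variable k : R.
Hypothesis Hk : 0 < k.

Let M := Surface plane (quadric_cover k) (-1) 1 1.

(** The equator, which the cover unrolls to a line of unbounded length, so [p] and [q] are
    arbitrary. *)
Lemma cover_spacelike_side (p q : R) : side M (0, p, 0) (0, q, 0) (Rabs (q - p)).
Proof.
  set (d := q - p). set (g := fun u => (0, p + u * d, 0) : triple).
  assert (V1 : forall t, has_vel g t (0, d, 0)).
  { intros t. split; [|split]; unfold g, co1, co2, co3; simpl; auto_derive; trivial; ring. }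
  assert (D : forall t, quadric_cover k (g t) = (0, cos (k * (p + t * d)) / k, sin (k * (p + t * d)) / k)).
  { intros t. unfold quadric_cover, g, co1, co2; simpl. rewrite Rmult_0_r, sinh_0, cosh_0.
    coordwise; field; lra. }
  set (w := fun t => (0, - sin (k * (p + t * d)) * d, cos (k * (p + t * d)) * d) : triple).
  assert (Hg : geodesic M g /\ signed_length M g = Rabs d).
  { apply (quadric_geodesic_intro M (k * k) g w 1).
    - apply cover_quadric_surface, Hk.
    - lra.
    - intros t _. split; [reflexivity|]. split; [apply (has_vel_derivable _ _ _ (V1 t))|].
      split; [|split].
      + eapply (curve_derivable_vel g (fun _ => (0, d, 0))) with (a := t - 1) (b := t + 1); [lra|auto|].
        apply (has_vel_derivable _ _ _ (has_vel_const (0, d, 0) t)).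
      + apply (has_vel_ext_loc (fun t => (0, cos (k * (p + t * d)) / k, sin (k * (p + t * d)) / k))).
        { apply filter_forall. intros u. symmetry. apply D. }
        split; [|split]; unfold w, co1, co2, co3; simpl; auto_derive; trivial; field; lra.
      + exists (- (k * k) * (d * d)). change (dev M (g t)) with (quadric_cover k (g t)). rewrite D.
        split; [|split]; unfold w, lin3, co1, co2, co3; simpl; auto_derive; trivial; field; lra.
    - change (sig M) with J2. rewrite ssq_Rabs. unfold w, J2, dot, co1, co2, co3; simpl.
      pose proof (sin2_cos2 (k * (p + 0 * d))) as H; unfold Rsqr in H.
      transitivity (d * d * (sin (k * (p + 0 * d)) * sin (k * (p + 0 * d)) +
        cos (k * (p + 0 * d)) * cos (k * (p + 0 * d)))); [ring|rewrite H; ring]. }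
  exists g. split; [split; [|split]|]; try apply Hg.
  - unfold g. repeat f_equal. ring.
  - unfold g, d. repeat f_equal. ring.
Qed.

Lemma cover_timelike_side (p q : R) : side M (p, 0, 0) (q, 0, 0) (- Rabs (q - p)).
Proof.
  set (d := q - p). set (g := fun u => (p + u * d, 0, 0) : triple).
  assert (V1 : forall t, has_vel g t (d, 0, 0)).
  { intros t. split; [|split]; unfold g, co1, co2, co3; simpl; auto_derive; trivial; ring. }
  assert (D : forall t, quadric_cover k (g t) = (sinh (k * (p + t * d)) / k, cosh (k * (p + t * d)) / k, 0)).
  { intros t. unfold quadric_cover, g, co1, co2; simpl. rewrite Rmult_0_r, sin_0, cos_0.
    coordwise; field; lra. }
  set (w := fun t => (cosh (k * (p + t * d)) * d, sinh (k * (p + t * d)) * d, 0) : triple).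
  assert (L : forall t, is_derive (fun t => k * (p + t * d)) t (k * d)) by (intros t; auto_derive; trivial; ring).
  assert (Dsh : forall t, is_derive (fun t => sinh (k * (p + t * d))) t (cosh (k * (p + t * d)) * (k * d))).
  { intros t. apply (is_derive_comp_R sinh _ _ _ _ (is_derive_sinh _) (L t)). }
  assert (Dch : forall t, is_derive (fun t => cosh (k * (p + t * d))) t (sinh (k * (p + t * d)) * (k * d))).
  { intros t. apply (is_derive_comp_R cosh _ _ _ _ (is_derive_cosh _) (L t)). }
  assert (F : forall (h : R -> R) t a c b, is_derive h t a -> a * c = b -> is_derive (fun t => h t * c) t b).
  { intros h t a c b Hh <-. eapply is_derive_eq.
    - apply is_derive_mult_R; [exact Hh|apply (is_derive_const_R c)].
    - cbn beta. ring. }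
  assert (Hg : geodesic M g /\ signed_length M g = - Rabs d).
  { apply (quadric_geodesic_intro M (k * k) g w 1).
    - apply cover_quadric_surface, Hk.
    - lra.
    - intros t _. split; [reflexivity|]. split; [apply (has_vel_derivable _ _ _ (V1 t))|].
      split; [|split].
      + eapply (curve_derivable_vel g (fun _ => (d, 0, 0))) with (a := t - 1) (b := t + 1); [lra|auto|].
        apply (has_vel_derivable _ _ _ (has_vel_const (d, 0, 0) t)).
      + apply (has_vel_ext_loc (fun t => (sinh (k * (p + t * d)) / k, cosh (k * (p + t * d)) / k, 0))).
        { apply filter_forall. intros u. symmetry. apply D. }
        split; [|split].
        * apply (F _ _ _ (/ k) _ (Dsh t)). unfold w, co1; simpl. field. lra.
        * apply (F _ _ _ (/ k) _ (Dch t)). unfold w, co2; simpl. field. lra.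
        * apply (is_derive_const_R 0).
      + exists (k * k * (d * d)). change (dev M (g t)) with (quadric_cover k (g t)). rewrite D.
        split; [|split].
        * apply (F _ _ _ d _ (Dch t)). unfold lin3, co1; simpl. field. lra.
        * apply (F _ _ _ d _ (Dsh t)). unfold lin3, co2; simpl. field. lra.
        * eapply is_derive_eq; [apply (is_derive_const_R 0)|]. unfold lin3, co3; simpl. ring.
    - change (sig M) with J2. rewrite ssq_opp, ssq_Rabs. unfold w, J2, dot, co1, co2, co3; simpl.
      pose proof (cosh2_sinh2 (k * (p + 0 * d))) as H.
      transitivity (- (d * d) * (cosh (k * (p + 0 * d)) * cosh (k * (p + 0 * d)) -
        sinh (k * (p + 0 * d)) * sinh (k * (p + 0 * d)))); [ring|rewrite H; ring]. }
  exists g. split; [split; [|split]|]; try apply Hg.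
  - unfold g. repeat f_equal. ring.
  - unfold g, d. repeat f_equal. ring.
Qed.

(** A section of the covering over the half space y > 0, where atan (z / y) is the polar angle. *)
Definition cover_section (v : triple) : triple :=
  (arcsinh (k * co1 v) / k, atan (co3 v / co2 v) / k, 0).

Lemma cover_section_dev (v : triple) : dot J2 v v = / (k * k) -> 0 < co2 v ->
  quadric_cover k (cover_section v) = v.
Proof.
  destruct v as [[x y] z]. unfold cover_section, quadric_cover, J2, dot, co1, co2, co3; simpl. intros Hv Hy.
  assert (E1 : k * (arcsinh (k * x) / k) = arcsinh (k * x)) by (field; lra).
  assert (E2 : k * (atan (z / y) / k) = atan (z / y)) by (field; lra).
  rewrite E1, E2, sinh_arcsinh, cosh_arcsinh, cos_atan, sin_atan. unfold Rsqr.
  set (r := sqrt (y * y + z * z)).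
  assert (Hr : 0 < r) by (apply sqrt_lt_R0; nra).
  assert (Hrr : r * r = y * y + z * z) by (apply sqrt_sqrt; nra).
  assert (S1 : sqrt (1 + k * x * (k * x)) = k * r).
  { apply sqrt_lem_1; [nra|nra|]. transitivity (k * k * (r * r)); [ring|]. rewrite Hrr.
    replace (y * y + z * z) with (/ (k * k) + x * x) by lra. field. lra. }
  assert (S2 : sqrt (1 + z / y * (z / y)) = r / y).
  { assert (Hq : 0 < r / y) by (apply Rdiv_lt_0_compat; trivial).
    apply sqrt_lem_1; [pose proof (Rle_0_sqr (z / y)) as H; unfold Rsqr in H; lra|lra|].
    transitivity ((r * r) / (y * y)); [field; lra|]. rewrite Hrr. field. lra. }
  rewrite S1, S2. coordwise; field; lra.
Qed.

(** By [gsin_one_minus] the coefficients in [arc] are gsin (1 - s) and gsin s over gsin 1. Below the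
    first conjugate length they are nonnegative and not both zero, so an arc with its ends in the
    half space y > 0 stays there. *)
Lemma arc_coefficients (c s : R) : c < PI * PI -> 0 <= s <= 1 ->
  0 <= gcos c s - gsin c s / gsin c 1 * gcos c 1 /\ 0 <= gsin c s / gsin c 1 /\
  0 < (gcos c s - gsin c s / gsin c 1 * gcos c 1) + gsin c s / gsin c 1.
Proof.
  intros Hc Hs. assert (H1 : 0 < gsin c 1) by (apply gsin_pos; lra).
  replace (gcos c s - gsin c s / gsin c 1 * gcos c 1) with (gsin c (1 - s) / gsin c 1)
    by (rewrite gsin_one_minus; field; lra).
  destruct (Req_dec s 0) as [->|H0].
  - rewrite Rminus_0_r, gsin_0. replace (gsin c 1 / gsin c 1) with 1 by (field; lra).
    unfold Rdiv. rewrite Rmult_0_l. lra.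
  - assert (H2 : 0 < gsin c s / gsin c 1) by (apply Rdiv_lt_0_compat; trivial; apply gsin_pos; lra).
    assert (H3 : 0 <= gsin c (1 - s) / gsin c 1).
    { destruct (Req_dec s 1) as [->|H4].
      - rewrite Rminus_diag, gsin_0. unfold Rdiv. lra.
      - apply Rlt_le, Rdiv_lt_0_compat; trivial. apply gsin_pos; lra. }
    lra.
Qed.

(** A side must be geodesic slightly beyond [0, 1], so the half space condition has to hold there
    too. *)
Lemma continuous_pos_extend (f : R -> R) :
  (forall s, continuous f s) -> (forall s, 0 <= s <= 1 -> 0 < f s) ->
  exists e, 0 < e /\ forall s, - e < s < 1 + e -> 0 < f s.
Proof.
  intros Hc Hp.
  assert (Hl : forall a, 0 < f a -> locally a (fun s => 0 < f s)).
  { intros a Ha. apply (Hc a). apply (open_gt 0 (f a) Ha). }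
  destruct (Hl 0) as (d0 & H0); [apply Hp; lra|]. destruct (Hl 1) as (d1 & H1); [apply Hp; lra|].
  exists (Rmin d0 d1). split; [apply Rmin_pos; apply cond_pos|].
  intros s Hs. pose proof (Rmin_l d0 d1); pose proof (Rmin_r d0 d1).
  destruct (Rlt_dec s 0); [|destruct (Rlt_dec 1 s)].
  - apply H0. change (Rabs (s - 0) < d0). apply Rabs_def1; lra.
  - apply H1. change (Rabs (s - 1) < d1). apply Rabs_def1; lra.
  - apply Hp. lra.
Qed.

Lemma cover_arc_side (P Q : triple) (l : R) :
  dot J2 P P = / (k * k) -> dot J2 Q Q = / (k * k) -> 0 < co2 P -> 0 < co2 Q ->
  k * k * ssq l < PI * PI -> dot J2 P Q = gcos (k * k * ssq l) 1 / (k * k) ->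
  side M (cover_section P) (cover_section Q) l.
Proof.
  intros DP DQ YP YQ Hc HPQ. set (c := k * k * ssq l) in *.
  assert (HS : gsin c 1 <> 0) by (pose proof (gsin_pos c 1 Hc); lra).
  assert (HK : k * k <> 0) by nra.
  destruct (arc_velocity J2 P Q (k * k) l HK DP DQ HPQ HS) as (E1 & E2 & E3). fold c in E1, E2, E3.
  set (V := lin3 _ Q _ P 0 P) in *. clearbody V.
  set (G := fun u => lin3 (gcos c (0 + u * 1)) P (gsin c (0 + u * 1)) V 0 P).
  assert (EG : forall t, G t = arc c P Q t).
  { intros t. rewrite E3. unfold G. replace (0 + t * 1) with t by ring. reflexivity. }
  assert (DG : forall t, dot J2 (G t) (G t) = / (k * k)).
  { intros t. apply (circle_dot J2 P V (k * k) l (0 + t * 1) HK DP E1 E2). }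
  assert (HV : forall t, has_vel G t (lin3 (- c * 1 * gsin c (0 + t * 1)) P (1 * gcos c (0 + t * 1)) V 0 P) /\
    has_vel (fun u => lin3 (- c * 1 * gsin c (0 + u * 1)) P (1 * gcos c (0 + u * 1)) V 0 P) t
      (lin3 (- c * 1 * 1) (G t) 0 (G t) 0 (G t))).
  { intros t. apply has_vel_gcos_gsin. }
  destruct (continuous_pos_extend (fun t => co2 (G t))) as (e & He & Ye).
  { intros t. apply (ex_derive_continuous (V := R_NormedModule)). eexists. apply (proj1 (HV t)). }
  { intros t Ht. rewrite EG. destruct (arc_coefficients c t Hc Ht) as (C1 & C2 & C3).
    unfold arc, lin3. unfold co2 at 1; simpl.
    set (a := gcos c t - _) in *. set (b := gsin c t / _) in *.
    assert (0 <= a * co2 P) by nra. assert (0 <= b * co2 Q) by nra.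
    destruct (Rlt_dec 0 a); [assert (0 < a * co2 P) by nra; lra|].
    assert (0 < b) by lra. assert (0 < b * co2 Q) by nra. lra. }
  set (g := fun t => cover_section (G t)).
  assert (Dg : forall t, - e < t < 1 + e -> quadric_cover k (g t) = G t).
  { intros t Ht. apply cover_section_dev; [apply DG|apply Ye, Ht]. }
  destruct (twice_derivable_has_vel (- e) (1 + e) G _ _ (fun s _ => HV s)) as (T1 & T2 & T3).
  assert (Tg : forall t, - e < t < 1 + e -> curve_derivable g t /\ curve_derivable (vel g) t).
  { apply twice_derivable_curve.
    - apply (twice_derivable_mult _ _ (fun t => arcsinh (k * co1 (G t))) (fun _ => / k));
        [|apply twice_derivable_const].
      apply (twice_derivable_comp _ _ arcsinh (fun x => / sqrt (x * x + 1)) (fun t => k * co1 (G t))).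
      + apply (twice_derivable_mult _ _ (fun _ => k)); trivial. apply twice_derivable_const.
      + intros t _. split.
        * eapply is_derive_eq; [apply is_derive_Reals, derivable_pt_lim_arcsinh|]. do 2 f_equal; ring.
        * set (x := k * co1 (G t)). assert (H1 : 0 < x * x + 1) by nra. pose proof (sqrt_lt_R0 _ H1).
          auto_derive. repeat split; lra.
    - apply (twice_derivable_mult _ _ (fun t => atan (co3 (G t) / co2 (G t))) (fun _ => / k));
        [|apply twice_derivable_const].
      apply (twice_derivable_comp _ _ atan (fun x => / (1 + x * x)) (fun t => co3 (G t) / co2 (G t))).
      + apply (twice_derivable_mult _ _ (fun t => co3 (G t)) (fun t => / co2 (G t))); trivial.
        apply (twice_derivable_comp _ _ Rinv (fun x => - 1 / x ^ 2) (fun t => co2 (G t))); trivial.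
        intros t Ht. pose proof (Ye t Ht) as Y. cbn beta in Y. split.
        * apply (is_derive_inv (fun x => x)); [apply is_derive_id_R|lra].
        * auto_derive. repeat split. nra.
      + intros t _. split; [apply is_derive_atan|].
        set (x := co3 (G t) / co2 (G t)). auto_derive. repeat split. nra.
    - exact (twice_derivable_const (- e) (1 + e) 0). }
  assert (Hg : geodesic M g /\ signed_length M g = l).
  { apply (quadric_geodesic_intro M (k * k) g
      (fun u => lin3 (- c * 1 * gsin c (0 + u * 1)) P (1 * gcos c (0 + u * 1)) V 0 P) e).
    - apply cover_quadric_surface, Hk.
    - exact He.
    - intros t Ht. split; [reflexivity|]. split; [apply Tg, Ht|]. split; [apply Tg, Ht|].
      change (dev M (g t)) with (quadric_cover k (g t)). rewrite Dg by trivial.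
      split; [|exists (- c * 1 * 1); apply HV].
      apply (has_vel_ext_loc G); [|apply HV].
      apply (interval_locally (- e) (1 + e)); trivial. intros u Hu. symmetry. apply Dg, Hu.
    - cbn beta. replace (0 + 0 * 1) with 0 by ring. rewrite gcos_0, gsin_0.
      change (sig M) with J2. rewrite dot_lin3_l, !dot_lin3_r, (dot_comm _ V P), E1, E2. ring. }
  destruct (arc_ends c P Q HS) as (A0 & A1).
  exists g. split; [split; [|split]|]; try apply Hg; unfold g; rewrite EG; congruence.
Qed.

End CoverSides.

(** * Existence of vertices *)

(** The closed cone formed by T^+, D^+ and the origin. *)
Definition triangular (a b c : R) : Prop :=
  0 <= a /\ 0 <= b /\ 0 <= c /\ a <= b + c /\ b <= a + c /\ c <= a + b.

Lemma T_pos_strict (x : triple) : T_pos x <->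
  (0 < co1 x /\ 0 < co2 x /\ 0 < co3 x) /\
  co1 x < co2 x + co3 x /\ co2 x < co1 x + co3 x /\ co3 x < co1 x + co2 x.
Proof.
  unfold T_pos, largest, total, Rmax.
  destruct (Rle_dec (co1 x) (co2 x)); [destruct (Rle_dec (co2 x) (co3 x))|destruct (Rle_dec (co1 x) (co3 x))];
  split; intros; repeat split; lra.
Qed.

Lemma not_triangular (x : triple) : x <> tzero -> ~ T_pos x -> ~ D_pos x ->
  ~ triangular (co1 x) (co2 x) (co3 x).
Proof.
  intros Hx HT HD (H1 & H2 & H3 & H4 & H5 & H6).
  destruct (Req_dec (co1 x) (co2 x + co3 x)) as [E|E1]; [apply HD; repeat split; trivial; left; trivial|].
  destruct (Req_dec (co2 x) (co1 x + co3 x)) as [E|E2]; [apply HD; repeat split; trivial; right; left; trivial|].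
  destruct (Req_dec (co3 x) (co1 x + co2 x)) as [E|E3]; [apply HD; repeat split; trivial; right; right; trivial|].
  apply HT, T_pos_strict. repeat split; lra.
Qed.

(** Heron's formula for sixteen times the squared area. With squared lengths replaced by energies,
    the left side is four times the Gram determinant of the vectors from A to B and C. *)
Lemma heron (a b c : R) :
  4 * (a * a) * (c * c) - (a * a + c * c - b * b) * (a * a + c * c - b * b)
  = (b + c - a) * (a + b - c) * (a + c - b) * (a + b + c).
Proof. ring. Qed.

Lemma heron_pos (a b c : R) : 0 < a -> 0 < b -> 0 < c -> a < b + c -> b < a + c -> c < a + b ->
  0 < 4 * (a * a) * (c * c) - (a * a + c * c - b * b) * (a * a + c * c - b * b).
Proof. intros. rewrite heron. repeat apply Rmult_lt_0_compat; lra. Qed.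

Lemma Rmult3_neg (p q r t : R) : 0 < p -> 0 < q -> r < 0 -> 0 < t -> p * q * r * t < 0.
Proof.
  intros. replace (p * q * r * t) with (- (p * q * (- r) * t)) by ring.
  apply Ropp_lt_gt_0_contravar. repeat apply Rmult_lt_0_compat; lra.
Qed.

(** For nonnegative lengths only one triangle inequality can fail, so exactly one factor is
    negative. *)
Lemma heron_neg (a b c : R) : 0 <= a -> 0 <= b -> 0 <= c -> ~ triangular a b c ->
  4 * (a * a) * (c * c) - (a * a + c * c - b * b) * (a * a + c * c - b * b) < 0.
Proof.
  intros Ha Hb Hc HT. rewrite heron. unfold triangular in HT.
  destruct (Rlt_dec (b + c) a); [|destruct (Rlt_dec (a + c) b); [|destruct (Rlt_dec (a + b) c)]].
  - replace (_ * _ * _ * _) with ((a + b - c) * (a + c - b) * (b + c - a) * (a + b + c)) by ring.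
    apply Rmult3_neg; lra.
  - apply Rmult3_neg; lra.
  - replace (_ * _ * _ * _) with ((b + c - a) * (a + c - b) * (a + b - c) * (a + b + c)) by ring.
    apply Rmult3_neg; lra.
  - exfalso. apply HT. lra.
Qed.

(** If strictly opposite signs occur, some product of two energies is negative, which suffices as
    the expression is symmetric in the three energies. Otherwise Heron's formula applies to the
    triple or to its negative. *)
Lemma signed_heron_neg (a b c : R) : ~ triangular a b c -> ~ triangular (- a) (- b) (- c) ->
  4 * ssq a * ssq c - (ssq a + ssq c - ssq b) * (ssq a + ssq c - ssq b) < 0.
Proof.
  intros Hp Hn.
  assert (Hopp : forall p q r, p * r < 0 -> 4 * p * r - (p + r - q) * (p + r - q) < 0).
  { intros p q r H. pose proof (Rle_0_sqr (p + r - q)) as H0; unfold Rsqr in H0. lra. }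
  assert (Hm : forall u v, 0 <= u -> v < 0 -> u <> 0 -> ssq u * ssq v < 0).
  { intros u v Hu Hv Hu0. rewrite ssq_pos, ssq_neg by lra.
    assert (0 < u * u) by nra. assert (0 < v * v) by nra. nra. }
  assert (Hopp' : forall p q r, p * q < 0 \/ p * r < 0 \/ q * r < 0 ->
    4 * p * r - (p + r - q) * (p + r - q) < 0).
  { intros p q r [H|[H|H]].
    - replace (_ - _) with (4 * p * q - (p + q - r) * (p + q - r)) by ring. apply Hopp, H.
    - apply Hopp, H.
    - replace (_ - _) with (4 * q * r - (q + r - p) * (q + r - p)) by ring. apply Hopp, H. }
  assert (Hnn : a <= 0 -> b <= 0 -> c <= 0 ->
    4 * ssq a * ssq c - (ssq a + ssq c - ssq b) * (ssq a + ssq c - ssq b) < 0).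
  { intros Ha Hb Hc. pose proof (heron_neg (- a) (- b) (- c)) as H. rewrite !ssq_neg by trivial.
    specialize (H ltac:(lra) ltac:(lra) ltac:(lra) Hn).
    match goal with |- ?l < 0 => replace l with
      (4 * (- a * - a) * (- c * - c) - (- a * - a + - c * - c - - b * - b) * (- a * - a + - c * - c - - b * - b)) by ring end.
    exact H. }
  destruct (Rlt_dec a 0) as [Ha|Ha]; destruct (Rlt_dec b 0) as [Hb|Hb]; destruct (Rlt_dec c 0) as [Hc|Hc];
    try (apply Hnn; lra).
  - destruct (Req_dec c 0) as [->|]; [apply Hnn; lra|]. apply Hopp'. right; left. rewrite Rmult_comm. apply Hm; lra.
  - destruct (Req_dec b 0) as [->|]; [apply Hnn; lra|]. apply Hopp'. left. rewrite Rmult_comm. apply Hm; lra.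
  - destruct (Req_dec b 0) as [->|].
    + destruct (Req_dec c 0) as [->|]; [apply Hnn; lra|]. apply Hopp'. right; left. rewrite Rmult_comm. apply Hm; lra.
    + apply Hopp'. left. rewrite Rmult_comm. apply Hm; lra.
  - destruct (Req_dec a 0) as [->|]; [apply Hnn; lra|]. apply Hopp'. left. apply Hm; lra.
  - destruct (Req_dec a 0) as [->|].
    + destruct (Req_dec c 0) as [->|]; [apply Hnn; lra|]. apply Hopp'. right; right. rewrite Rmult_comm. apply Hm; lra.
    + apply Hopp'. left. apply Hm; lra.
  - destruct (Req_dec a 0) as [->|].
    + destruct (Req_dec b 0) as [->|]; [apply Hnn; lra|]. apply Hopp'. right; right. apply Hm; lra.
    + apply Hopp'. right; left. apply Hm; lra.
  - rewrite !ssq_pos by lra. apply heron_neg; lra || trivial.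
Qed.

(** [m] is the required product <u, v>. A non-null u is put on the coordinate axis of its own type,
    and v is found by projecting to the two axes. *)
Lemma plane_vectors_exist (s E1 E2 E3 : R) : s * s = 1 ->
  (0 < E1 /\ 0 <= s * (4 * E1 * E3 - (E1 + E3 - E2) * (E1 + E3 - E2)) \/
   s = -1 /\ 4 * E1 * E3 - (E1 + E3 - E2) * (E1 + E3 - E2) < 0) ->
  exists u v, plane u /\ plane v /\ dot (s, 1, 1) u u = E1 /\
    dot (s, 1, 1) (vsub v u) (vsub v u) = E2 /\ dot (s, 1, 1) v v = E3.
Proof.
  intros Hs H. set (m := (E1 + E3 - E2) / 2).
  assert (Hm : E2 = E1 + E3 - 2 * m) by (unfold m; field).
  assert (HG : 4 * E1 * E3 - (E1 + E3 - E2) * (E1 + E3 - E2) = 4 * (E1 * E3 - m * m)) by (rewrite Hm; ring).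
  rewrite HG in H. clearbody m. clear HG.
  enough (Hex : exists u1 u2 v1 v2, s * u1 * u1 + u2 * u2 = E1 /\ s * u1 * v1 + u2 * v2 = m /\
    s * v1 * v1 + v2 * v2 = E3).
  { destruct Hex as (u1 & u2 & v1 & v2 & H1 & H2 & H3).
    exists (u1, u2, 0), (v1, v2, 0). unfold plane, dot, vsub, lin3, co1, co2, co3; simpl.
    split; [reflexivity|]. split; [reflexivity|]. rewrite Hm, <- H1, <- H2, <- H3. split; [ring|split; ring]. }
  destruct (Rlt_dec 0 E1) as [P1|N1].
  - assert (HD : 0 <= s * (E1 * E3 - m * m)) by (destruct H as [(_ & H)|(-> & H)]; lra).
    set (a := sqrt E1). assert (Ha : 0 < a) by (apply sqrt_lt_R0, P1).
    assert (Haa : a * a = E1) by (apply sqrt_sqrt; lra).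
    set (t := sqrt (s * (E1 * E3 - m * m) / E1)).
    assert (Ht : t * t = s * (E1 * E3 - m * m) / E1).
    { apply sqrt_sqrt. apply Rmult_le_pos; [exact HD|]. apply Rlt_le, Rinv_0_lt_compat, P1. }
    exists 0, a, t, (m / a). split; [lra|]. split; [field; lra|].
    transitivity (s * (t * t) + m * m / (a * a)); [field; lra|]. rewrite Ht, Haa.
    transitivity ((s * s) * (E1 * E3 - m * m) / E1 + m * m / E1); [field; lra|]. rewrite Hs. field. lra.
  - destruct H as [(H & _)|(Es & H)]; [lra|]. subst s.
    destruct (Rlt_dec E1 0) as [P1|Z1].
    + set (a := sqrt (- E1)). assert (Ha : 0 < a) by (apply sqrt_lt_R0; lra).
      assert (Haa : a * a = - E1) by (apply sqrt_sqrt; lra).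
      set (t := sqrt ((m * m - E1 * E3) / - E1)).
      assert (Ht : t * t = (m * m - E1 * E3) / - E1).
      { apply sqrt_sqrt. apply Rmult_le_pos; [lra|]. apply Rlt_le, Rinv_0_lt_compat; lra. }
      exists a, 0, (- m / a), t. split; [lra|]. split; [field; lra|].
      transitivity (- (m * m) / (a * a) + t * t); [field; lra|]. rewrite Ht, Haa. field. lra.
    + assert (Z : E1 = 0) by lra. subst E1. assert (Hm0 : m <> 0) by (intros ->; lra).
      (* For the null vector u = (1, 1), the conditions on v read v2 - v1 = m and v2 + v1 = E3 /
         m. *)
      exists 1, 1, ((E3 / m - m) / 2), ((m + E3 / m) / 2).
      split; [ring|]. split; [field; trivial|]. field; trivial.
Qed.

Lemma plane_triangle (s : R) (x : triple) : s * s = 1 ->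
  (0 < ssq (co1 x) /\
    0 <= s * (4 * ssq (co1 x) * ssq (co3 x) - (ssq (co1 x) + ssq (co3 x) - ssq (co2 x)) *
      (ssq (co1 x) + ssq (co3 x) - ssq (co2 x))) \/
   s = -1 /\ 4 * ssq (co1 x) * ssq (co3 x) - (ssq (co1 x) + ssq (co3 x) - ssq (co2 x)) *
      (ssq (co1 x) + ssq (co3 x) - ssq (co2 x)) < 0) ->
  exists T, realizes (Surface plane (fun p => p) s 1 1) T x.
Proof.
  intros Hs H. destruct (plane_vectors_exist s _ _ _ Hs H) as (u & v & Pu & Pv & Hu & Hw & Hv).
  assert (E : forall w, vsub w (0, 0, 0) = w) by (clear; intros w; unfold vsub; triple_ring).
  apply (triangle_of_sides _ (0, 0, 0) u v); apply plane_side; rewrite ?E; trivial; reflexivity.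
Qed.

Lemma plane_line_sides (s : R) :
  (forall p q, side (Surface plane (fun p => p) s 1 1) (0, p, 0) (0, q, 0) (Rabs (q - p))) /\
  (s = -1 -> forall p q, side (Surface plane (fun p => p) s 1 1) (p, 0, 0) (q, 0, 0) (- Rabs (q - p))).
Proof.
  split; [intros p q|intros -> p q]; apply plane_side; try reflexivity;
  rewrite ?ssq_opp, ssq_Rabs; unfold vsub, dot, lin3, co1, co2, co3; simpl; ring.
Qed.

(** The Gram determinant of three vectors of square 1 with mutual products x, y, z. *)
Definition gdet (x y z : R) : R := 1 + 2 * x * y * z - x * x - y * y - z * z.

Lemma gdet_cos (a b z : R) : gdet (cos a) (cos b) z = - ((z - cos (a + b)) * (z - cos (a - b))).
Proof.
  rewrite cos_plus, cos_minus. unfold gdet.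
  pose proof (sin2_cos2 a) as Ha; pose proof (sin2_cos2 b) as Hb; unfold Rsqr in *.
  transitivity (- (z * z - 2 * z * (cos a * cos b) + (cos a * cos a) * (cos b * cos b)
    - (sin a * sin a) * (sin b * sin b))); [|ring].
  replace (sin a * sin a) with (1 - cos a * cos a) by lra.
  replace (sin b * sin b) with (1 - cos b * cos b) by lra. ring.
Qed.

Lemma cosh_plus_minus (a b : R) :
  cosh (a + b) = cosh a * cosh b + sinh a * sinh b /\ cosh (a - b) = cosh a * cosh b - sinh a * sinh b.
Proof.
  unfold cosh, sinh.
  replace (- (a + b)) with (- a + - b) by ring. replace (a - b) with (a + - b) by ring.
  replace (- (a + - b)) with (- a + b) by ring. rewrite !exp_plus. split; field.
Qed.

Lemma gdet_cosh (a b z : R) : gdet (cosh a) (cosh b) z = - ((z - cosh (a + b)) * (z - cosh (a - b))).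
Proof.
  destruct (cosh_plus_minus a b) as (-> & ->). unfold gdet.
  pose proof (cosh2_sinh2 a) as Ha; pose proof (cosh2_sinh2 b) as Hb.
  transitivity (- (z * z - 2 * z * (cosh a * cosh b) + (cosh a * cosh a) * (cosh b * cosh b)
    - (sinh a * sinh a) * (sinh b * sinh b))); [|ring].
  replace (sinh a * sinh a) with (cosh a * cosh a - 1) by lra.
  replace (sinh b * sinh b) with (cosh b * cosh b - 1) by lra. ring.
Qed.

Lemma cosh_lt (a b : R) : 0 <= a < b -> cosh a < cosh b.
Proof.
  intros H. assert (Hs : sinh a < sinh b) by (apply sinh_lt; lra).
  assert (Ha : 0 <= sinh a) by (destruct (Req_dec a 0) as [->|]; [rewrite sinh_0; lra|pose proof (sinh_pos a); lra]).
  pose proof (cosh2_sinh2 a); pose proof (cosh2_sinh2 b). pose proof (cosh_pos a); pose proof (cosh_pos b). nra.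
Qed.

Lemma cosh_Rabs (a : R) : cosh (Rabs a) = cosh a.
Proof. unfold Rabs. destruct (Rcase_abs a); [apply cosh_sinh_opp|reflexivity]. Qed.

Lemma cosh_lt_abs (a b : R) : Rabs a < Rabs b -> cosh a < cosh b.
Proof. intros H. rewrite <- (cosh_Rabs a), <- (cosh_Rabs b). apply cosh_lt. split; [apply Rabs_pos|trivial]. Qed.

Lemma cosh_ge_1 (a : R) : 1 <= cosh a.
Proof. pose proof (cosh2_sinh2 a); pose proof (cosh_pos a). nra. Qed.

Lemma cosh_gt_1 (a : R) : a <> 0 -> 1 < cosh a.
Proof.
  intros H. rewrite <- cosh_0. apply cosh_lt_abs. rewrite Rabs_R0. apply Rabs_pos_lt, H.
Qed.

Lemma cos_lt (a b : R) : 0 <= a < b -> b <= PI -> cos b < cos a.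
Proof. intros H H'. apply cos_decreasing_1; lra. Qed.

Lemma cos_lt_abs (a b : R) : Rabs a < b -> b <= PI -> cos b < cos a.
Proof.
  intros H Hb. replace (cos a) with (cos (Rabs a)).
  - apply cos_lt; trivial. split; [apply Rabs_pos|trivial].
  - unfold Rabs. destruct (Rcase_abs a); [apply cos_neg|reflexivity].
Qed.

Lemma neg_mult_pos (p q : R) : p < 0 -> q < 0 -> - (p * q) < 0.
Proof. intros. nra. Qed.

(** This is k^2 <P, Q> for the ends of a side of length l / k in the de Sitter quadric of curvature
    k^2. *)
Definition cos_or_cosh (l : R) : R := if Rle_dec 0 l then cos l else cosh l.

Lemma gdet_perm (x y z : R) : gdet x y z = gdet y x z /\ gdet x y z = gdet x z y /\ gdet x y z = gdet z y x.
Proof. unfold gdet. repeat split; ring. Qed.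

(** The cosine decreases up to PI, so cos c lies below both roots cos (a + b) and cos (a - b). *)
Lemma gdet_spacelike_neg (a b c : R) : 0 <= a -> 0 <= b -> a + b < c -> c < PI ->
  gdet (cos a) (cos b) (cos c) < 0.
Proof.
  intros. rewrite gdet_cos. apply neg_mult_pos.
  - pose proof (cos_lt (a + b) c); lra.
  - assert (cos c < cos (a - b)); [|lra]. apply cos_lt_abs; [|lra]. apply Rabs_def1; lra.
Qed.

Lemma gdet_timelike_neg (a b c : R) : a <= 0 -> b <= 0 -> c < a + b ->
  gdet (cosh a) (cosh b) (cosh c) < 0.
Proof.
  intros. rewrite gdet_cosh.
  assert (cosh (a + b) < cosh c) by (apply cosh_lt_abs; rewrite !Rabs_left1 by lra; lra).
  assert (cosh (a - b) < cosh c).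
  { apply cosh_lt_abs. rewrite (Rabs_left1 c) by lra. apply Rabs_def1; lra. }
  nra.
Qed.

(** As a quadratic in its first argument, the determinant has roots cos (c + b) and cos (c - b),
    both at most 1 < cosh a. *)
Lemma gdet_mixed_1 (a b c : R) : a < 0 -> gdet (cosh a) (cos b) (cos c) < 0.
Proof.
  intros. rewrite (proj2 (proj2 (gdet_perm _ _ _))), gdet_cos.
  pose proof (cosh_gt_1 a). pose proof (COS_bound (c + b)). pose proof (COS_bound (c - b)). nra.
Qed.

(** Here cos c < 1 lies below both roots cosh (a + b) and cosh (a - b). *)
Lemma gdet_mixed_2 (a b c : R) : 0 < c < PI -> gdet (cosh a) (cosh b) (cos c) < 0.
Proof.
  intros. rewrite gdet_cosh. pose proof (cosh_ge_1 (a + b)). pose proof (cosh_ge_1 (a - b)).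
  assert (cos c < 1) by (rewrite <- cos_0; apply cos_lt; lra). nra.
Qed.

Lemma gdet_neg (a b c : R) : a < PI -> b < PI -> c < PI ->
  ~ triangular a b c -> ~ triangular (- a) (- b) (- c) ->
  gdet (cos_or_cosh a) (cos_or_cosh b) (cos_or_cosh c) < 0.
Proof.
  intros Ha Hb Hc Hp Hn. unfold triangular in Hp, Hn.
  assert (Hnn : a <= 0 -> b <= 0 -> c <= 0 -> gdet (cosh a) (cosh b) (cosh c) < 0).
  { intros Ha' Hb' Hc'.
    destruct (Rlt_dec c (a + b)); [apply gdet_timelike_neg; trivial|].
    destruct (Rlt_dec b (a + c)).
    - rewrite (proj1 (proj2 (gdet_perm _ _ _))). apply gdet_timelike_neg; trivial.
    - destruct (Rlt_dec a (c + b)); [|exfalso; apply Hn; lra].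
      rewrite (proj2 (proj2 (gdet_perm _ _ _))). apply gdet_timelike_neg; trivial. }
  unfold cos_or_cosh.
  destruct (Rle_dec 0 a) as [Ha'|Ha']; destruct (Rle_dec 0 b) as [Hb'|Hb']; destruct (Rle_dec 0 c) as [Hc'|Hc'];
    try (apply Hnn; lra).
  - destruct (Rlt_dec (a + b) c); [apply gdet_spacelike_neg; trivial|].
    destruct (Rlt_dec (a + c) b).
    + rewrite (proj1 (proj2 (gdet_perm _ _ _))). apply gdet_spacelike_neg; trivial.
    + destruct (Rlt_dec (c + b) a); [|exfalso; apply Hp; lra].
      rewrite (proj2 (proj2 (gdet_perm _ _ _))). apply gdet_spacelike_neg; trivial.
  - rewrite (proj2 (proj2 (gdet_perm _ _ _))). apply gdet_mixed_1; lra.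
  - rewrite (proj1 (gdet_perm _ _ _)). apply gdet_mixed_1; lra.
  (* As cos 0 = cosh 0, a zero length can be counted among the timelike ones. *)
  - destruct (Req_dec a 0) as [->|]; [rewrite cos_0, <- cosh_0; apply Hnn; lra|].
    rewrite (proj2 (proj2 (gdet_perm _ _ _))). apply gdet_mixed_2; lra.
  - apply gdet_mixed_1; lra.
  - destruct (Req_dec b 0) as [->|]; [rewrite cos_0, <- cosh_0; apply Hnn; lra|].
    rewrite (proj1 (proj2 (gdet_perm _ _ _))). apply gdet_mixed_2; lra.
  - destruct (Req_dec c 0) as [->|]; [rewrite cos_0, <- cosh_0; apply Hnn; lra|].
    apply gdet_mixed_2; lra.
Qed.

(* The three vectors are placed symmetrically about the direction of [A + C]. *)
Lemma de_sitter_vectors (x y z : R) : -1 < z -> 0 < x + y -> gdet x y z < 0 ->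
  exists A B C, (dot J2 A A = 1 /\ dot J2 B B = 1 /\ dot J2 C C = 1) /\
    (0 < co2 A /\ 0 < co2 B /\ 0 < co2 C) /\
    dot J2 A B = x /\ dot J2 B C = y /\ dot J2 A C = z.
Proof.
  intros Hz Hxy HD. set (q := sqrt ((1 + z) / 2)).
  assert (Hq : 0 < q) by (apply sqrt_lt_R0; lra).
  assert (Hqq : q * q = (1 + z) / 2) by (apply sqrt_sqrt; lra).
  set (b2 := (x + y) / (2 * q)).
  assert (Hb2 : 0 < b2) by (apply Rdiv_lt_0_compat; lra).
  assert (Hqb : q * b2 = (x + y) / 2) by (unfold b2; field; lra).
  assert (Hbb : b2 * b2 = (x + y) * (x + y) / (2 * (1 + z))).
  { transitivity ((x + y) * (x + y) / (4 * (q * q))); [unfold b2; field; lra|]. rewrite Hqq. field. lra. }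
  clearbody b2 q.
  (* The sum of the products of B with A and C fixes q b2, and 0 < x + y puts B in the half space.
     What remains is planar: A - C is spacelike, null or timelike as z is below, equal to or above
     1. *)
  enough (Hex : exists p r b1 b3, r * r - p * p = (1 - z) / 2 /\ r * b3 - p * b1 = (x - y) / 2 /\
    b3 * b3 - b1 * b1 = 1 - b2 * b2).
  { destruct Hex as (p & r & b1 & b3 & H1 & H2 & H3).
    exists (p, q, r), (b1, b2, b3), (- p, q, - r). unfold J2, dot, co1, co2, co3; simpl.
    repeat split; trivial; lra. }
  destruct (total_order_T z 1) as [[H|H]|H].
  - set (r := sqrt ((1 - z) / 2)).
    assert (Hr : 0 < r) by (apply sqrt_lt_R0; lra).
    assert (Hrr : r * r = (1 - z) / 2) by (apply sqrt_sqrt; lra).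
    set (b3 := (x - y) / (2 * r)).
    assert (H3 : b3 * b3 = (x - y) * (x - y) / (2 * (1 - z))).
    { transitivity ((x - y) * (x - y) / (4 * (r * r))); [unfold b3; field; lra|]. rewrite Hrr. field. lra. }
    (* The value required for b1^2 is nonnegative because the Gram determinant is negative. *)
    assert (HE : b2 * b2 + b3 * b3 - 1 = - gdet x y z / ((1 + z) * (1 - z))).
    { rewrite Hbb, H3. unfold gdet. field. split; lra. }
    assert (HP : 0 <= b2 * b2 + b3 * b3 - 1).
    { rewrite HE. apply Rlt_le, Rdiv_lt_0_compat; [lra|]. apply Rmult_lt_0_compat; lra. }
    pose proof (sqrt_sqrt _ HP) as H1.
    exists 0, r, (sqrt (b2 * b2 + b3 * b3 - 1)), b3. split; [lra|]. split; [unfold b3; field; lra|lra].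
  (* For z = 1 the determinant is - (x - y)^2, so x and y differ; B is solved in null coordinates,
     b3 - b1 = d and b3 + b1 = e. *)
  - subst z. assert (Hd : x - y <> 0).
    { intros E. replace x with y in HD by lra. unfold gdet in HD. lra. }
    set (d := (x - y) / 2). set (e := (1 - b2 * b2) / d).
    assert (Hd0 : d <> 0) by (unfold d; lra).
    exists 1, 1, ((e - d) / 2), ((d + e) / 2). split; [lra|]. split; [unfold d; lra|].
    transitivity (d * e); [field|]. unfold e. field. trivial.
  - set (p := sqrt ((z - 1) / 2)).
    assert (Hp : 0 < p) by (apply sqrt_lt_R0; lra).
    assert (Hpp : p * p = (z - 1) / 2) by (apply sqrt_sqrt; lra).
    set (b1 := - (x - y) / (2 * p)).
    assert (H1 : b1 * b1 = (x - y) * (x - y) / (2 * (z - 1))).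
    { transitivity ((x - y) * (x - y) / (4 * (p * p))); [unfold b1; field; lra|]. rewrite Hpp. field. lra. }
    assert (HE : 1 - b2 * b2 + b1 * b1 = - gdet x y z / ((1 + z) * (z - 1))).
    { rewrite Hbb, H1. unfold gdet. field. split; lra. }
    assert (HP : 0 <= 1 - b2 * b2 + b1 * b1).
    { rewrite HE. apply Rlt_le, Rdiv_lt_0_compat; [lra|]. apply Rmult_lt_0_compat; lra. }
    pose proof (sqrt_sqrt _ HP) as H3.
    exists p, 0, b1, (sqrt (1 - b2 * b2 + b1 * b1)). split; [lra|]. split; [unfold b1; field; lra|lra].
Qed.

Lemma cos_or_cosh_gt (l : R) : l < PI -> -1 < cos_or_cosh l.
Proof.
  intros H. unfold cos_or_cosh. destruct (Rle_dec 0 l).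
  - rewrite <- cos_PI. apply cos_lt; lra.
  - pose proof (cosh_ge_1 l); lra.
Qed.

(** A timelike length contributes at least 1, and the other term exceeds -1. If both are spacelike,
    the failing triangle inequality must be a + b < c < PI, whence cos a > cos (PI - b) = - cos
    b. *)
Lemma cos_or_cosh_sum (a b c : R) : a <= c -> b <= c -> c < PI ->
  ~ triangular a b c -> 0 < cos_or_cosh a + cos_or_cosh b.
Proof.
  intros Ha Hb Hc HT. unfold triangular in HT.
  pose proof (cos_or_cosh_gt a ltac:(lra)) as Ga. pose proof (cos_or_cosh_gt b ltac:(lra)) as Gb.
  unfold cos_or_cosh in *. destruct (Rle_dec 0 a); destruct (Rle_dec 0 b);
    try pose proof (cosh_ge_1 a); try pose proof (cosh_ge_1 b); try lra.
  assert (Hab : a + b < c) by lra.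
  assert (cos (PI - b) < cos a) by (apply cos_lt; lra).
  rewrite <- cos_neg in H1. replace (- (PI - b)) with (b - PI) in H1 by ring.
  rewrite cos_minus, cos_PI, sin_PI in H1. lra.
Qed.

(** The construction is symmetric in the ends of one side. Choosing the side with the largest signed
    length makes the sum for the other two positive; the vertices are relabelled accordingly. *)
Lemma de_sitter_vertices (a b c : R) : a < PI -> b < PI -> c < PI ->
  ~ triangular a b c -> ~ triangular (- a) (- b) (- c) ->
  exists A B C, (dot J2 A A = 1 /\ dot J2 B B = 1 /\ dot J2 C C = 1) /\
    (0 < co2 A /\ 0 < co2 B /\ 0 < co2 C) /\
    dot J2 A B = cos_or_cosh a /\ dot J2 B C = cos_or_cosh b /\ dot J2 A C = cos_or_cosh c.
Proof.
  intros Ha Hb Hc Hp Hn. pose proof (gdet_neg a b c Ha Hb Hc Hp Hn) as HD.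
  destruct (Rle_dec a c); [destruct (Rle_dec b c)|destruct (Rle_dec b a)].
  - apply de_sitter_vectors; trivial; [apply cos_or_cosh_gt; trivial|].
    apply (cos_or_cosh_sum a b c); trivial.
  - destruct (de_sitter_vectors (cos_or_cosh a) (cos_or_cosh c) (cos_or_cosh b))
      as (A & B & C & (H1 & H2 & H3) & (H4 & H5 & H6) & H7 & H8 & H9).
    + apply cos_or_cosh_gt; trivial.
    + apply (cos_or_cosh_sum a c b); try lra. unfold triangular in *. lra.
    + rewrite <- (proj1 (proj2 (gdet_perm _ _ _))). exact HD.
    + exists B, A, C. rewrite (dot_comm J2 B A). repeat split; trivial.
  - destruct (de_sitter_vectors (cos_or_cosh c) (cos_or_cosh b) (cos_or_cosh a))
      as (A & B & C & (H1 & H2 & H3) & (H4 & H5 & H6) & H7 & H8 & H9).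
    + apply cos_or_cosh_gt; trivial.
    + apply (cos_or_cosh_sum c b a); try lra. unfold triangular in *. lra.
    + rewrite <- (proj2 (proj2 (gdet_perm _ _ _))). exact HD.
    + exists A, C, B. rewrite (dot_comm J2 C B). repeat split; trivial.
  - destruct (de_sitter_vectors (cos_or_cosh a) (cos_or_cosh c) (cos_or_cosh b))
      as (A & B & C & (H1 & H2 & H3) & (H4 & H5 & H6) & H7 & H8 & H9).
    + apply cos_or_cosh_gt; trivial.
    + apply (cos_or_cosh_sum a c b); try lra. unfold triangular in *. lra.
    + rewrite <- (proj1 (proj2 (gdet_perm _ _ _))). exact HD.
    + exists B, A, C. rewrite (dot_comm J2 B A). repeat split; trivial.
Qed.

Lemma gcos_sqr (u : R) : 0 <= u -> gcos (u * u) 1 = cos u /\ gcos (- (u * u)) 1 = cosh u.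
Proof.
  intros Hu. unfold gcos. rewrite !Rmult_1_r. split.
  - destruct (Rlt_dec 0 (u * u)); [rewrite sqrt_square by trivial; reflexivity|].
    assert (u = 0) by nra. subst u. destruct (Req_EM_T (0 * 0) 0); [symmetry; apply cos_0|lra].
  - destruct (Rlt_dec 0 (- (u * u))); [nra|]. destruct (Req_EM_T (- (u * u)) 0).
    + assert (u = 0) by nra. subst u. symmetry; apply cosh_0.
    + rewrite Ropp_involutive, sqrt_square by trivial. reflexivity.
Qed.

Lemma gcos_ssq (k l : R) : 0 < k -> gcos (k * k * ssq l) 1 = cos_or_cosh (k * l).
Proof.
  intros Hk. unfold cos_or_cosh. destruct (Rle_dec 0 (k * l)) as [H|H].
  - assert (0 <= l) by nra. rewrite ssq_pos by trivial.
    replace (k * k * (l * l)) with ((k * l) * (k * l)) by ring. apply gcos_sqr, H.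
  - assert (l < 0) by nra. rewrite ssq_neg by lra.
    replace (k * k * - (l * l)) with (- ((- (k * l)) * (- (k * l)))) by ring.
    rewrite (proj2 (gcos_sqr (- (k * l)) ltac:(lra))). apply cosh_sinh_opp.
Qed.

Lemma ssq_lt (k l : R) : 0 < k -> k * l < PI -> k * k * ssq l < PI * PI.
Proof.
  intros Hk Hl. pose proof PI_RGT_0. destruct (Rle_dec 0 l).
  - rewrite ssq_pos by trivial. replace (k * k * (l * l)) with ((k * l) * (k * l)) by ring.
    assert (0 <= k * l) by nra. nra.
  - rewrite ssq_neg by lra. assert (0 < k * k * (l * l)); [|nra].
    assert (0 < l * l) by nra. apply Rmult_lt_0_compat; nra.
Qed.

Lemma triangular_scale (k a b c : R) : 0 < k -> triangular (k * a) (k * b) (k * c) -> triangular a b c.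
Proof.
  intros Hk (H1 & H2 & H3 & H4 & H5 & H6).
  repeat split; apply (Rmult_le_reg_l k); trivial; rewrite ?Rmult_0_r, ?Rmult_plus_distr_l; trivial.
Qed.

Lemma cover_triangle (k : R) (x : triple) : 0 < k ->
  k * co1 x < PI -> k * co2 x < PI -> k * co3 x < PI ->
  ~ triangular (co1 x) (co2 x) (co3 x) -> ~ triangular (- co1 x) (- co2 x) (- co3 x) ->
  exists T, realizes (Surface plane (quadric_cover k) (-1) 1 1) T x.
Proof.
  intros Hk H1 H2 H3 Hp Hn.
  destruct (de_sitter_vertices _ _ _ H1 H2 H3) as (A & B & C & (DA & DB & DC) & (YA & YB & YC) & DAB & DBC & DAC).
  { intros H. apply Hp, (triangular_scale k); trivial. }
  { intros H. apply Hn, (triangular_scale k); trivial. rewrite <- !Ropp_mult_distr_r. exact H. }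
  set (sc := fun v => lin3 (/ k) v 0 v 0 v).
  assert (Hsc : forall v w, dot J2 (sc v) (sc w) = dot J2 v w / (k * k)).
  { intros v w. unfold sc. rewrite dot_lin3_l, !dot_lin3_r. field. lra. }
  assert (Ysc : forall v, 0 < co2 v -> 0 < co2 (sc v)).
  { intros v Hv. unfold sc, lin3. unfold co2 at 1; simpl.
    assert (0 < / k * co2 v) by (apply Rmult_lt_0_compat; trivial; apply Rinv_0_lt_compat, Hk). lra. }
  assert (E1 : 1 / (k * k) = / (k * k)) by (field; lra).
  apply (triangle_of_sides _ (cover_section k (sc A)) (cover_section k (sc B)) (cover_section k (sc C)));
    apply cover_arc_side; trivial; try (apply Ysc; trivial); try (apply ssq_lt; trivial);
    rewrite Hsc, ?gcos_ssq by trivial; congruence.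
Qed.

(** A lies on the first axis, B in the plane of the first two, and C follows by orthogonalization;
    up to the scale 1/r its last coordinate is a square root of gdet / h^2. Positivity of s (1 -
    x^2) makes A and B independent. *)
Lemma riemann_vectors (s r x y z : R) : s * s = 1 -> 0 < r -> 0 < s * (1 - x * x) -> 0 <= gdet x y z ->
  exists B C, co1 B = x / r /\ co1 C = z / r /\ let A := (1 / r, 0, 0) in
    (dot (s, 1, 1) A A = s / (r * r) /\ dot (s, 1, 1) B B = s / (r * r) /\ dot (s, 1, 1) C C = s / (r * r)) /\
    dot (s, 1, 1) A B = s * x / (r * r) /\ dot (s, 1, 1) B C = s * y / (r * r) /\
    dot (s, 1, 1) A C = s * z / (r * r).
Proof.
  intros Hs Hr Hx HD.
  set (h := sqrt (s * (1 - x * x))). assert (Hh : 0 < h) by (apply sqrt_lt_R0, Hx).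
  assert (Hhh : h * h = s * (1 - x * x)) by (apply sqrt_sqrt; lra).
  set (w := s * (y - x * z) / h).
  assert (HP : 0 <= gdet x y z / (h * h)).
  { apply Rmult_le_pos; trivial. apply Rlt_le, Rinv_0_lt_compat. nra. }
  set (v := sqrt (gdet x y z / (h * h))).
  assert (Hv : v * v = gdet x y z / (h * h)) by (apply sqrt_sqrt, HP).
  assert (Hw : h * w = s * (y - x * z)) by (unfold w; field; lra).
  assert (HC : s * z * z + w * w + v * v = s).
  { rewrite Hv. unfold w.
    transitivity (s * z * z + ((s * s) * ((y - x * z) * (y - x * z)) + gdet x y z) / (h * h)); [field; lra|].
    rewrite Hs. unfold gdet.
    replace (1 * ((y - x * z) * (y - x * z)) + (1 + 2 * x * y * z - x * x - y * y - z * z))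
      with ((1 - z * z) * (1 - x * x)) by ring.
    replace (1 - x * x) with (s * (h * h)).
    - field. lra.
    - rewrite Hhh. transitivity ((s * s) * (1 - x * x)); [ring|rewrite Hs; ring]. }
  clearbody h w v.
  exists (x / r, h / r, 0), (z / r, w / r, v / r). unfold dot, co1, co2, co3; simpl.
  repeat split.
  - field. lra.
  - transitivity ((s * (x * x) + h * h) / (r * r)); [field; lra|]. rewrite Hhh. field. lra.
  - transitivity ((s * z * z + w * w + v * v) / (r * r)); [field; lra|]. rewrite HC. reflexivity.
  - field. lra.
  - transitivity ((s * x * z + h * w) / (r * r)); [field; lra|]. rewrite Hw. field. lra.
  - field. lra.
Qed.

(** cos c lies strictly between the roots cos (a + b) and cos (a - b). If a + b > PI, the first root
    is cos (2 PI - a - b), and the perimeter bound says c < 2 PI - a - b. *)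
Lemma spherical_gdet (a b c : R) : 0 < a -> 0 < b -> 0 < c -> a < b + c -> b < a + c -> c < a + b ->
  a + b + c < 2 * PI -> 0 < gdet (cos a) (cos b) (cos c).
Proof.
  intros. rewrite gdet_cos.
  assert (cos c < cos (a - b)) by (apply cos_lt_abs; [apply Rabs_def1; lra|lra]).
  assert (cos (a + b) < cos c).
  { destruct (Rle_dec (a + b) PI); [apply cos_lt; lra|].
    replace (cos (a + b)) with (cos (2 * PI - (a + b))).
    - apply cos_lt; lra.
    - rewrite <- (cos_neg (a + b)), <- (cos_period (- (a + b)) 1). f_equal. simpl. ring. }
  nra.
Qed.

Lemma hyperbolic_gdet (a b c : R) : 0 < a -> 0 < b -> 0 < c -> a < b + c -> b < a + c -> c < a + b ->
  0 < gdet (cosh a) (cosh b) (cosh c).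
Proof.
  intros. rewrite gdet_cosh.
  assert (cosh (a - b) < cosh c).
  { apply cosh_lt_abs. rewrite (Rabs_pos_eq c) by lra. apply Rabs_def1; lra. }
  assert (cosh c < cosh (a + b)) by (apply cosh_lt; lra).
  nra.
Qed.

Section RiemannTriangle.

Variables (Q : triple -> Prop) (s K : R).
Hypothesis Hs : s * s = 1.
Hypothesis HsK : 0 < s * K.
Hypothesis HQ : forall p, Q p <-> dot (s, 1, 1) p p = / K /\ (s < 0 -> 0 < co1 p).

Lemma riemann_triangle (x : triple) : T_pos x -> (0 < K -> sqrt K * total x < 2 * PI) ->
  exists T, realizes (Surface Q (fun p => p) s 1 1) T x.
Proof.
  intros HT Htot. apply T_pos_strict in HT as ((Pa & Pb & Pc) & Ha & Hb & Hc).
  pose proof (riemann_K s K HsK) as HK. pose proof PI_RGT_0 as HPI.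
  set (r := sqrt (s * K)). assert (Hr : 0 < r) by (apply sqrt_lt_R0, HsK).
  assert (Hrr : r * r = s * K) by (apply sqrt_sqrt; lra).
  assert (HrK : s / (r * r) = / K).
  { rewrite Hrr. field. split; trivial. intros E; rewrite E in Hs; lra. }
  set (f := fun l => gcos (K * ssq l) 1).
  assert (Hf : forall l, 0 < l -> (s = 1 -> f l = cos (r * l)) /\ (s = -1 -> f l = cosh (r * l))).
  { intros l Hl. unfold f. rewrite ssq_pos by lra. split; intros E.
    - replace (K * (l * l)) with ((r * l) * (r * l)).
      + apply gcos_sqr. nra.
      + transitivity ((r * r) * (l * l)); [ring|]. rewrite Hrr, E. ring.
    - replace (K * (l * l)) with (- ((r * l) * (r * l))).
      + apply gcos_sqr. nra.
      + transitivity (- ((r * r) * (l * l))); [ring|]. rewrite Hrr, E. ring. }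
  assert (Sa : 0 < r * co1 x) by nra. assert (Sb : 0 < r * co2 x) by nra. assert (Sc : 0 < r * co3 x) by nra.
  assert (Ta : r * co1 x < r * co2 x + r * co3 x) by nra.
  assert (Tb : r * co2 x < r * co1 x + r * co3 x) by nra.
  assert (Tc : r * co3 x < r * co1 x + r * co2 x) by nra.
  assert (Hsum : s = 1 -> r * co1 x + r * co2 x + r * co3 x < 2 * PI).
  { intros E. assert (HK0 : 0 < K) by (rewrite E in HsK; lra). specialize (Htot HK0).
    unfold r, total in *. rewrite E, Rmult_1_l. lra. }
  assert (Hk : forall l, 0 < l -> (s = 1 -> r * l < PI) -> gsin (K * ssq l) 1 <> 0).
  { intros l Hl HlP. assert (K * ssq l < PI * PI); [|pose proof (gsin_pos (K * ssq l) 1); lra].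
    rewrite ssq_pos by lra. destruct (sign_cases s Hs) as [E|E].
    - specialize (HlP E). rewrite E, Rmult_1_l in Hrr. rewrite <- Hrr.
      replace (r * r * (l * l)) with ((r * l) * (r * l)) by ring. assert (0 < r * l) by nra. nra.
    - assert (K < 0) by (rewrite E in HsK; lra). assert (0 < l * l) by nra. nra. }
  destruct (Hf _ Pa) as (Fa & Fa'). destruct (Hf _ Pb) as (Fb & Fb'). destruct (Hf _ Pc) as (Fc & Fc').
  destruct (riemann_vectors s r (f (co1 x)) (f (co2 x)) (f (co3 x)) Hs Hr)
    as (B & C & B1 & C1 & (DA & DB & DC) & DAB & DBC & DAC).
  - destruct (sign_cases s Hs) as [E|E].
    + rewrite Fa, E by trivial. specialize (Hsum E).
      assert (cos (r * co1 x) < 1) by (rewrite <- cos_0; apply cos_lt; lra).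
      assert (-1 < cos (r * co1 x)) by (rewrite <- cos_PI; apply cos_lt; lra). nra.
    + rewrite Fa', E by trivial. pose proof (cosh_gt_1 (r * co1 x)). nra.
  - apply Rlt_le. destruct (sign_cases s Hs) as [E|E].
    + rewrite Fa, Fb, Fc by trivial. apply spherical_gdet; auto.
    + rewrite Fa', Fb', Fc' by trivial. apply hyperbolic_gdet; auto.
  - rewrite HrK in DA, DB, DC.
    assert (HF : forall l, s * f l / (r * r) = f l / K).
    { intros l. transitivity (f l * (s / (r * r))); [field; lra|]. rewrite HrK. reflexivity. }
    rewrite HF in DAB, DBC, DAC.
    assert (Hfp : forall l, 0 < l -> s < 0 -> 0 < f l / r).
    { intros l Hl Hs0. assert (E : s = -1) by (destruct (sign_cases s Hs); lra).
      rewrite (proj2 (Hf l Hl) E). apply Rdiv_lt_0_compat; trivial. apply cosh_pos. }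
    assert (QA : Q (1 / r, 0, 0)).
    { apply HQ. split; [exact DA|]. intros _. unfold co1; simpl. apply Rdiv_lt_0_compat; lra. }
    assert (QB : Q B) by (apply HQ; split; [exact DB|]; intros; rewrite B1; apply Hfp; trivial).
    assert (QC : Q C) by (apply HQ; split; [exact DC|]; intros; rewrite C1; apply Hfp; trivial).
    (* On the sphere twice a side is less than the perimeter, so each side is below PI / r and not
       conjugate. *)
    apply (triangle_of_sides _ (1 / r, 0, 0) B C); apply (riemann_arc_side Q s K Hs HsK HQ);
      trivial; try lra; apply Hk; trivial; intros E; specialize (Hsum E); lra.
Qed.

End RiemannTriangle.

(** * Vertices when a side may have a conjugate length *)

Section Vertices.

Variable k : R.
Hypothesis Hk : 0 < k.

Let M := Surface plane (quadric_cover k) (-1) 1 1.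

(** What is kept of a spacelike side when conjugate lengths are allowed: a lifted isometry carries
    its ends to the points 0 and [l] of the equator. *)
Definition connected (P Q : triple) (l : R) : Prop :=
  exists f f' L L', lift_pair k f f' L L' /\ f P = (0, 0, 0) /\ f Q = (0, l, 0).

Lemma dev_equator (u : R) : quadric_cover k (0, u, 0) = (0, cos (k * u) / k, sin (k * u) / k).
Proof.
  unfold quadric_cover, co1, co2; simpl. rewrite Rmult_0_r, sinh_0, cosh_0.
  coordwise; field; lra.
Qed.

Lemma lift_pair_plane (f f' L L' : triple -> triple) (P : triple) :
  lift_pair k f f' L L' -> plane P -> plane (f P).
Proof. intros Hf HP. unfold plane. rewrite (lp_plane Hf). exact HP. Qed.

(** An isometry takes the initial position and velocity to those of the equator at the origin; the
    whole side then follows the equator by [cover_path]. *)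
Lemma side_connected (P Q : triple) (l : R) : 0 < l -> side M P Q l -> connected P Q l.
Proof.
  intros Hl (g & (Hg & G0 & G1) & Lg).
  pose proof (cover_quadric_surface k Hk) as HM.
  destruct (quadric_geodesic_formula M (k * k) HM g l Hg Lg) as (V & HPV & HV & HF).
  destruct (qs_geodesic HM g Hg) as (e & He & HC).
  rewrite G0 in *. change (sig M) with J2 in *. change (dev M) with (quadric_cover k) in *.
  rewrite ssq_pos in HV, HF by lra.
  assert (HP : plane P) by (rewrite <- G0; apply HC; lra).
  assert (D0 : dot J2 (0, / k, 0) (0, / k, 0) = / (k * k)).
  { unfold J2, dot, co1, co2, co3; simpl. field. lra. }
  assert (D1 : dot J2 (0, / k, 0) (0, 0, l) = 0).
  { unfold J2, dot, co1, co2, co3; simpl. ring. }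
  assert (D2 : dot J2 (0, 0, l) (0, 0, l) = l * l).
  { unfold J2, dot, co1, co2, co3; simpl. ring. }
  pose proof (cover_quadric k Hk P) as DP.
  destruct (gram_isom_first J2 (quadric_cover k P) V V (0, / k, 0) (0, 0, l) (0, 0, l))
    as (L & L' & HL & LP & LV & _); try congruence.
  { repeat split; unfold J2, co1, co2, co3; simpl; lra. }
  { rewrite DP, HV, HPV. replace (_ - _) with ((l * l) / (k * k)) by (field; lra).
    apply Rgt_not_eq, Rdiv_lt_0_compat; nra. }
  destruct (cover_lift k Hk L L' P (0, 0, 0) HL HP eq_refl) as (f & f' & Hf & fP).
  { rewrite LP. symmetry. apply dev_origin, Hk. }
  exists f, f', L, L'. split; [exact Hf|]. split; [exact fP|].
  assert (HE : forall s, 0 <= s <= 1 -> f (g s) = (0, l * s, 0)).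
  { apply (cover_path k Hk (fun s => f (g s)) (fun s => (0, l * s, 0)) e He).
    - intros s Hs. destruct (HC s Hs) as (C1 & C2 & _). split; [apply (lift_pair_plane _ _ _ _ _ Hf), C1|].
      split; [reflexivity|]. split; [apply C1_coord_chain; trivial; apply (lp_C1 Hf)|].
      split; [|split]; unfold co1, co2, co3; simpl; auto_derive; trivial.
    - intros s Hs. rewrite (lp_dev Hf), (HF s Hs), (isom_lin (pair_isom HL)), LP, LV.
      rewrite dev_equator.
      assert (Hpos : 0 < k * k * (l * l)) by (apply Rmult_lt_0_compat; nra).
      assert (Hsq : sqrt (k * k * (l * l)) = k * l).
      { replace (k * k * (l * l)) with ((k * l) * (k * l)) by ring. apply sqrt_square. nra. }
      assert (Ec : gcos (k * k * (l * l)) s = cos (k * (l * s))).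
      { unfold gcos. destruct (Rlt_dec 0 (k * k * (l * l))); [|lra]. rewrite Hsq. f_equal; ring. }
      assert (Es : gsin (k * k * (l * l)) s = sin (k * (l * s)) / (k * l)).
      { unfold gsin. destruct (Rlt_dec 0 (k * k * (l * l))); [|lra]. rewrite Hsq. do 2 f_equal; ring. }
      rewrite Ec, Es. coordwise; field; lra.
    - rewrite G0, fP, Rmult_0_r. reflexivity. }
  rewrite <- G1, HE by lra. rewrite Rmult_1_r. reflexivity.
Qed.

Lemma connected_lift (f f' L L' : triple -> triple) (P Q : triple) (l : R) :
  lift_pair k f f' L L' -> connected P Q l -> connected (f P) (f Q) l.
Proof.
  intros Hf (g & g' & N & N' & Hg & gP & gQ).
  pose proof (lift_pair_comp Hg (lift_pair_sym Hf)) as Hc.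
  do 4 eexists. split; [exact Hc|]. cbn beta. rewrite !(lp_l Hf). split; trivial.
Qed.

Lemma flip_lift_pair (l : R) : exists f f' L L', lift_pair k f f' L L' /\
  forall u, f (0, u, 0) = (0, l - u, 0).
Proof.
  pose proof (lift_pair_comp (cover_shift_lift_pair k Hk l)
    (refl_lift_pair k Hk 1 (-1) ltac:(ring) ltac:(ring))) as Hc.
  do 4 eexists. split; [exact Hc|]. intros u. cbn beta.
  unfold cover_shift, refl_cover; coordwise; ring.
Qed.

Lemma connected_sym (P Q : triple) (l : R) : connected P Q l -> connected Q P l.
Proof.
  intros (f & f' & L & L' & Hf & fP & fQ).
  destruct (flip_lift_pair l) as (g & g' & N & N' & Hg & gu).
  pose proof (lift_pair_comp Hg Hf) as Hc.
  do 4 eexists. split; [exact Hc|]. cbn beta. rewrite fP, fQ, !gu, Rminus_0_r, Rminus_diag. split; reflexivity.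
Qed.

(** Both maps send the segment from the origin to p to curves with the same development and the same
    start. *)
Lemma lift_unique (f f' h h' L L' : triple -> triple) :
  lift_pair k f f' L L' -> lift_pair k h h' L L' -> f (0, 0, 0) = h (0, 0, 0) ->
  forall p, plane p -> f p = h p.
Proof.
  intros Hf Hh H0 p Hp.
  set (c := fun s => (s * co1 p, s * co2 p, 0) : triple).
  assert (Hc : forall s, curve_derivable c s).
  { intros s. split; [|split]; unfold c, co1, co2, co3; simpl; auto_derive; trivial. }
  assert (E0 : c 0 = (0, 0, 0)) by (unfold c; rewrite !Rmult_0_l; reflexivity).
  assert (E1 : c 1 = p).
  { unfold c. rewrite !Rmult_1_l. apply triple_eq; try reflexivity. symmetry. exact Hp. }
  rewrite <- E1.
  apply (cover_path k Hk (fun s => f (c s)) (fun s => h (c s)) 1); try lra.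
  - intros s _. split; [apply (lift_pair_plane _ _ _ _ _ Hf); reflexivity|].
    split; [apply (lift_pair_plane _ _ _ _ _ Hh); reflexivity|].
    split; apply C1_coord_chain; trivial; [apply (lp_C1 Hf)|apply (lp_C1 Hh)].
  - intros s _. rewrite (lp_dev Hf), (lp_dev Hh). reflexivity.
  - rewrite E0. exact H0.
Qed.

Lemma fixes_origin (f f' L L' : triple -> triple) : lift_pair k f f' L L' -> f (0, 0, 0) = (0, 0, 0) ->
  L (0, / k, 0) = (0, / k, 0).
Proof. intros Hf H0. rewrite <- (dev_origin k Hk), <- (lp_dev Hf), H0. reflexivity. Qed.

Lemma origin_displacement (f f' L L' : triple -> triple) :
  lift_pair k f f' L L' -> f (0, 0, 0) = (0, 0, 0) ->
  exists e, e * e = 1 /\ forall p, plane p -> Rabs (k * co2 (f p) - e * (k * co2 p)) < PI.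
Proof.
  intros Hf H0.
  destruct (origin_lift k Hk L L' (lp_isom Hf) (fixes_origin _ _ _ _ Hf H0))
    as (h & h' & Hh & h0 & e & He & Hd).
  exists e. split; [exact He|]. intros p Hp.
  rewrite (lift_unique f f' h h' L L' Hf Hh) by congruence. apply Hd.
Qed.

Lemma isom_scale_origin (L : triple -> triple) (c : R) : lin_isom J2 L ->
  L (0, c / k, 0) = lin3 c (L (0, / k, 0)) 0 (L (0, / k, 0)) 0 (L (0, / k, 0)).
Proof.
  intros HL. rewrite <- (isom_lin HL). f_equal.
  coordwise; field; lra.
Qed.

(** At a conjugate length the cosine is 1 or -1, so the developed ends agree up to sign. *)
Lemma conjugate_dev (P Q : triple) (l : R) : connected P Q l -> sin (k * l) = 0 ->
  quadric_cover k Q = lin3 (cos (k * l)) (quadric_cover k P) 0 (quadric_cover k P) 0 (quadric_cover k P).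
Proof.
  intros (f & f' & L & L' & Hf & fP & fQ) Hs.
  rewrite <- (lp_l Hf Q), <- (lp_l Hf P), fP, fQ, !(lp_dev' Hf).
  rewrite dev_equator, Hs, dev_origin by trivial. replace (0 / k) with 0 by (field; lra).
  apply isom_scale_origin, (pair_isom' (lp_isom Hf)).
Qed.

Lemma connected_dot (P Q : triple) (l : R) : connected P Q l ->
  dot J2 (quadric_cover k P) (quadric_cover k Q) = cos (k * l) / (k * k).
Proof.
  intros (f & f' & L & L' & Hf & fP & fQ).
  rewrite <- (isom_dot (pair_isom (lp_isom Hf))).
  rewrite <- !(lp_dev Hf), fP, fQ, dev_origin, dev_equator by trivial.
  unfold J2, dot, co1, co2, co3; simpl. field. lra.
Qed.

Lemma conjugate_ge_PI (l : R) : 0 < l -> sin (k * l) = 0 -> PI <= k * l.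
Proof.
  intros Hl Hs. destruct (Rle_dec PI (k * l)); [trivial|].
  pose proof (sin_gt_0 (k * l)). assert (0 < k * l) by nra. lra.
Qed.

(** The development and the displacement bound leave only the points a and - a of the equator for
    Q. *)
Lemma middle_conjugate (Q : triple) (a b : R) : 0 < a -> 0 < b -> plane Q -> sin (k * a) = 0 ->
  connected (0, 0, 0) Q a -> connected Q (0, a + b, 0) b -> Q = (0, a, 0).
Proof.
  intros Ha Hb PQ Hs H1 H2. pose proof (conjugate_ge_PI a Ha Hs) as Hpi.
  pose proof (conjugate_dev _ _ _ H1 Hs) as DQ.
  assert (HQ : exists e, e * e = 1 /\ Q = (0, e * a, 0)).
  { destruct H1 as (f & f' & L & L' & Hf & f0 & fQ).
    destruct (origin_displacement f f' L L' Hf f0) as (e & He & Hd).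
    exists e. split; [exact He|]. specialize (Hd Q PQ). rewrite fQ in Hd.
    change (co2 (0, a, 0)) with a in Hd.
    apply (cover_inj k Hk); [|exact PQ|].
    - rewrite DQ, dev_origin, dev_equator by trivial.
      assert (E : cos (k * (e * a)) = cos (k * a) /\ sin (k * (e * a)) = sin (k * a)).
      { destruct (sign_cases e He) as [-> | ->].
        - rewrite Rmult_1_l. split; reflexivity.
        - replace (k * (-1 * a)) with (- (k * a)) by ring. rewrite cos_neg, sin_neg, Hs. split; [reflexivity|ring]. }
      destruct E as (-> & ->). rewrite Hs.
      coordwise; field; lra.
    - change (co2 (0, e * a, 0)) with (e * a). pose proof PI_RGT_0.
      assert (E : k * co2 Q - k * (e * a) = - e * (k * a - e * (k * co2 Q))).
      { transitivity (e * e * (k * co2 Q) - e * (k * a)); [rewrite He; ring|ring]. }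
      rewrite E, Rabs_mult.
      assert (E1 : Rabs (- e) = 1).
      { destruct (sign_cases e He) as [-> | ->]; [rewrite Rabs_left|rewrite Rabs_right]; lra. }
      rewrite E1. lra. }
  destruct HQ as (e & He & HQ). destruct (sign_cases e He) as [-> | ->]; [rewrite HQ, Rmult_1_l; reflexivity|].
  (* From - a the third vertex is 2 a + b away along the equator, yet connected at length b. As k a
     >= PI, this exceeds what a lift fixing the origin can displace. *)
  exfalso. subst Q.
  destruct (connected_lift _ _ _ _ _ _ _ (cover_shift_lift_pair k Hk a) H2) as (f & f' & L & L' & Hf & f0 & fQ).
  assert (E0 : cover_shift a (0, -1 * a, 0) = (0, 0, 0)).
  { unfold cover_shift; coordwise; ring. }
  rewrite E0 in f0.
  destruct (origin_displacement f f' L L' Hf f0) as (e' & He' & Hd).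
  specialize (Hd (cover_shift a (0, a + b, 0)) eq_refl). rewrite fQ in Hd.
  change (co2 (0, b, 0)) with b in Hd. change (co2 (cover_shift a (0, a + b, 0))) with (a + b + a) in Hd.
  apply Rabs_def2 in Hd. assert (0 < k * b) by nra.
  destruct (sign_cases e' He') as [-> | ->]; lra.
Qed.

(** Products with the developed points 0 and a determine the development of [R0], as sin (k a) is
    nonzero. Its place in the fibre follows from a lift that fixes the equator from 0 to b
    pointwise. *)
Lemma end_nonconjugate (R0 : triple) (a b : R) : plane R0 -> sin (k * a) <> 0 -> sin (k * b) <> 0 ->
  connected (0, 0, 0) R0 (a + b) -> connected (0, a, 0) R0 b -> R0 = (0, a + b, 0).
Proof.
  intros PR Sa Sb H1 H2.
  assert (DR : quadric_cover k R0 = quadric_cover k (0, a + b, 0)).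
  { pose proof (connected_dot _ _ _ H1) as D1. pose proof (connected_dot _ _ _ H2) as D2.
    pose proof (cover_quadric k Hk R0) as DD. rewrite dev_origin in D1 by trivial. rewrite dev_equator in D2 |- *.
    destruct (quadric_cover k R0) as [[X Y] Z]. unfold J2, dot, co1, co2, co3 in D1, D2, DD; simpl in D1, D2, DD.
    set (t := k * (a + b)) in *.
    assert (Et : k * b = t - k * a) by (unfold t; ring). rewrite Et, cos_minus in D2. clear Et.
    pose proof (sin2_cos2 t) as Ht. unfold Rsqr in Ht.
    assert (EY : Y = cos t / k).
    { transitivity (k * (-1 * 0 * X + 1 * / k * Y + 1 * 0 * Z)); [field; lra|]. rewrite D1. field. lra. }
    assert (EZ : Z = sin t / k).
    { apply (Rmult_eq_reg_l (sin (k * a))); trivial.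
      transitivity (k * (-1 * 0 * X + 1 * (cos (k * a) / k) * Y + 1 * (sin (k * a) / k) * Z) - cos (k * a) * Y).
      - field. lra.
      - rewrite D2, EY. field. lra. }
    assert (EX : X = 0).
    { assert (E : X * X = 0); [|nra].
      transitivity (Y * Y + Z * Z - / (k * k)); [lra|]. rewrite EY, EZ.
      transitivity ((sin t * sin t + cos t * cos t - 1) / (k * k)); [field; lra|]. rewrite Ht. field. lra. }
    rewrite EX, EY, EZ. reflexivity. }
  destruct (connected_lift _ _ _ _ _ _ _ (cover_shift_lift_pair k Hk (- a)) H2) as (f & f' & L & L' & Hf & f0 & fR).
  assert (E0 : cover_shift (- a) (0, a, 0) = (0, 0, 0)).
  { unfold cover_shift; coordwise; ring. }
  rewrite E0 in f0. set (R1 := cover_shift (- a) R0) in *.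
  assert (D1 : quadric_cover k R1 = quadric_cover k (0, b, 0)).
  { unfold R1. rewrite cover_shift_dev, DR, <- cover_shift_dev by trivial. f_equal.
    unfold cover_shift; coordwise; ring. }
  pose proof (pair_isom' (lp_isom Hf)) as HL'.
  assert (L'0 : L' (0, / k, 0) = (0, / k, 0)).
  { rewrite <- (fixes_origin _ _ _ _ Hf f0) at 1. apply (pair_l (lp_isom Hf)). }
  assert (L'b : L' (quadric_cover k (0, b, 0)) = quadric_cover k (0, b, 0)).
  { rewrite <- fR at 1. rewrite (lp_dev Hf), (pair_l (lp_isom Hf)). exact D1. }
  (* As sin (k b) is nonzero, the fixed vectors at 0 and b span the plane of the equator. *)
  assert (L'3 : L' (0, 0, 1) = (0, 0, 1)).
  { rewrite dev_equator in L'b.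
    assert (E : (0, 0, 1) = lin3 (k / sin (k * b)) (0, cos (k * b) / k, sin (k * b) / k)
      (- k * cos (k * b) / sin (k * b)) (0, / k, 0) 0 (0, / k, 0)).
    { coordwise; field; lra. }
    rewrite E at 1. rewrite (isom_lin HL'), L'b, L'0. symmetry; exact E. }
  assert (HR : forall s, 0 <= s <= 1 -> f' (0, b * s, 0) = (0, b * s, 0)).
  { assert (Hc : forall s, curve_derivable (fun s => (0, b * s, 0)) s).
    { intros s. split; [|split]; unfold co1, co2, co3; simpl; auto_derive; trivial. }
    apply (cover_path k Hk (fun s => f' (0, b * s, 0)) (fun s => (0, b * s, 0)) 1); try lra.
    - intros s _. split; [apply (lift_pair_plane _ _ _ _ _ (lift_pair_sym Hf)); reflexivity|].
      split; [reflexivity|]. split; [|apply Hc].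
      apply (C1_coord_chain f' (fun s => (0, b * s, 0))); [apply (lp_C1' Hf)|apply Hc].
    - intros s _. rewrite (lp_dev' Hf), dev_equator.
      set (c := cos (k * (b * s))). set (d := sin (k * (b * s))).
      assert (E : (0, c / k, d / k) = lin3 c (0, / k, 0) (d / k) (0, 0, 1) 0 (0, / k, 0)).
      { coordwise; field; lra. }
      rewrite E, (isom_lin HL'), L'0, L'3. reflexivity.
    - rewrite !Rmult_0_r. transitivity (f' (f (0, 0, 0))); [rewrite f0; reflexivity|].
      apply (lp_l Hf). }
  assert (E1 : R1 = (0, b, 0)).
  { rewrite <- (lp_l Hf R1), fR. rewrite <- (Rmult_1_r b). apply HR. lra. }
  rewrite <- (lp_r (cover_shift_lift_pair k Hk a) R0). fold R1. rewrite E1.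
  unfold cover_shift; coordwise; ring.
Qed.

(** One side is moved to the equator and the third point is located: the long side if a or b is
    conjugate, with order reversed for b, and PQ if neither is. *)
Lemma three_points (P Q R0 : triple) (a b : R) : 0 < a -> 0 < b -> plane P -> plane Q -> plane R0 ->
  connected P Q a -> connected Q R0 b -> connected P R0 (a + b) ->
  exists f f' L L', lift_pair k f f' L L' /\
    f P = (0, 0, 0) /\ f Q = (0, a, 0) /\ f R0 = (0, a + b, 0).
Proof.
  intros Ha Hb PP PQ PR HPQ HQR HPR.
  destruct (Req_dec (sin (k * a)) 0) as [Sa|Sa]; [|destruct (Req_dec (sin (k * b)) 0) as [Sb|Sb]].
  - destruct HPR as (f & f' & L & L' & Hf & fP & fR).
    exists f, f', L, L'. repeat (split; trivial).
    apply (middle_conjugate _ a b); trivial.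
    + apply (lift_pair_plane _ _ _ _ _ Hf PQ).
    + rewrite <- fP. apply (connected_lift _ _ _ _ _ _ _ Hf HPQ).
    + rewrite <- fR. apply (connected_lift _ _ _ _ _ _ _ Hf HQR).
  - apply connected_sym in HPR. apply connected_sym in HPQ. apply connected_sym in HQR.
    destruct HPR as (f & f' & L & L' & Hf & fR & fP).
    assert (fQ : f Q = (0, b, 0)).
    { apply (middle_conjugate _ b a); trivial.
      + apply (lift_pair_plane _ _ _ _ _ Hf PQ).
      + rewrite <- fR. apply (connected_lift _ _ _ _ _ _ _ Hf HQR).
      + rewrite Rplus_comm, <- fP. apply (connected_lift _ _ _ _ _ _ _ Hf HPQ). }
    destruct (flip_lift_pair (a + b)) as (g & g' & N & N' & Hg & gu).
    pose proof (lift_pair_comp Hg Hf) as Hc.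
    do 4 eexists. split; [exact Hc|]. cbn beta. rewrite fP, fQ, fR, !gu.
    rewrite Rminus_diag, Rminus_0_r. replace (a + b - b) with a by ring. repeat split; reflexivity.
  - destruct HPQ as (f & f' & L & L' & Hf & fP & fQ).
    exists f, f', L, L'. repeat (split; trivial).
    apply end_nonconjugate; trivial.
    + apply (lift_pair_plane _ _ _ _ _ Hf PR).
    + rewrite <- fP. apply (connected_lift _ _ _ _ _ _ _ Hf HPR).
    + rewrite <- fQ. apply (connected_lift _ _ _ _ _ _ _ Hf HQR).
Qed.

(** This serves degenerate triples with a zero entry. The null velocity W is orthogonal to the
    developments of S and P, which at a nonconjugate length span a positive definite plane, so W =
    0. At a conjugate length P and Q have the same development, and again W = 0. *)
Lemma null_side_trivial (S P Q : triple) (l : R) : connected S P l -> connected S Q l -> side M P Q 0 -> P = Q.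
Proof.
  intros HP HQ (g & (Hg & G0 & G1) & Lg).
  pose proof (cover_quadric_surface k Hk) as HM.
  destruct (quadric_geodesic_formula M (k * k) HM g 0 Hg Lg) as (W & HPW & HW & HF).
  destruct (qs_geodesic HM g Hg) as (e & He & HC).
  rewrite G0 in *. change (sig M) with J2 in *. change (dev M) with (quadric_cover k) in *.
  rewrite ssq_pos, Rmult_0_l in HW, HF by lra. rewrite Rmult_0_r in HF.
  assert (HF' : forall s, 0 <= s <= 1 -> quadric_cover k (g s) = lin3 1 (quadric_cover k P) s W 0 (quadric_cover k P)).
  { intros s Hs. rewrite (HF s Hs). destruct (gcos_gsin_zero s) as (-> & ->). reflexivity. }
  assert (DQ : quadric_cover k Q = lin3 1 (quadric_cover k P) 1 W 0 (quadric_cover k P)).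
  { rewrite <- G1. apply HF'. lra. }
  assert (W0 : W = (0, 0, 0)).
  { destruct (Req_dec (sin (k * l)) 0) as [Hs|Hs].
    - rewrite (conjugate_dev _ _ _ HP Hs), (conjugate_dev _ _ _ HQ Hs) in DQ.
      set (U := lin3 _ _ _ _ _ _) in DQ at 1. fold U in DQ. clearbody U. clear - DQ.
      destruct U as [[u1 u2] u3], W as [[w1 w2] w3].
      unfold lin3, co1, co2, co3 in DQ; simpl in DQ. injection DQ as E1 E2 E3.
      coordwise; lra.
    - pose proof (connected_dot _ _ _ HQ) as D. rewrite DQ, dot_lin3_r, (connected_dot _ _ _ HP) in D.
      destruct HP as (f & f' & L & L' & Hf & fS & fP).
      pose proof (pair_isom (lp_isom Hf)) as HL.
      rewrite <- (isom_dot HL) in HW, HPW. rewrite <- (isom_dot HL _ W) in D.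
      rewrite <- (lp_dev Hf), fP, dev_equator in HPW.
      rewrite <- (lp_dev Hf), fS, dev_origin in D by trivial.
      rewrite <- (pair_l (lp_isom Hf) W).
      assert (E : L W = (0, 0, 0)).
      { destruct (L W) as [[w1 w2] w3]. unfold J2, dot, co1, co2, co3 in HW, HPW, D; simpl in HW, HPW, D.
        assert (E2 : w2 = 0).
        { apply (Rmult_eq_reg_l (/ k)); [lra|apply Rinv_neq_0_compat; lra]. }
        subst w2. assert (E3 : w3 = 0).
        { apply (Rmult_eq_reg_l (sin (k * l) / k)); [lra|].
          apply Rmult_integral_contrapositive_currified; trivial. apply Rinv_neq_0_compat; lra. }
        subst w3. assert (E1 : w1 = 0) by nra. subst w1. reflexivity. }
      rewrite E.
      assert (HL' : lin_isom J2 L') by apply (pair_isom' (lp_isom Hf)).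
      rewrite (isom_matrix _ _ (0, 0, 0) HL').
      coordwise; ring. }
  subst W. rewrite <- G1. symmetry.
  apply (cover_path k Hk g (fun _ => P) e He).
  - intros s Hs. destruct (HC s Hs) as (C1 & C2 & _). split; [exact C1|].
    split; [rewrite <- G0; apply HC; lra|]. split; [exact C2|].
    apply (has_vel_derivable _ _ _ (has_vel_const P s)).
  - intros s Hs. rewrite (HF' s Hs). clear.
    destruct (quadric_cover k P) as [[u1 u2] u3].
    coordwise; ring.
  - exact G0.
  - lra.
Qed.

(** The order of the vertices on the line varies with the triple, so the direction of sides is
    forgotten. *)
Definition linked (P Q : triple) (l : R) : Prop := side M P Q l \/ side M Q P l.

Lemma linked_sym (P Q : triple) (l : R) : linked P Q l -> linked Q P l.
Proof. unfold linked; tauto. Qed.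

Lemma linked_connected (P Q : triple) (l : R) : 0 < l -> linked P Q l -> connected P Q l.
Proof.
  intros Hl [H|H]; [apply side_connected; trivial|apply connected_sym, side_connected; trivial].
Qed.

Lemma linked_null (S P Q : triple) (l : R) : connected S P l -> connected S Q l -> linked P Q 0 -> P = Q.
Proof.
  intros HP HQ [H|H]; [apply (null_side_trivial S P Q l)|symmetry; apply (null_side_trivial S Q P l)]; trivial.
Qed.

Lemma linked_plane (P Q : triple) (l : R) : linked P Q l -> plane P /\ plane Q.
Proof.
  assert (H : forall P Q, side M P Q l -> plane P /\ plane Q).
  { clear P Q. intros P Q (g & Hg & _).
    apply (geodesic_carrier M (k * k) (cover_quadric_surface k Hk) g P Q Hg). }
  intros [H1|H1]; apply H in H1; tauto.
Qed.

Lemma three_linked_points (P Q R0 : triple) (a b : R) : 0 <= a -> 0 <= b -> 0 < a + b ->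
  linked P Q a -> linked Q R0 b -> linked P R0 (a + b) ->
  exists f f' L L', lift_pair k f f' L L' /\
    f P = (0, 0, 0) /\ f Q = (0, a, 0) /\ f R0 = (0, a + b, 0).
Proof.
  intros Ha Hb Hab HPQ HQR HPR.
  destruct (linked_plane _ _ _ HPR) as (PP & PR). destruct (linked_plane _ _ _ HPQ) as (_ & PQ).
  pose proof (linked_connected _ _ _ Hab HPR) as CPR.
  destruct (Req_dec a 0) as [->|Ha0]; [|destruct (Req_dec b 0) as [->|Hb0]].
  - rewrite Rplus_0_l in *.
    assert (E : P = Q).
    { apply (linked_null R0 P Q b); trivial; apply connected_sym; trivial.
      apply linked_connected; trivial. }
    subst Q. destruct CPR as (f & f' & L & L' & Hf & fP & fR). exists f, f', L, L'. auto.
  - rewrite Rplus_0_r in *.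
    assert (E : Q = R0).
    { apply (linked_null P Q R0 a); trivial. apply linked_connected; trivial. }
    subst Q. destruct CPR as (f & f' & L & L' & Hf & fP & fR). exists f, f', L, L'. auto.
  - apply three_points; trivial; try lra; apply linked_connected; trivial; lra.
Qed.

(** [b] and [c] are chosen before the triangle, so any two triangles with these sidelengths share
    one normal form. *)
Lemma triangle_normal_form (x : triple) : D_pos x ->
  exists b c, forall T, realizes M T x -> exists f f' L L', lift_pair k f f' L L' /\
    f (vA T) = (0, 0, 0) /\ f (vB T) = (0, b, 0) /\ f (vC T) = (0, c, 0).
Proof.
  intros (Hx & H1 & H2 & H3 & HD).
  assert (Hpos : 0 < co1 x \/ 0 < co2 x \/ 0 < co3 x).
  { destruct (Req_dec (co1 x) 0); [|lra]. destruct (Req_dec (co2 x) 0); [|lra].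
    destruct (Req_dec (co3 x) 0); [|lra]. exfalso. apply Hx, triple_eq; trivial. }
  assert (HS : forall T, realizes M T x ->
    linked (vA T) (vB T) (co1 x) /\ linked (vB T) (vC T) (co2 x) /\ linked (vA T) (vC T) (co3 x)).
  { intros T ((J1 & J2' & J3) & L1 & L2 & L3). repeat split; left; eexists; split; eassumption. }
  destruct HD as [E|[E|E]].
  - exists (co1 x), (co3 x). intros T HT. destruct (HS T HT) as (LAB & LBC & LAC).
    destruct (three_linked_points (vA T) (vC T) (vB T) (co3 x) (co2 x)) as (f & f' & L & L' & Hf & fA & fC & fB);
      trivial; try lra.
    + apply linked_sym, LBC.
    + replace (co3 x + co2 x) with (co1 x) by lra. exact LAB.
    + exists f, f', L, L'. split; trivial. split; trivial. split; trivial.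
      rewrite fB. f_equal. f_equal. lra.
  - exists (- co1 x), (co3 x). intros T HT. destruct (HS T HT) as (LAB & LBC & LAC).
    destruct (three_linked_points (vB T) (vA T) (vC T) (co1 x) (co3 x)) as (f & f' & L & L' & Hf & fB & fA & fC);
      trivial; try lra.
    + apply linked_sym, LAB.
    + rewrite <- E. exact LBC.
    (* Here A is the middle point; the shift returns it to the origin. *)
    + pose proof (lift_pair_comp (cover_shift_lift_pair k Hk (- co1 x)) Hf) as Hc.
      do 4 eexists. split; [exact Hc|]. cbn beta. rewrite fA, fB, fC.
      repeat split; apply triple_eq; unfold cover_shift; unfold co1 at 1, co2 at 1, co3 at 1; simpl;
        try reflexivity; unfold co1, co2, co3; simpl; ring.
  - exists (co1 x), (co3 x). intros T HT. destruct (HS T HT) as (LAB & LBC & LAC).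
    destruct (three_linked_points (vA T) (vB T) (vC T) (co1 x) (co2 x)) as (f & f' & L & L' & Hf & fA & fB & fC);
      trivial; try lra.
    + rewrite <- E. exact LAC.
    + exists f, f', L, L'. rewrite E. auto.
Qed.

Lemma cover_unique_vertices (x : triple) (T T' : geodesic_triangle) : D_pos x ->
  realizes M T x -> realizes M T' x -> exists f, isometry M f /\ maps_vertices f T T'.
Proof.
  intros Hx HT HT'. destruct (triangle_normal_form x Hx) as (b & c & H).
  destruct (H T HT) as (f & f' & L & L' & Hf & fA & fB & fC).
  destruct (H T' HT') as (g & g' & N & N' & Hg & gA & gB & gC).
  pose proof (lift_pair_comp (lift_pair_sym Hg) Hf) as Hc.
  eexists. split; [apply (li_isometry (lift_pair_isometry k _ _ _ _ Hc))|].
  unfold maps_vertices. cbn beta. rewrite fA, fB, fC, <- gA, <- gB, <- gC.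
  rewrite !(lp_l Hg). auto.
Qed.

End Vertices.

(** * The model spaces *)

Lemma form_switch (M : surface) (v w : triple) : form (switch_sign M) v w = - form M v w.
Proof. unfold form, switch_sign; simpl. ring. Qed.

Lemma geodesic_switch (M : surface) (g : R -> triple) : geodesic (switch_sign M) g <-> geodesic M g.
Proof.
  split; intros (e & He & H); exists e; (split; [trivial|]); intros s Hs;
  destruct (H s Hs) as (C & D1 & D2 & HT); (split; [exact C|]); (split; [exact D1|]); (split; [exact D2|]);
  intros c Hc Hc0 Hcd; specialize (HT c Hc Hc0 Hcd);
  rewrite form_switch in *.
  - apply Ropp_eq_0_compat in HT. rewrite Ropp_involutive in HT. exact HT.
  - change (dvel (switch_sign M)) with (dvel M). rewrite HT. ring.
Qed.

Lemma signed_length_switch (M : surface) (g : R -> triple) (l : R) :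
  signed_length (switch_sign M) g = l <-> signed_length M g = - l.
Proof.
  unfold signed_length. cbv zeta. rewrite !signed_sqrt_ssq, form_switch, ssq_opp.
  change (dvel (switch_sign M)) with (dvel M). split; intros; lra.
Qed.

Lemma realizes_switch (M : surface) (T : geodesic_triangle) (x : triple) :
  realizes (switch_sign M) T x <-> realizes M T (topp x).
Proof.
  unfold realizes, is_triangle, joins. rewrite !geodesic_switch, !signed_length_switch.
  reflexivity.
Qed.

Lemma isometry_switch (M : surface) (f : triple -> triple) : isometry M f -> isometry (switch_sign M) f.
Proof.
  intros (H1 & H2 & H3). split; [exact H1|]. split; [exact H2|].
  intros c s Hc Hd. rewrite !form_switch. f_equal. apply H3; trivial.
Qed.

Lemma uniquely_realized_switch (M : surface) (x : triple) :
  uniquely_realized M (topp x) -> uniquely_realized (switch_sign M) x.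
Proof.
  intros ((T & HT) & HU). split.
  - exists T. apply realizes_switch, HT.
  - intros T1 T2 H1 H2. apply realizes_switch in H1, H2. destruct (HU T1 T2 H1 H2) as (f & Hf & HM).
    exists f. split; trivial. apply isometry_switch, Hf.
Qed.

Lemma uniquely_realized_vertices_switch (M : surface) (x : triple) :
  uniquely_realized_vertices M (topp x) -> uniquely_realized_vertices (switch_sign M) x.
Proof.
  intros ((T & HT) & HU). split.
  - exists T. apply realizes_switch, HT.
  - intros T1 T2 H1 H2. apply realizes_switch in H1, H2. destruct (HU T1 T2 H1 H2) as (f & Hf & HM).
    exists f. split; trivial. apply isometry_switch, Hf.
Qed.

Lemma uniquely_realized_weaken (M : surface) (x : triple) :
  uniquely_realized M x -> uniquely_realized_vertices M x.
Proof.
  intros (HT & HU). split; [exact HT|]. intros T T' H H'. destruct (HU T T' H H') as (f & Hf & Hv & _).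
  exists f. auto.
Qed.

Lemma lorentz_model_neg (K : R) : K < 0 -> lorentz_model K = switch_sign (lorentz_model (- K)).
Proof.
  intros HK. rewrite (lorentz_model_pos (- K)) by lra. unfold lorentz_model, switch_sign; simpl.
  destruct (Req_EM_T K 0); [lra|]. destruct (Rlt_dec 0 K); [lra|]. f_equal; ring.
Qed.

Lemma model_zero : riemann_model 0 = Surface plane (fun p => p) 1 1 1 /\
  lorentz_model 0 = Surface plane (fun p => p) (-1) 1 1.
Proof. unfold riemann_model, lorentz_model. destruct (Req_EM_T 0 0); [auto|lra]. Qed.

Lemma plane_uniquely_realized (s : R) (x : triple) : s * s = 1 -> x <> tzero ->
  (exists T, realizes (Surface plane (fun p => p) s 1 1) T x) ->
  uniquely_realized (Surface plane (fun p => p) s 1 1) x.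
Proof. intros Hs Hx HT. split; trivial. intros T T'. apply plane_unique; trivial. Qed.

Definition no_conjugate (K : R) (x : triple) : Prop :=
  gsin (K * ssq (co1 x)) 1 <> 0 /\ gsin (K * ssq (co2 x)) 1 <> 0 /\ gsin (K * ssq (co3 x)) 1 <> 0.

Lemma quadric_uniquely_realized (M : surface) (K : R) (x : triple) : quadric_surface M K -> x <> tzero ->
  no_conjugate K x -> (exists T, realizes M T x) -> uniquely_realized M x.
Proof.
  intros HM Hx (H1 & H2 & H3) HT. split; trivial.
  intros T T'. apply (quadric_unique M K HM); trivial.
Qed.

(** The bound by PI / sqrt K in multiplied form, vacuous unless K is positive. *)
Definition scaled_lt_PI (K : R) (x : triple) : Prop :=
  0 < K -> sqrt K * co1 x < PI /\ sqrt K * co2 x < PI /\ sqrt K * co3 x < PI.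

(** A side can be conjugate only if K and its length have the same strict sign. For K > 0 the bound
    excludes this, for K < 0 the signs do. *)
Lemma scaled_no_conjugate (K : R) (x : triple) : scaled_lt_PI K x ->
  (K < 0 -> 0 <= co1 x /\ 0 <= co2 x /\ 0 <= co3 x) -> no_conjugate K x.
Proof.
  intros HP HN.
  assert (H : forall l, (0 < K -> sqrt K * l < PI) -> (K < 0 -> 0 <= l) -> gsin (K * ssq l) 1 <> 0).
  { intros l H1 H2. assert (K * ssq l < PI * PI); [|pose proof (gsin_pos (K * ssq l) 1); lra].
    pose proof PI_RGT_0. destruct (total_order_T K 0) as [[H0|H0]|H0].
    - rewrite ssq_pos by auto. assert (0 <= l * l) by nra. nra.
    - rewrite H0, Rmult_0_l. nra.
    - rewrite <- (sqrt_sqrt K) by lra. apply ssq_lt; auto. apply sqrt_lt_R0, H0. }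
  split; [|split]; apply H; intros; try apply HP; try apply HN; trivial.
Qed.

Lemma topp_topp (x : triple) : topp (topp x) = x.
Proof.
  destruct x as [[a b] c]. unfold topp. coordwise; ring.
Qed.

Lemma topp_nonzero (x : triple) : x <> tzero -> topp x <> tzero.
Proof.
  intros Hx E. apply Hx. rewrite <- (topp_topp x), E.
  unfold topp, tzero. coordwise; ring.
Qed.

(** * Length bounds in the extended reals *)

Lemma largest_bound (K : R) (x : triple) : Rbar_lt (largest x) (pi_over_sqrt K) -> scaled_lt_PI K x.
Proof.
  unfold scaled_lt_PI, pi_over_sqrt. intros H HK. destruct (Rlt_dec 0 K); [|lra]. simpl in H.
  pose proof (sqrt_lt_R0 K HK) as Hr.
  assert (E : forall l, l <= largest x -> sqrt K * l < PI).
  { intros l Hl. apply (Rmult_lt_reg_r (/ sqrt K)); [apply Rinv_0_lt_compat, Hr|].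
    replace (sqrt K * l * / sqrt K) with l by (field; lra). unfold Rdiv in H. lra. }
  unfold largest in E.
  pose proof (Rmax_l (Rmax (co1 x) (co2 x)) (co3 x)). pose proof (Rmax_r (Rmax (co1 x) (co2 x)) (co3 x)).
  pose proof (Rmax_l (co1 x) (co2 x)). pose proof (Rmax_r (co1 x) (co2 x)).
  repeat split; apply E; lra.
Qed.

Lemma smallest_bound (K : R) (x : triple) :
  Rbar_lt (Rbar_opp (pi_over_sqrt K)) (smallest x) -> scaled_lt_PI K (topp x).
Proof.
  intros H. apply largest_bound.
  assert (E : largest (topp x) = - smallest x).
  { unfold largest, smallest, topp. change (Rmax (Rmax (- co1 x) (- co2 x)) (- co3 x) = - Rmin (Rmin (co1 x) (co2 x)) (co3 x)).
    rewrite <- !Ropp_Rmin. reflexivity. }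
  rewrite E. unfold pi_over_sqrt in *. destruct (Rlt_dec 0 K); simpl in *; [lra|trivial].
Qed.

Lemma total_bound (K : R) (x : triple) :
  Rbar_lt (total x) (Rbar_mult 2 (pi_over_sqrt K)) -> 0 < K -> sqrt K * total x < 2 * PI.
Proof.
  unfold pi_over_sqrt. intros H HK. destruct (Rlt_dec 0 K); [|lra]. simpl in H.
  pose proof (sqrt_lt_R0 K HK) as Hr.
  apply (Rmult_lt_reg_r (/ sqrt K)); [apply Rinv_0_lt_compat, Hr|].
  replace (sqrt K * total x * / sqrt K) with (total x) by (field; lra). unfold Rdiv in H. lra.
Qed.

Lemma total_bound_neg (K : R) (x : triple) :
  Rbar_lt (Rbar_opp (Rbar_mult 2 (pi_over_sqrt K))) (total x) -> 0 < K -> sqrt K * total (topp x) < 2 * PI.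
Proof.
  unfold pi_over_sqrt. intros H HK. destruct (Rlt_dec 0 K); [|lra]. simpl in H.
  pose proof (sqrt_lt_R0 K HK) as Hr.
  assert (E : total (topp x) = - total x) by (unfold total, topp, co1, co2, co3; simpl; ring).
  rewrite E. apply (Rmult_lt_reg_r (/ sqrt K)); [apply Rinv_0_lt_compat, Hr|].
  replace (sqrt K * - total x * / sqrt K) with (- total x) by (field; lra). unfold Rdiv in H. lra.
Qed.

(** By the triangle inequality twice a side is less than the perimeter. *)
Lemma T_pos_scaled (K : R) (x : triple) : T_pos x -> (0 < K -> sqrt K * total x < 2 * PI) ->
  scaled_lt_PI K x.
Proof.
  intros HT H HK. specialize (H HK). apply T_pos_strict in HT. pose proof (sqrt_lt_R0 K HK). unfold total in H.
  repeat split; nra.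
Qed.

(** * Unique realization case by case *)

Lemma riemann_T_pos (K : R) (x : triple) : x <> tzero -> T_pos x ->
  (0 < K -> sqrt K * total x < 2 * PI) -> uniquely_realized (riemann_model K) x.
Proof.
  intros Hx HT Htot. destruct (Req_dec K 0) as [->|HK].
  - rewrite (proj1 model_zero). apply plane_uniquely_realized; trivial; [ring|].
    apply T_pos_strict in HT as ((P1 & P2 & P3) & H1 & H2 & H3).
    apply plane_triangle; [ring|]. left. rewrite !ssq_pos by lra. split; [nra|].
    rewrite Rmult_1_l. apply Rlt_le, heron_pos; trivial.
  - destruct (riemann_model_form K HK) as (Q & s & -> & Hs & HsK & HQ).
    apply (quadric_uniquely_realized _ K); trivial.
    + apply riemann_quadric_surface; trivial.
    + apply scaled_no_conjugate; [apply T_pos_scaled; trivial|].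
      intros _. apply T_pos_strict in HT. lra.
    + apply (riemann_triangle Q s K); trivial.
Qed.

Lemma riemann_D_pos (K : R) (x : triple) : D_pos x -> scaled_lt_PI K x ->
  uniquely_realized (riemann_model K) x.
Proof.
  intros HD HP. pose proof (proj1 HD) as Hx. destruct (Req_dec K 0) as [->|HK].
  - rewrite (proj1 model_zero). apply plane_uniquely_realized; trivial; [ring|].
    apply (line_triangle _ (fun u => (0, u, 0))); trivial. apply plane_line_sides.
  - destruct (riemann_model_form K HK) as (Q & s & -> & Hs & HsK & HQ).
    apply (quadric_uniquely_realized _ K); trivial.
    + apply riemann_quadric_surface; trivial.
    + apply scaled_no_conjugate; [trivial|]. intros _. destruct HD as (_ & H1 & H2 & H3 & _). auto.
    + destruct (riemann_line_side Q s K Hs HsK HQ) as (eta & H). apply (line_triangle _ eta); trivial.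
Qed.

Lemma de_sitter_exists (K : R) (x : triple) : 0 < K -> D_pos x \/ D_neg x ->
  exists T, realizes (lorentz_model K) T x.
Proof.
  intros HK HD. rewrite lorentz_model_pos by trivial. pose proof (sqrt_lt_R0 K HK) as Hr.
  destruct HD as [HD|HD].
  - apply (line_triangle _ (fun u => (0, u, 0))); trivial. apply cover_spacelike_side, Hr.
  - apply (line_triangle_neg _ (fun u => (u, 0, 0))); trivial. apply cover_timelike_side, Hr.
Qed.

Lemma minkowski_degenerate (x : triple) : x <> tzero -> D_pos x \/ D_neg x ->
  uniquely_realized (lorentz_model 0) x.
Proof.
  intros Hx HD. rewrite (proj2 model_zero). apply plane_uniquely_realized; trivial; [ring|].
  destruct HD as [HD|HD].
  - apply (line_triangle _ (fun u => (0, u, 0))); trivial. apply plane_line_sides.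
  - apply (line_triangle_neg _ (fun u => (u, 0, 0))); trivial. apply plane_line_sides. reflexivity.
Qed.

Lemma de_sitter_D_pos (K : R) (x : triple) : 0 < K -> D_pos x -> no_conjugate K x ->
  uniquely_realized (lorentz_model K) x.
Proof.
  intros HK HD HP. apply (quadric_uniquely_realized _ K); trivial.
  - apply lorentz_model_quadric, HK.
  - apply HD.
  - apply de_sitter_exists; auto.
Qed.

Lemma de_sitter_D_neg (K : R) (x : triple) : 0 < K -> x <> tzero -> D_neg x ->
  uniquely_realized (lorentz_model K) x.
Proof.
  intros HK Hx HD. apply (quadric_uniquely_realized _ K); trivial.
  - apply lorentz_model_quadric, HK.
  - apply scaled_no_conjugate; [|lra]. intros _. pose proof (sqrt_lt_R0 K HK). pose proof PI_RGT_0.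
    destruct HD as (_ & H1 & H2 & H3 & _). unfold topp, co1, co2, co3 in H1, H2, H3; simpl in H1, H2, H3.
    unfold co1, co2, co3. repeat split; nra.
  - apply de_sitter_exists; auto.
Qed.

Lemma de_sitter_vertices_D_pos (K : R) (x : triple) : 0 < K -> D_pos x ->
  uniquely_realized_vertices (lorentz_model K) x.
Proof.
  intros HK HD. split; [apply de_sitter_exists; auto|].
  rewrite lorentz_model_pos by trivial. intros T T'.
  apply cover_unique_vertices; trivial. apply sqrt_lt_R0, HK.
Qed.

Lemma D_neg_topp (x : triple) : D_pos x -> D_neg (topp x).
Proof. intros H. unfold D_neg. rewrite topp_topp. exact H. Qed.

Lemma lorentz_D_pos (K : R) (x : triple) : D_pos x -> scaled_lt_PI K x ->
  uniquely_realized (lorentz_model K) x.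
Proof.
  intros HD HP. pose proof (proj1 HD) as Hx. destruct (total_order_T K 0) as [[HK|HK]|HK].
  - rewrite lorentz_model_neg by trivial. apply uniquely_realized_switch.
    apply de_sitter_D_neg; [lra|apply topp_nonzero, Hx|apply D_neg_topp, HD].
  - subst K. apply minkowski_degenerate; auto.
  - apply de_sitter_D_pos; trivial. apply scaled_no_conjugate; [trivial|lra].
Qed.

(** A zero of [gsin] would give sqrt (- K) * (- l) = n PI, one of the excluded lengths. *)
Lemma no_conjugate_of_timelike (K : R) (x : triple) : K < 0 -> D_neg x ->
  no_conjugate_timelike_side K x -> no_conjugate (- K) (topp x).
Proof.
  intros HK (_ & H1 & H2 & H3 & _) HN.
  assert (HK' : 0 < - K) by lra. pose proof (sqrt_lt_R0 _ HK') as Hr.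
  assert (E : forall l, 0 <= - l -> (forall n : nat, (0 < n)%nat -> l <> - (INR n * (PI / sqrt (- K)))) ->
    gsin (- K * ssq (- l)) 1 <> 0).
  { intros l Hl Hn HS. destruct (gsin_eq_0 _ HS) as (_ & n & Hn0 & HE).
    apply (Hn n Hn0). rewrite ssq_pos in HE by trivial.
    rewrite <- (sqrt_sqrt (- K)) in HE at 1 by lra.
    replace (sqrt (- K) * sqrt (- K) * (- l * - l)) with ((sqrt (- K) * - l) * (sqrt (- K) * - l)) in HE by ring.
    rewrite sqrt_square in HE by nra.
    replace (INR n * (PI / sqrt (- K))) with (INR n * PI / sqrt (- K)) by (field; lra).
    rewrite <- HE. field. lra. }
  split; [|split]; apply E; trivial; intros n Hn; apply (HN HK n Hn).
Qed.

(** Timelike sides can be conjugate only for K < 0; there the two conclusions have separate proofs,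
    while for K >= 0 the first follows from the second. *)
Lemma lorentz_D_neg (K : R) (x : triple) : x <> tzero -> D_neg x ->
  uniquely_realized_vertices (lorentz_model K) x /\
  (no_conjugate_timelike_side K x -> uniquely_realized (lorentz_model K) x).
Proof.
  intros Hx HD. destruct (total_order_T K 0) as [[HK|HK]|HK].
  - rewrite lorentz_model_neg by trivial. split.
    + apply uniquely_realized_vertices_switch, de_sitter_vertices_D_pos; [lra|exact HD].
    + intros HN. apply uniquely_realized_switch, de_sitter_D_pos; [lra|exact HD|].
      apply no_conjugate_of_timelike; trivial.
  - subst K. pose proof (minkowski_degenerate x Hx (or_intror HD)) as H.
    split; [apply uniquely_realized_weaken|]; trivial.
  - pose proof (de_sitter_D_neg K x HK Hx HD) as H.
    split; [apply uniquely_realized_weaken|]; trivial.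
Qed.

Lemma minkowski_generic (x : triple) : x <> tzero ->
  ~ triangular (co1 x) (co2 x) (co3 x) -> ~ triangular (- co1 x) (- co2 x) (- co3 x) ->
  uniquely_realized (lorentz_model 0) x.
Proof.
  intros Hx Hp Hn. rewrite (proj2 model_zero). apply plane_uniquely_realized; trivial; [ring|].
  apply plane_triangle; [ring|]. right. split; [reflexivity|]. apply signed_heron_neg; trivial.
Qed.

Lemma de_sitter_generic (K : R) (x : triple) : x <> tzero -> 0 < K ->
  ~ triangular (co1 x) (co2 x) (co3 x) -> ~ triangular (- co1 x) (- co2 x) (- co3 x) ->
  scaled_lt_PI K x -> uniquely_realized (lorentz_model K) x.
Proof.
  intros Hx HK Hp Hn HP. apply (quadric_uniquely_realized _ K); trivial.
  - apply lorentz_model_quadric, HK.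
  - apply scaled_no_conjugate; [trivial|lra].
  - rewrite lorentz_model_pos by trivial. destruct (HP HK) as (H1 & H2 & H3).
    apply cover_triangle; trivial. apply sqrt_lt_R0, HK.
Qed.

Theorem lemma2p1 (K : R) (x : triple) (hx : x <> tzero) :
  (T_pos x ->
     Rbar_lt (total x) (Rbar_mult 2 (pi_over_sqrt K)) ->
     uniquely_realized (riemann_model K) x) /\
  (T_neg x ->
     Rbar_lt (Rbar_opp (Rbar_mult 2 (pi_over_sqrt K))) (total x) ->
     uniquely_realized (switch_sign (riemann_model K)) x) /\
  (D_pos x ->
     Rbar_lt (largest x) (pi_over_sqrt K) ->
     uniquely_realized (riemann_model K) x /\ uniquely_realized (lorentz_model K) x) /\
  (D_neg x ->
     Rbar_lt (Rbar_opp (pi_over_sqrt K)) (smallest x) ->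
     uniquely_realized (switch_sign (riemann_model K)) x /\
     uniquely_realized_vertices (lorentz_model K) x /\
     (no_conjugate_timelike_side K x -> uniquely_realized (lorentz_model K) x)) /\
  (~ T_pos x -> ~ T_neg x -> ~ D_pos x -> ~ D_neg x ->
     uniquely_realized (lorentz_model 0) x /\
     (0 < K -> Rbar_lt (largest x) (pi_over_sqrt K) ->
        uniquely_realized (lorentz_model K) x) /\
     (K < 0 -> Rbar_lt (Rbar_opp (pi_over_sqrt (- K))) (smallest x) ->
        uniquely_realized (lorentz_model K) x)).
Proof.
  split; [|split; [|split; [|split]]].
  - intros HT H. apply riemann_T_pos; trivial. apply total_bound, H.
  - intros HT H. apply uniquely_realized_switch, riemann_T_pos; trivial.
    + apply topp_nonzero, hx.
    + apply total_bound_neg, H.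
  - intros HD H. apply largest_bound in H. split; [apply riemann_D_pos|apply lorentz_D_pos]; trivial.
  - intros HD H. apply smallest_bound in H. split.
    + apply uniquely_realized_switch, riemann_D_pos; trivial.
    + apply lorentz_D_neg; trivial.
  - intros HTp HTn HDp HDn.
    (* Outside T^+, T^-, D^+, D^- and the origin, neither x nor - x is [triangular]. *)
    pose proof (not_triangular x hx HTp HDp) as Hp.
    pose proof (not_triangular (topp x) (topp_nonzero x hx) HTn HDn) as Hn.
    change (~ triangular (- co1 x) (- co2 x) (- co3 x)) in Hn.
    split; [apply minkowski_generic; trivial|]. split.
    + intros HK H. apply de_sitter_generic; trivial. apply largest_bound, H.
    (* The sign switch exchanges the roles of x and - x. *)
    + intros HK H. rewrite lorentz_model_neg by trivial.
      apply uniquely_realized_switch, de_sitter_generic.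
      * apply topp_nonzero, hx.
      * lra.
      * exact Hn.
      * change (~ triangular (- - co1 x) (- - co2 x) (- - co3 x)). rewrite !Ropp_involutive. exact Hp.
      * apply smallest_bound, H.
Qed.
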